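(* Let $k\geq 2$ be an integer and let $G$ be a $\Delta$-critical graph of order $n$. If $\Delta\geq \frac{2}{3}n+\frac{3k}{2}$ and $\delta(G_{\Delta})\leq k$, then $G$ is overfull.
   Context: All graphs are finite and simple. $\Delta=\Delta(G)$ is the maximum degree and $\chi'(G)$ the chromatic index. $G$ is class 2 if $\chi'(G)=\Delta(G)+1$. A graph $G$ is critical if $\chi'(H)<\chi'(G)$ for every proper subgraph $H$ of $G$; a $\Delta$-critical graph is a critical class 2 graph with maximum degree $\Delta$. $G$ is overfull if $|E(G)|/\lfloor n/2\rfloor>\Delta(G)$, where $n=|V(G)|$. The core $G_\Delta$ of $G$ is the subgraph induced by all vertices of degree $\Delta(G)$, and $\delta(G_\Delta)$ is its minimum degree. *)

(* Defs.v *)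
From mathcomp Require Import all_boot all_order all_algebra.
Set Implicit Arguments.
Unset Strict Implicit.
Unset Printing Implicit Defensive.

(* The vertex set is a field, not the whole of T, so that a graph and all its
   subgraphs, including those with fewer vertices, live in the same type. *)
Record sgraph (T : finType) := SGraph {
  vertices : {set T};
  edges : {set {set T}};
  edgesP : [forall A in edges, (A \subset vertices) && (#|A| == 2)]
}.

Section Graphs.

Variable T : finType.
Implicit Types G H : sgraph T.

Definition degree G (v : T) : nat := #|[set A in edges G | v \in A]|.

Definition max_degree G : nat := \max_(v in vertices G) degree G v.

(* When G has a vertex, every degree is less than #|vertices G|, so that the
   initial value of the minimum is irrelevant. *)
Definition min_degree G : nat :=
  \big[minn/#|vertices G|]_(v in vertices G) degree G v.

Definition edge G : finType := {A : {set T} | A \in edges G}.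

(* Colourings are defined on the type of edges of G, so that an edgeless graph
   is 0-edge-colourable. *)
Definition proper_edge_coloring G (k : nat) (c : {ffun edge G -> 'I_k}) : bool :=
  [forall A : edge G, forall B : edge G,
     (A != B) && (val A :&: val B != set0) ==> (c A != c B)].

Definition edge_colorable G (k : nat) : bool :=
  [exists c : {ffun edge G -> 'I_k}, proper_edge_coloring c].

Lemma edge_colorable_exists G : exists k, edge_colorable G k.
Proof.
exists #|edge G|; apply/existsP; exists [ffun A => enum_rank A].
apply/forallP=> A; apply/forallP=> B; apply/implyP=> /andP[neqAB _].
by rewrite !ffunE (inj_eq enum_rank_inj).
Qed.

Definition chromatic_index G : nat := ex_minn (edge_colorable_exists G).

Definition class2 G : Prop := chromatic_index G = (max_degree G).+1.

Definition subgraph H G : bool :=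
  (vertices H \subset vertices G) && (edges H \subset edges G).

Definition proper_subgraph H G : bool :=
  subgraph H G &&
  ((vertices H != vertices G) || (edges H != edges G)).

Definition critical G : Prop :=
  forall H, proper_subgraph H G -> chromatic_index H < chromatic_index G.

Definition Delta_critical (Delta : nat) G : Prop :=
  [/\ critical G, class2 G & max_degree G = Delta].

Lemma induced_edgesP G (S : {set T}) :
  [forall A in [set A in edges G | A \subset S],
     (A \subset vertices G :&: S) && (#|A| == 2)].
Proof.
apply/forall_inP=> A; rewrite inE subsetI => /andP[AG ->].
by rewrite andbT; exact: (forall_inP (edgesP G)).
Qed.

Definition induced G (S : {set T}) : sgraph T := SGraph (induced_edgesP G S).

Definition core G : sgraph T :=
  induced G [set v in vertices G | degree G v == max_degree G].

(* For graphs with at most one vertex the denominator is 0, hence so is the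
   quotient, and such graphs are not overfull. *)
Definition overfull G : Prop :=
  ((max_degree G)%:R < #|edges G|%:R / (#|vertices G|./2)%:R :> rat)%R.

End Graphs.

(* Main.v *)
Require Import Defs.
From mathcomp Require Import all_boot all_order all_algebra.
From mathcomp Require Import perm zify lra.
From Stdlib Require Import Classical.
Set Implicit Arguments.
Unset Strict Implicit.
Unset Printing Implicit Defensive.

(* Delete a vertex r of full degree with at most k neighbours of full degree, and
   colour the edges of H = G - r with D colours. By criticality the colouring can be
   chosen so that distinct colours th u, one for each neighbour u of r, are missing at
   their vertices except at one root s; it cannot be chosen so that th s is missing at
   s as well, since G is not D-edge-colourable. Put an arrow from v to w when v misses
   th w, other than as its own th v. The vertices reachable from s form the fan F,
   in which predecessors are unique. Counting leaves in it gives Vizing's adjacency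
   lemma.

   Take F of maximal size among the fans containing a neighbour q of r of minimal
   degree. Suppose that some neighbour b of r outside of F misses th s. Choose b so
   that as many vertices as possible reach it. Then, for every deficient vertex u, the
   edge ub can be recoloured by Kempe changes, and following the arrows that this
   creates bounds the number of deficient common neighbours of r, s and b by three
   times the number of full neighbours of r outside of F, plus 1. This contradicts the
   lower bound on the degrees given by D >= 2n/3 + 3k/2. The same count with two
   vertices r and x excludes a vertex x not adjacent to r that misses th s. So th s is
   a perfect matching of H, hence n is odd, and any other colour is missed at most
   twice in H. Counting the missing colours shows that G is overfull. *)

(** * Kempe changes *)

(** Let g be the number of full neighbours of r outside F. As deg r = D, [th] is a bijection onto
    the colours, so the colour of an edge ub is [th w] for one w, and freeing it makes u point to w.
    Distinct u give distinct w. What these w reach stays outside F, never points back to one of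
    them, and has unique predecessors; so it contains at least as many sinks as there are w, and
    sinks are full. This allows at most g deficient u inside F and g outside. Outside, u must
    moreover never become bad: a bad u would let su be recoloured, and F would trade its leaf for a
    full vertex carrying the colour of su. So su must have none of the g colours of full vertices
    outside F; colour [th s] is set aside too, as Kempe changes could turn it into one of them. That
    costs g + 1 vertices u, whence 3g + 1. For x not adjacent to r this restriction disappears,
    since by then no vertex outside F is bad, and 2g remains. Vizing's lemma at q gives g < m - (D -
    deg q), with m the number of full neighbours of r, and both counts come down to 3D + 2 <= 2n +
    4k, against 3D >= 2n + 9k/2. *)

Section Kempe.
Variables (T C : finType) (adj : rel T).
Hypothesis adjC : symmetric adj.
Hypothesis adjI : irreflexive adj.
Variable r : T.
Implicit Types (psi : T -> T -> C) (a b c : C).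

(* The graph [adj] with the vertex [r] deleted; [psi] is only meaningful on its edges. *)
Definition hadj : rel T := fun x y => [&& adj x y, x != r & y != r].

Lemma hadjC : symmetric hadj.
Proof. by move=> x y; rewrite /hadj adjC [(x != r) && _]andbC. Qed.

Lemma hadjI : irreflexive hadj.
Proof. by move=> x; rewrite /hadj adjI. Qed.

Definition proper psi : Prop :=
  (forall x y, hadj x y -> psi x y = psi y x) /\
  (forall x y z, hadj x y -> hadj x z -> psi x y = psi x z -> y = z).

Definition mis psi v : {set C} := [set c | [forall y, hadj v y ==> (psi v y != c)]].

Lemma misP psi v c :
  reflect (forall y, hadj v y -> psi v y != c) (c \in mis psi v).
Proof. by rewrite inE; apply: (iffP forallP) => H y; move/(_ y): H => /implyP. Qed.

Lemma misPn psi v c :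
  reflect (exists2 y, hadj v y & psi v y = c) (c \notin mis psi v).
Proof.
rewrite inE negb_forall; apply: (iffP existsP) => [[y]|[y vy <-]].
  by rewrite negb_imply negbK => /andP[vy /eqP]; exists y.
by exists y; rewrite vy eqxx.
Qed.

Definition kedge psi a b : rel T :=
  fun x y => hadj x y && ((psi x y == a) || (psi x y == b)).

Definition same psi a b : rel T := connect (kedge psi a b).

Lemma kedgeC psi a b : proper psi -> symmetric (kedge psi a b).
Proof.
move=> [sy _] x y; rewrite /kedge hadjC; case yx: (hadj y x) => //=.
by rewrite (sy _ _ yx).
Qed.

Lemma sameC psi a b : proper psi -> symmetric (same psi a b).
Proof. by move=> pr; apply: sym_connect_sym; apply: kedgeC. Qed.

Lemma same_colC psi a b x y : same psi a b x y = same psi b a x y.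
Proof. by apply: eq_connect => u v; rewrite /kedge orbC. Qed.

Lemma same_trans psi a b : transitive (same psi a b).
Proof. exact: connect_trans. Qed.

Lemma same_refl psi a b x : same psi a b x x.
Proof. exact: connect0. Qed.

Lemma same_isolated psi a b x y :
  a \in mis psi x -> b \in mis psi x -> same psi a b x y -> x = y.
Proof.
move=> /misP xa /misP xb /connectP[[|z p] /=]; first by move=> _ ->.
by case/andP=> /andP[xz /orP[|] zc]; [move/negP: (xa _ xz) | move/negP: (xb _ xz)].
Qed.

(* The Kempe chain of [x] is a path that ends at [x]. *)
Definition kend psi a b x := (a \in mis psi x) != (b \in mis psi x).

(** * A Kempe chain has at most two ends *)

Section Ends.
Variables (psi : T -> T -> C) (a b : C).
Hypothesis pr : proper psi.

(** A colour class is a matching, hence an involution whose fixed points are the vertices missing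
    the colour. The product [h] of two of them makes a chain part of an orbit of a permutation. *)
Let f c v := if [pick y | hadj v y && (psi v y == c)] is Some y then y else v.

Let fP c v y : hadj v y -> psi v y = c -> f c v = y.
Proof.
move=> vy vc; rewrite /f; case: pickP => [z /andP[vz /eqP zc]|/(_ y)].
  by apply: (pr.2 v) => //; rewrite zc.
by rewrite vy vc eqxx.
Qed.

Let fix_mis c v : (f c v == v) = (c \in mis psi v).
Proof.
apply/eqP/misP => [fv y vy|H].
  apply/eqP => vc; move: (vy); have -> : y = v by rewrite -(fP vy vc).
  by rewrite hadjI.
rewrite /f; case: pickP => [z /andP[vz zc]|//].
by move/negP: (H _ vz).
Qed.

Let fK c : involutive (f c).
Proof.
move=> v; have [cm|/misPn[y vy vc]] := boolP (c \in mis psi v).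
  by have fv : f c v = v; [apply/eqP; rewrite fix_mis | rewrite !fv].
by rewrite (fP vy vc); apply: fP; rewrite 1?hadjC // -(pr.1 _ _ vy).
Qed.

Let h v := f a (f b v).

Let h_inj : injective h.
Proof. by move=> x y /(can_inj (fK a)) /(can_inj (fK b)). Qed.

(** Conjugation by [f a] inverts [h]. If [f a] fixes [x], it therefore reflects the orbit of [x],
    exchanging the positions i and -i. *)
Let iter_fa i x : f a x = x -> iter i h (f a (iter i h x)) = x.
Proof.
move=> xa; elim: i => // i IH.
rewrite iterSr iterS; have -> : h (f a (h (iter i h x))) = f a (iter i h x).
  by rewrite /h !fK.
exact: IH.
Qed.

Let order_iter i x : iter i h x = x -> order h x %| i.
Proof.
move=> ix; have := divn_eq i (order h x); set n := order h x => iE.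
have q : forall k, iter (k * n) h x = x.
  by elim=> [//|k IH]; rewrite mulSn iterD IH /n iter_order.
have rx : iter (i %% n) h x = x by rewrite -{2}ix {2}iE addnC iterD q.
have rn : i %% n < n by rewrite ltn_mod /n order_gt0.
by rewrite /dvdn -(findex_iter rn) rx findex0.
Qed.

Let same_fconnect x y : a \in mis psi x -> same psi a b x y -> fconnect h x y.
Proof.
rewrite -fix_mis => /eqP xa; move: y.
have fa v : fconnect h x v -> fconnect h x (f a v).
  move/iter_findex => <-; rewrite (fconnect_sym h_inj).
  set w := iter _ h x.
  by have := fconnect_iter h (findex h x v) (f a w); rewrite /w iter_fa.
have fb v : fconnect h x v -> fconnect h x (f b v).
  move=> xv; have -> : f b v = f a (h v) by rewrite /h fK.
  by apply: fa; apply: connect_trans xv (fconnect1 _ _).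
move=> y /connectP[p + ->]; elim/last_ind: p => [//|p z IH].
rewrite rcons_path last_rcons => /andP[/IH xl /andP[lz /orP[] /eqP lc]].
  by rewrite -(fP lz lc); apply: fa.
by rewrite -(fP lz lc); apply: fb.
Qed.

(** An end at position i is fixed by [f a] or by [f b], so the reflection gives a period 2i or 2i +
    1. As 0 < i < n for the order n, that period is n itself, which determines i. *)
Let end_findex x y : a \in mis psi x -> kend psi a b y -> same psi a b x y ->
  x != y -> findex h x y = (order h x)./2.
Proof.
move=> xa ye xy nxy; have hxy := same_fconnect xa xy.
have yE := iter_findex hxy; have iN := findex_max hxy.
set i := findex h x y in yE iN *; set n := order h x in iN *.
have i0 : 0 < i.
  by rewrite lt0n; apply/eqP => i0; move: yE nxy; rewrite i0 /= => ->; rewrite eqxx.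
have {xa}xa : f a x = x by apply/eqP; rewrite fix_mis.
have key : f a y = y \/ f b y = y.
  move: ye; rewrite /kend -!fix_mis.
  have [ay _|_] := eqVneq (f a y) y; first by left.
  by have [yb _|_ //] := eqVneq (f b y) y; right.
case: key => yf.
  have : iter (i + i) h x = x by rewrite iterD yE -{1}yf -yE iter_fa.
  move/order_iter; rewrite -/n => /dvdnP[k kE].
  have : k = 1 by nia.
  by move=> k1; move: kE; rewrite k1; lia.
have yh : f a (h y) = y by rewrite /h fK yf.
have : iter (i.+1 + i) h x = x.
  by rewrite iterD yE -{1}yh -{1}yE -iterS iter_fa.
move/order_iter; rewrite -/n => /dvdnP[k kE].
have : k = 1 by nia.
by move=> k1; move: kE; rewrite k1; lia.
Qed.

Lemma ends3_aux x y z : a \in mis psi x -> kend psi a b y -> kend psi a b z ->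
  same psi a b x y -> same psi a b x z -> x != y -> x != z -> y = z.
Proof.
move=> xa ye ze xy xz nxy nxz.
rewrite -(iter_findex (same_fconnect xa xy)) -(iter_findex (same_fconnect xa xz)).
by rewrite !end_findex.
Qed.
End Ends.

Lemma ends3 psi a b x y z : proper psi ->
  kend psi a b x -> kend psi a b y -> kend psi a b z ->
  same psi a b x y -> same psi a b x z -> x != y -> x != z -> y = z.
Proof.
move=> pr xe ye ze xy xz nxy nxz.
have [xa|xa] := boolP (a \in mis psi x); first exact: (ends3_aux pr xa ye ze).
have xb : b \in mis psi x by move: xe; rewrite /kend (negbTE xa); case: (b \in _).
have sw v : kend psi a b v -> kend psi b a v by rewrite /kend eq_sym.
by apply: (ends3_aux pr xb (sw _ ye) (sw _ ze)); rewrite // same_colC.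
Qed.

Definition kswap psi a b x : T -> T -> C :=
  fun v z => if same psi a b x v then tperm a b (psi v z) else psi v z.

Section Swap.
Variables (psi : T -> T -> C) (a b : C) (x : T).
Hypothesis pr : proper psi.

Lemma kswap_proper : proper (kswap psi a b x).
Proof.
split=> [v z vz|v y z vy vz].
  rewrite /kswap -(pr.1 _ _ vz).
  have [vc|] := boolP ((psi v z == a) || (psi v z == b)).
    have kvz : kedge psi a b v z by rewrite /kedge vz vc.
    have svz : same psi a b v z := connect1 kvz.
    have -> : same psi a b x z = same psi a b x v; last by [].
    apply/idP/idP => H; last exact: same_trans H svz.
    by apply: same_trans H _; rewrite sameC.
  rewrite negb_or => /andP[na nb].
  by case: ifP; case: ifP => //; rewrite tpermD 1?eq_sym.
rewrite /kswap; case: ifP => _; last exact: pr.2.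
by move/perm_inj; apply: pr.2.
Qed.

Lemma mis_kswap v c :
  (c \in mis (kswap psi a b x) v) =
  ((if same psi a b x v then tperm a b c else c) \in mis psi v).
Proof.
rewrite !inE; apply: eq_forallb => z; congr (_ ==> _); rewrite /kswap.
by case: ifP => // _; rewrite -(inj_eq (@perm_inj _ (tperm a b))) tpermK.
Qed.
End Swap.

Definition recol psi (u t : T) c : T -> T -> C :=
  fun v z => if ((v == u) && (z == t)) || ((v == t) && (z == u)) then c else psi v z.

Section Recol.
Variables (psi : T -> T -> C) (u t : T) (c : C).
Hypothesis pr : proper psi.
Hypothesis ut : hadj u t.
Hypotheses (cu : c \in mis psi u) (ct : c \in mis psi t).

Let nut : u != t. Proof. by apply: contraTneq ut => ->; rewrite hadjI. Qed.

Lemma recol_proper : proper (recol psi u t c).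
Proof.
have cu' z : hadj u z -> psi u z != c by move/(misP _ _ _ cu).
have ct' z : hadj t z -> psi t z != c by move/(misP _ _ _ ct).
split=> [v z vz|v y z vy vz].
  by rewrite /recol [(z == u) && _]andbC [(z == t) && _]andbC orbC (pr.1 _ _ vz).
rewrite /recol; case: ifP => [|vyN]; case: ifP => [|vzN].
- move=> vzt vyt _; move: vyt vzt => /orP[] /andP[/eqP-> /eqP->].
    by rewrite eqxx (negbTE nut) orbF /= => /eqP->.
  by rewrite eqxx [t == u]eq_sym (negbTE nut) /= => /eqP->.
- move=> vyt E; case/orP: vyt => /andP[/eqP vE _]; rewrite vE in vz E.
    by move: (cu' _ vz); rewrite -E eqxx.
  by move: (ct' _ vz); rewrite -E eqxx.
- move=> vzt E; case/orP: vzt => /andP[/eqP vE _]; rewrite vE in vy E.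
    by move: (cu' _ vy); rewrite E eqxx.
  by move: (ct' _ vy); rewrite E eqxx.
- exact: pr.2.
Qed.

Lemma mis_recol v d : (d \in mis (recol psi u t c) v) =
  if (v == u) || (v == t) then (d != c) && ((d == psi u t) || (d \in mis psi v))
  else d \in mis psi v.
Proof.
case: ifP => [vub|/norP[vu vb]]; last first.
  rewrite !inE; apply: eq_forallb => z; congr (_ ==> _).
  by rewrite /recol (negbTE vu) (negbTE vb).
pose w := if v == u then t else u.
have vw : hadj v w.
  by move: vub; rewrite /w; case: eqP => [-> //|_] /= /eqP ->; rewrite hadjC.
have wE : psi v w = psi u t.
  by move: vub; rewrite /w; case: eqP => [-> //|_] /= /eqP ->; rewrite (pr.1 _ _ ut).
have rE z : recol psi u t c v z = if z == w then c else psi v z.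
  rewrite /recol /w; case: (eqVneq v u) vub => [->|nvu] /=.
    by rewrite (negbTE nut) orbF.
  by move=> ->.
have cv : c \in mis psi v by case/orP: vub => /eqP->.
apply/misP/andP=> [H|[dc]].
  split; first by have := H _ vw; rewrite rE eqxx eq_sym.
  have [//|dn] /= := eqVneq d; apply/misP=> z vz; have := H _ vz; rewrite rE.
  by case: (z =P w) => // -> _; rewrite wE eq_sym.
case/orP=> [/eqP dE z vz|/misP H z vz]; rewrite rE; case: (z =P w) => [_|zw].
- by rewrite eq_sym.
- by apply/eqP=> E; apply: zw; apply: (pr.2 v) => //; rewrite E wE.
- by rewrite eq_sym.
- exact: H.
Qed.
End Recol.
End Kempe.

(** * Fans *)

Lemma connect_agree (T : finType) (e e' : rel T) s :
  (forall v, connect e s v -> e v =1 e' v) -> connect e s =1 connect e' s.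
Proof.
move=> H v; apply/idP/idP => /connectP[p + ->] {v}.
  elim/last_ind: p => [//|p z IH]; rewrite rcons_path last_rcons.
  case/andP=> sp lz; apply: (connect_trans (IH sp)); apply: connect1.
  by rewrite -H //; apply/connectP; exists p.
elim/last_ind: p => [//|p z IH]; rewrite rcons_path last_rcons.
by case/andP=> /IH sp lz; apply: (connect_trans sp); apply: connect1; rewrite H.
Qed.

Lemma connect_ind (T : finType) (e : rel T) s (P : T -> Prop) : P s ->
  (forall y x, connect e s y -> P y -> e y x -> P x) ->
  forall v, connect e s v -> P v.
Proof.
move=> Ps H v /connectP[p + ->] {v}; elim/last_ind: p => [//|p z IH].
rewrite rcons_path last_rcons => /andP[sp lz].
by apply: H (IH sp) lz; apply/connectP; exists p.
Qed.

Lemma connect_first (T : finType) (e : rel T) x y :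
  connect e x y -> x != y -> exists2 z, e x z & connect e z y.
Proof.
case/connectP=> [[|z p] /=]; first by move=> _ ->; rewrite eqxx.
by case/andP=> xz zp -> _; exists z => //; apply/connectP; exists p.
Qed.

Lemma connect_last (T : finType) (e : rel T) x y :
  connect e x y -> x != y -> exists2 z, connect e x z & e z y.
Proof.
case/connectP=> p; elim/last_ind: p => [|p z _] /=; first by move=> _ ->; rewrite eqxx.
rewrite rcons_path last_rcons => /andP[xp lz] -> _.
by exists (last x p) => //; apply/connectP; exists p.
Qed.

(** * Partial colourings, arrows and the fan of the root *)

Section State.
Variables (T C : finType) (adj : rel T).
Hypothesis adjC : symmetric adj.
Hypothesis adjI : irreflexive adj.
Variable r : T.
Implicit Types (psi : T -> T -> C) (th : T -> C) (c : C) (s u v w x y z : T).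

Local Notation mis := (mis adj r).
Local Notation same := (same adj r).
Local Notation proper := (proper adj r).
Local Notation hadj := (hadj adj r).

Definition nbr : {set T} := [set z | adj r z].
Local Notation N := nbr.

Lemma nbr_neq z : z \in N -> z != r.
Proof. by apply: contraTneq => ->; rewrite inE adjI. Qed.

(* The colours missing at [v] once the edge [r v] has received the colour [th v]. *)
Definition fr psi th v : {set C} := if v \in N then mis psi v :\ th v else mis psi v.

Definition arrow psi th : rel T := fun v w => (w \in N) && (th w \in fr psi th v).

(* [psi], together with [th] on the edges at [r], colours all edges but [r s]; the
   colour [th s] is the only one free at [r] when [N] has as many elements as [C]. *)
Definition valid psi th s : Prop :=
  [/\ proper psi, s \in N, {in N &, injective th} &
      forall u, u \in N -> u != s -> th u \in mis psi u].

(** The last arrow is split off so that the path is never empty: for [u] equal to [s] this means a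
    cycle through the root. *)
Definition bad psi th s u : Prop :=
  exists2 z, connect (arrow psi th) u z & arrow psi th z s.

(** A counterexample would colour the whole graph, with [th] on the edges at [r]. *)
Definition uncolorable : Prop :=
  forall psi th, proper psi -> {in N &, injective th} ->
  exists2 u, u \in N & th u \notin mis psi u.

Lemma fr_mis psi th v c : c \in fr psi th v -> c \in mis psi v.
Proof. by rewrite /fr; case: ifP => // _; rewrite in_setD1 => /andP[]. Qed.

Lemma arrow_nbr psi th v w : arrow psi th v w -> w \in N.
Proof. by case/andP. Qed.

Lemma arrow_mis psi th v w : arrow psi th v w -> th w \in mis psi v.
Proof. by case/andP=> _ /fr_mis. Qed.

Lemma arrowI psi th v w : v \in N -> arrow psi th v w -> v != w.
Proof.
move=> vN /andP[_]; rewrite /fr vN in_setD1 => /andP[+ _].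
by apply: contra_neq => ->.
Qed.

Lemma arrow_irr psi th v : arrow psi th v v = false.
Proof.
by apply/negP=> H; have := arrowI (arrow_nbr H) H; rewrite eqxx.
Qed.

Lemma arrowE psi th v w : {in N &, injective th} -> v \in N -> w \in N ->
  arrow psi th v w = (v != w) && (th w \in mis psi v).
Proof.
move=> inj vN wN; rewrite /arrow wN /fr vN in_setD1 eq_sym.
by congr (~~ _ && _); apply/eqP/eqP => [/inj->|->].
Qed.

Lemma connect_nbr psi th u v : u \in N -> connect (arrow psi th) u v -> v \in N.
Proof.
move=> uN; move: v; apply: (connect_ind (P := fun v => v \in N)) => //.
by move=> y x _ _ /arrow_nbr.
Qed.

(** Each vertex takes the colour of its successor, and the last one that of [u]. Built from the far
    end, with one transposition per step, so that injectivity is preserved. *)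
Lemma shift_path psi th u t p : {in N &, injective th} -> u \in N ->
  path (arrow psi th) u p -> last u p = t -> uniq (u :: p) ->
  exists th', [/\ {in N &, injective th'},
    forall z, z \in u :: p -> z != t -> th' z \in mis psi z,
    th' t = th u & forall z, z \notin u :: p -> th' z = th z].
Proof.
move=> inj; elim: p u => [|v p IH] u uN /=.
  move=> _ <- _; exists th; split=> // z; rewrite inE => /eqP->.
  by rewrite eqxx.
case/andP=> uv vp lt /andP[uvp vuniq]; have vN := arrow_nbr uv.
have [th1 [inj1 mis1 t1 off1]] := IH v vN vp lt vuniq.
have tN : t \in N.
  by apply: (connect_nbr (psi := psi) (th := th) vN); apply/connectP; exists p.
have tin : t \in v :: p by rewrite -lt mem_last.
have ut : u != t by apply: contraNneq uvp => ->.
exists (fun z => th1 (tperm u t z)); split.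
- move=> y z yN zN /inj1 E; apply: (@perm_inj _ (tperm u t)); apply: E.
    by case: tpermP => // ->.
  by case: tpermP => // ->.
- move=> z; rewrite inE; case: (eqVneq z u) => [->|zu] /= zin zt.
    by rewrite tpermL t1; apply: arrow_mis uv.
  by rewrite tpermD 1?eq_sym //; apply: mis1.
- by rewrite tpermR off1.
- move=> z; rewrite inE negb_or => /andP[zu zvp].
  by rewrite tpermD 1?eq_sym // ?off1 //; apply: contraNneq zvp => ->.
Qed.

Lemma shift_connect psi th u t : {in N &, injective th} -> u \in N ->
  connect (arrow psi th) u t ->
  exists th' (P : {set T}), [/\ {in N &, injective th'},
    forall z, z \in P -> z != t -> th' z \in mis psi z,
    th' t = th u, forall z, z \notin P -> th' z = th z &
    forall z, z \in P ->
      connect (arrow psi th) u z /\ connect (arrow psi th) z t].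
Proof.
move=> inj uN /connectP[p0 /shortenP[p up uniqp _] tE].
have [th' [a b c d]] := shift_path inj uN up (esym tE) uniqp.
exists th', [set z in u :: p]; split=> //.
- by move=> z; rewrite inE; apply: b.
- by move=> z; rewrite inE; apply: d.
move=> z; rewrite inE => zin; case/splitPl: zin up tE => p1 p2 lz.
rewrite cat_path last_cat lz => /andP[p1P p2P] tE; split; apply/connectP.
  by exists p1.
by exists p2.
Qed.

Section Fan.
Hypothesis unc : uncolorable.

Lemma root_mis psi th s : valid psi th s -> th s \notin mis psi s.
Proof.
case=> pr sN inj val; have [u uN] := unc pr inj.
by have [->//|us] := eqVneq u s; rewrite val.
Qed.

(** Rotating the colours along a cycle through the root would give the root a colour that it
    misses. *)
Lemma not_bad_root psi th s : valid psi th s -> ~ bad psi th s s.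
Proof.
move=> V [z sz zs]; have [pr sN inj val] := V.
have nsz : s != z by apply: contraTneq zs => <-; rewrite arrow_irr.
have [w sw wz] := connect_first sz nsz.
have ws : connect (arrow psi th) w s := connect_trans wz (connect1 zs).
have [th' [P [inj' mis' thS off _]]] := shift_connect inj (arrow_nbr sw) ws.
have [u uN] := unc pr inj'; case/negP.
have [->|us] := eqVneq u s; first by rewrite thS (arrow_mis sw).
have [uP|uP] := boolP (u \in P); first exact: mis'.
by rewrite off // val.
Qed.

Lemma fr_root psi th s : valid psi th s -> fr psi th s = mis psi s.
Proof.
move=> V; have := root_mis V; have [_ sN _ _] := V.
rewrite /fr sN => H; apply/setP=> c; rewrite in_setD1.
by have [->|//] := eqVneq c (th s); rewrite (negbTE H).
Qed.

Lemma good_mis psi th s u z : valid psi th s -> ~ bad psi th s u ->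
  connect (arrow psi th) u z -> th s \notin mis psi z.
Proof.
move=> V nb uz; have [pr sN inj val] := V.
have [->|zs] := eqVneq z s; first exact: root_mis.
apply/negP=> H; apply: nb; exists z => //.
rewrite /arrow sN /fr; case: ifP => // zN; rewrite in_setD1 H andbT.
by apply: contra_neq zs => /inj->.
Qed.

Definition sw psi th s w z := kswap adj r psi (th s) (th w) z.

Section Swap.
Variables (psi : T -> T -> C) (th : T -> C) (s w z : T).
Hypothesis V : valid psi th s.
Hypotheses (wN : w \in N) (ws : w != s).
Hypothesis zw : ~~ same psi (th s) (th w) z w.
Local Notation psi' := (sw psi th s w z).

Lemma mis_sw v c : (c \in mis psi' v) =
  ((if same psi (th s) (th w) z v then tperm (th s) (th w) c else c) \in mis psi v).
Proof. by have [pr _ _ _] := V; apply: mis_kswap. Qed.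

Lemma mis_sw_other v c : c != th s -> c != th w ->
  (c \in mis psi' v) = (c \in mis psi v).
Proof. by move=> cs cw; rewrite mis_sw; case: ifP => // _; rewrite tpermD 1?eq_sym. Qed.

(** Among the neighbours of [r] other than the root, only [w] has its own colour among the two
    exchanged, and [w] is off the chain. *)
Lemma sw_valid : valid psi' th s.
Proof.
have [pr sN inj val] := V; split=> //; first exact: kswap_proper.
move=> u uN us; rewrite mis_sw; case: ifP => zu; last exact: val.
have uw : u != w by apply: contraNneq zw => E; rewrite -{2}E.
by rewrite tpermD ?val // (inj_in_eq inj) // eq_sym.
Qed.

Lemma arrow_sw v x : arrow psi' th v x =
  arrow psi th v (if same psi (th s) (th w) z v then tperm s w x else x).
Proof.
have [pr sN inj val] := V; have V' := sw_valid.
have xN : (tperm s w x \in N) = (x \in N) by case: tpermP => // ->; rewrite ?wN ?sN.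
have frE : fr psi' th v = if same psi (th s) (th w) z v
    then [set c | tperm (th s) (th w) c \in fr psi th v] else fr psi th v.
  have [->|vs] := eqVneq v s.
    rewrite (fr_root V') (fr_root V); apply/setP=> c.
    by rewrite mis_sw; case: ifP => //; rewrite inE.
  apply/setP=> c; rewrite /fr; case: ifP => vN; last first.
    by rewrite mis_sw; case: ifP => //; rewrite inE.
  rewrite in_setD1 mis_sw; case: ifP => zv; last by rewrite in_setD1.
  rewrite inE in_setD1; congr (~~ _ && _).
  have vw : v != w by apply/eqP=> E; case/negP: zw; rewrite -{2}E.
  have tv : tperm (th s) (th w) (th v) = th v.
    by rewrite tpermD // (inj_in_eq inj) // eq_sym.
  by rewrite -{2}tv (inj_eq perm_inj).
rewrite /arrow frE; case: ifP => zv //; rewrite xN inE.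
case xN': (x \in N) => //=.
suff -> : tperm (th s) (th w) (th x) = th (tperm s w x) by [].
case: (tpermP s w x) => [->|->|/eqP xs /eqP xw]; rewrite ?tpermL ?tpermR //.
by rewrite tpermD // (inj_in_eq inj) // eq_sym.
Qed.

Lemma arrow_sw_other v x : x != s -> x != w -> arrow psi' th v x = arrow psi th v x.
Proof. by move=> xs xw; rewrite arrow_sw; case: ifP => // _; rewrite tpermD 1?eq_sym. Qed.

Lemma arrow_sw_end : arrow psi th z w -> arrow psi' th z s.
Proof. by move=> a; rewrite arrow_sw same_refl tpermL. Qed.

(* The new path to s starts as the old one, but leaves it as soon as a vertex of the
   Kempe chain pointed to w. *)
Lemma bad_sw u : ~ bad psi th s u -> connect (arrow psi th) u z ->
  arrow psi th z w -> bad psi' th s u.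
Proof.
move=> nb /connectP[p]; elim: p u nb => [|v p IH] u nb /=.
  by move=> _ zE a; exists z; [rewrite -zE connect0 | apply: arrow_sw_end].
case/andP=> uv vp zE a.
have nbv : ~ bad psi th s v.
  by case=> y vy ys; apply: nb; exists y => //; apply: connect_trans (connect1 uv) vy.
have vs : v != s.
  by apply: contraPneq nb => vs; case; exists u; rewrite ?connect0 // -vs.
have [y vy ys] := IH v nbv vp zE a.
have [vw|vw] := eqVneq v w; last first.
  exists y => //; apply: connect_trans vy; apply: connect1.
  by rewrite arrow_sw_other.
have [zu|zu] := boolP (same psi (th s) (th w) z u).
  by exists u; [apply: connect0 | rewrite arrow_sw zu tpermL -vw].
by exists y => //; apply: connect_trans vy; apply: connect1; rewrite arrow_sw (negbTE zu).
Qed.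
End Swap.

(** Otherwise a change on the chain of [y] would redirect its arrow from [w] to the root and close a
    cycle. *)
Lemma fan_link psi th s y w : valid psi th s -> connect (arrow psi th) s y ->
  arrow psi th y w -> w != s /\ same psi (th s) (th w) y w.
Proof.
move=> V sy yw; have nb := not_bad_root V.
have ws : w != s by apply/eqP=> ws; apply: nb; exists y => //; rewrite -ws.
split=> //; apply/negPn/negP=> nyw.
have V' := sw_valid V (arrow_nbr yw) nyw.
by apply: (not_bad_root V'); apply: (bad_sw V (arrow_nbr yw) nyw nb sy yw).
Qed.

Lemma arrow_kend psi th s y w : valid psi th s -> arrow psi th y w ->
  th s \notin mis psi y -> kend adj r psi (th s) (th w) y.
Proof. by move=> V yw ny; rewrite /kend (negbTE ny) (arrow_mis yw). Qed.

Lemma fan_kend psi th s w : valid psi th s -> connect (arrow psi th) s w -> w != s ->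
  kend adj r psi (th s) (th w) w.
Proof.
move=> V sw ws; rewrite /kend (negbTE (good_mis V (not_bad_root V) sw)).
by have [_ sN _ val] := V; rewrite val // (connect_nbr sN sw).
Qed.

(** By [fan_link], the vertex [w] and all its predecessors in the fan are ends of one chain. *)
Lemma fan_uniq psi th s y z w : valid psi th s -> connect (arrow psi th) s y ->
  connect (arrow psi th) s z -> arrow psi th y w -> arrow psi th z w -> y = z.
Proof.
move=> V sy sz yw zw; have [ws lyw] := fan_link V sy yw; have [_ lzw] := fan_link V sz zw.
have [pr sN _ _] := V.
have nm t : connect (arrow psi th) s t -> th s \notin mis psi t.
  by apply: good_mis V (not_bad_root V).
have swc : connect (arrow psi th) s w := connect_trans sy (connect1 yw).
apply: (ends3 (x := w) adjC adjI pr (fan_kend V swc ws)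
  (arrow_kend V yw (nm _ sy)) (arrow_kend V zw (nm _ sz))).
- by rewrite sameC.
- by rewrite sameC.
- by rewrite eq_sym (arrowI (connect_nbr sN sy) yw).
- by rewrite eq_sym (arrowI (connect_nbr sN sz) zw).
Qed.

(* The ends of the Kempe chain of w are w and its predecessor y in the fan. *)
Lemma fan_not_same psi th s y w z : valid psi th s -> connect (arrow psi th) s y ->
  arrow psi th y w -> kend adj r psi (th s) (th w) z -> z != y -> z != w ->
  ~~ same psi (th s) (th w) z w /\ ~~ same psi (th s) (th w) z y.
Proof.
move=> V sy yw kz zy zw; have [ws lyw] := fan_link V sy yw.
have [pr sN _ _] := V.
have ny : th s \notin mis psi y by apply: good_mis V (not_bad_root V) sy.
have swc : connect (arrow psi th) s w := connect_trans sy (connect1 yw).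
have yNw : y != w := arrowI (connect_nbr sN sy) yw.
have H : ~~ same psi (th s) (th w) z w.
  apply/negP=> szw; have E : z = y; last by rewrite E eqxx in zy.
  apply: (ends3 (x := w) adjC adjI pr (fan_kend V swc ws) kz (arrow_kend V yw ny));
    by rewrite 1?sameC // eq_sym.
by split=> //; apply: contra H => szy; apply: same_trans szy lyw.
Qed.

(** A fan vertex on the chain of [z] points neither to [s] nor to [w]: by [fan_link], the latter
    would put [w] on that chain. So transposing these two targets alters nothing in the fan. *)
Lemma fan_sw psi th s w z : valid psi th s -> w \in N -> w != s ->
  ~~ same psi (th s) (th w) z w ->
  connect (arrow psi th) s =1 connect (arrow (sw psi th s w z) th) s.
Proof.
move=> V wN ws zw; apply: connect_agree => v sv x.
rewrite (arrow_sw V wN zw); case: ifP => // zv.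
have vs : arrow psi th v s = false.
  by apply/negP=> a; have [] := fan_link V sv a; rewrite eqxx.
have vw : arrow psi th v w = false.
  apply/negP=> a; have [_ l] := fan_link V sv a; case/negP: zw.
  exact: same_trans zv l.
by case: tpermP => [->|->|] //; rewrite vs vw.
Qed.

Lemma fan_mis_sw psi th s w z v : valid psi th s -> w \in N -> w != s ->
  ~~ same psi (th s) (th w) z w -> connect (arrow psi th) s v ->
  mis (sw psi th s w z) v = mis psi v.
Proof.
move=> V wN ws zw sv; apply/setP=> c; rewrite (mis_sw _ _ V); case: ifP => // zv.
have sm := good_mis V (not_bad_root V) sv.
have [pr sN inj val] := V.
have wm : th w \notin mis psi v.
  apply/negP=> H; have vw : v != w by apply/eqP=> E; case/negP: zw; rewrite -{2}E.
  have a : arrow psi th v w by rewrite arrowE // ?vw ?(connect_nbr sN sv).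
  by have [_ l] := fan_link V sv a; case/negP: zw; apply: same_trans zv l.
by case: tpermP => [->|->|] //; rewrite (negbTE sm) (negbTE wm).
Qed.

(** The edge [r s] takes the colour of [r t], which [s] misses, and [r t] becomes the uncoloured
    edge. The arrow between [s] and [t] is reversed. *)
Lemma reroot1 psi th s t : valid psi th s -> arrow psi th s t ->
  exists th', [/\ valid psi th' t, th' t = th s, th' s = th t,
    forall v, v != s -> v != t -> th' v = th v &
    connect (arrow psi th) s =1 connect (arrow psi th') t].
Proof.
move=> V st; have [pr sN inj val] := V; have tN := arrow_nbr st.
have nst : s != t := arrowI sN st.
pose th' v := th (tperm s t v).
have tpN v : (tperm s t v \in N) = (v \in N) by case: tpermP => // ->; rewrite ?sN ?tN.
have inj' : {in N &, injective th'}.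
  move=> y z yN zN /inj E; apply: (@perm_inj _ (tperm s t)); apply: E; by rewrite tpN.
have th's : th' s = th t by rewrite /th' tpermL.
have th't : th' t = th s by rewrite /th' tpermR.
have th'o v : v != s -> v != t -> th' v = th v by move=> vs vt; rewrite /th' tpermD 1?eq_sym.
have V' : valid psi th' t.
  split=> // u uN ut; have [->|us] := eqVneq u s; first by rewrite th's (arrow_mis st).
  by rewrite th'o // val.
exists th'; split=> // v; apply/idP/idP.
  have t_s : arrow psi th' t s by rewrite arrowE // eq_sym nst th's val // eq_sym.
  apply: (connect_ind (P := fun v => connect (arrow psi th') t v)) => [|y x sy ty yx]; first exact: connect1.
  have yN := connect_nbr sN sy; have xN := arrow_nbr yx.
  have [->|xs] := eqVneq x s; first exact: connect1.
  have [->|xt] := eqVneq x t; first exact: connect0.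
  apply: (connect_trans ty); apply: connect1.
  by rewrite arrowE // th'o // (arrow_mis yx) (arrowI yN yx).
apply: (connect_ind (P := fun v => connect (arrow psi th) s v)) => [|y x ty sy yx]; first exact: connect1.
have yN := connect_nbr tN ty; have xN := arrow_nbr yx.
have [->|xs] := eqVneq x s; first exact: connect0.
have [->|xt] := eqVneq x t; first exact: connect1.
apply: (connect_trans sy); apply: connect1.
by rewrite arrowE // -th'o // (arrow_mis yx) (arrowI yN yx).
Qed.

Lemma reroot psi th s u : valid psi th s -> connect (arrow psi th) s u ->
  exists th', [/\ valid psi th' u, th' u = th s,
    forall v, ~~ connect (arrow psi th) s v -> th' v = th v &
    connect (arrow psi th) s =1 connect (arrow psi th') u].
Proof.
move=> V /connectP[p0 /shortenP[p + + _] ->] {p0}.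
elim: p s th V => [|t p IH] s th V /=; first by exists th.
case/andP=> st tp /andP[stp uniqp].
have [th1 [V1 t1 _ off1 eq1]] := reroot1 V st.
have [pr sN inj val] := V; have [_ tN inj1 _] := V1.
have tp1 : path (arrow psi th1) t p.
  apply: (sub_in_path (P := fun x => (x \in t :: p) && connect (arrow psi th) s x)) (tp); last first.
    apply/allP=> x xt; rewrite xt; apply: connect_trans (connect1 st) _.
    exact: path_connect tp _ xt.
  move=> y x /andP[ytp sy] /andP[xtp sx] yx.
  have yN := connect_nbr sN sy; have xN := arrow_nbr yx.
  (* A later arrow of the path into [t] would give [t] a predecessor other than [s]. *)
  have xt : x != t.
    apply: contraNneq stp => xt; rewrite xt in yx.
    by rewrite (fan_uniq V (connect0 _ s) sy st yx).
  have xs : x != s by apply: contraNneq stp => <-.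
  by rewrite arrowE // off1 // (arrow_mis yx) (arrowI yN yx).
have [th' [V' tE off' eq']] := IH t th1 V1 tp1 uniqp.
exists th'; split=> //; first by rewrite tE.
  move=> v sv; rewrite off' -?eq1 // off1 //.
    by apply: contraNneq sv => ->; apply: connect0.
  by apply: contraNneq sv => ->; apply: connect1.
by move=> v; rewrite eq1 eq'.
Qed.
End Fan.
End State.

(** * Recolouring an edge *)

(** Choosing a successor maps the vertices of [X] that have one injectively into [X :\: W]; the
    sinks make up for the loss of [W]. *)
Lemma card_sources (T : finType) (e : rel T) (X W : {set T}) :
  W \subset X ->
  (forall x y, x \in X -> e x y -> y \in X :\: W) ->
  (forall x x' y, x \in X -> x' \in X -> e x y -> e x' y -> x = x') ->
  #|W| <= #|[set x in X | ~~ [exists y, e x y]]|.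
Proof.
move=> WX out uniq.
pose Y := [set x in X | [exists y, e x y]].
pose f x := if [pick y | e x y] is Some y then y else x.
have fP x : x \in Y -> e x (f x).
  rewrite inE /f => /andP[_ /existsP[y xy]]; case: pickP => // /(_ y).
  by rewrite xy.
have YX : {subset Y <= X} by move=> x; rewrite inE => /andP[].
have finj : {in Y &, injective f}.
  move=> x x' xY x'Y fE; apply: (uniq x x' (f x)); rewrite ?YX ?fP //.
  by rewrite fE fP.
have : #|Y| <= #|X :\: W|.
  rewrite -(card_in_imset finj); apply: subset_leq_card.
  by apply/subsetP=> z /imsetP[x xY ->]; apply: out (fP _ xY); apply: YX.
have XE : #|X| = #|Y| + #|[set x in X | ~~ [exists y, e x y]]|.
  rewrite -(cardsID [set x | [exists y, e x y]] X); congr (_ + _).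
    by apply: eq_card => x; rewrite !inE.
  by apply: eq_card => x; rewrite !inE andbC.
rewrite cardsD (setIidPr WX) XE.
have := subset_leq_card WX; rewrite XE.
lia.
Qed.

Section Recolouring.
Variables (T C : finType) (adj : rel T).
Hypothesis adjC : symmetric adj.
Hypothesis adjI : irreflexive adj.
Variable r : T.
Implicit Types (psi : T -> T -> C) (a t c : C) (u b x y z : T).

Local Notation mis := (mis adj r).
Local Notation same := (same adj r).
Local Notation proper := (proper adj r).
Local Notation hadj := (hadj adj r).
Local Notation kswap := (kswap adj r).

Lemma same_kswap psi a t z : same (kswap psi a t z) a t =2 same psi a t.
Proof.
apply: eq_connect => x y; rewrite /kedge /kswap.
case: ifP => // _; congr (_ && _).
by case: tpermP => [->|->|/eqP/negbTE-> /eqP/negbTE->]; rewrite ?eqxx ?orbT.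
Qed.

Lemma kswap_edge psi a t z x y :
  psi x y != a -> psi x y != t -> kswap psi a t z x y = psi x y.
Proof. by move=> na nt; rewrite /kswap; case: ifP => // _; rewrite tpermD // eq_sym. Qed.

Lemma kswap_edge_off psi a t z x y : ~~ same psi a t z x -> kswap psi a t z x y = psi x y.
Proof. by rewrite /kswap => /negbTE->. Qed.

(* Frees [t] at [b] by a Kempe change if needed, then gives [t] to the edge [u b]. *)
Definition mid psi a t u b :=
  recol (if t \in mis psi b then psi else kswap psi a t b) u b t.

Section Mid.
Variables (psi : T -> T -> C) (a t : C) (u b : T).
Hypothesis pr : proper psi.
Hypothesis ub : hadj u b.
Hypotheses (ab : a \in mis psi b) (tu : t \in mis psi u) (au : a \notin mis psi u).
Hypothesis nbu : ~~ same psi a t b u.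
Local Notation d := (psi u b).
Local Notation psi' := (mid psi a t u b).
Let psi1 := if t \in mis psi b then psi else kswap psi a t b.

Let pr1 : proper psi1.
Proof. by rewrite /psi1; case: ifP => // _; apply: kswap_proper. Qed.

Let nat_ : a != t. Proof. by apply: contraNneq au => ->. Qed.

Lemma mid_neq : [/\ d != a, d != t & u != b].
Proof.
split; last by apply: contraTneq ub => ->; rewrite hadjI.
  by rewrite (pr.1 _ _ ub); move/misP: ab; apply; rewrite hadjC.
by move/misP: tu; apply.
Qed.

Let mis1 x c : (c \in mis psi1 x) =
  ((if (t \notin mis psi b) && same psi a t b x then tperm a t c else c) \in mis psi x).
Proof. by rewrite /psi1; case: ifP => //= tb; rewrite mis_kswap. Qed.

Let d1 : psi1 u b = d.
Proof. by rewrite /psi1; case: ifP => // _; rewrite kswap_edge_off. Qed.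

Let tb1 : t \in mis psi1 b.
Proof. by rewrite mis1 same_refl andbT; case: ifP => [_|/negbFE]; rewrite ?tpermR. Qed.

Let u1 c : (c \in mis psi1 u) = (c \in mis psi u).
Proof. by rewrite mis1 (negbTE nbu) andbF. Qed.

Let tu1 : t \in mis psi1 u. Proof. by rewrite u1. Qed.

Let mis' x c : (c \in mis psi' x) =
  if (x == u) || (x == b) then (c != t) && ((c == d) || (c \in mis psi1 x))
  else c \in mis psi1 x.
Proof. by rewrite /mid -/psi1 mis_recol // d1. Qed.

Lemma mid_proper : proper psi'.
Proof. exact: recol_proper. Qed.

Lemma mid_mis x c : c != a -> c != t -> c != d -> (c \in mis psi' x) = (c \in mis psi x).
Proof.
move=> ca ct cd; rewrite mis' (negbTE cd) ct /= mis1.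
by case: ifP => _; case: ifP => // _; rewrite tpermD // eq_sym.
Qed.

Lemma mid_mis_d x : x != u -> x != b -> (d \in mis psi' x) = (d \in mis psi x).
Proof.
have [da dt _] := mid_neq.
move=> /negbTE xu /negbTE xb; rewrite mis' xu xb mis1.
by case: ifP => // _; rewrite tpermD // eq_sym.
Qed.

Lemma mid_mis_off x c : x != u -> x != b -> ~~ same psi a t b x ->
  (c \in mis psi' x) = (c \in mis psi x).
Proof.
move=> /negbTE xu /negbTE xb /negbTE bx.
by rewrite mis' xu xb mis1 bx andbF.
Qed.

Lemma mid_mis_off2 x c : x != u -> x != b -> a \notin mis psi x -> t \notin mis psi x ->
  (c \in mis psi' x) = (c \in mis psi x).
Proof.
move=> /negbTE xu /negbTE xb /negbTE ax /negbTE tx; rewrite mis' xu xb mis1.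
by case: ifP => // _; case: tpermP => [->|->|]; rewrite ?ax ?tx.
Qed.

Lemma mid_u c : (c \in mis psi' u) = (c != t) && ((c == d) || (c \in mis psi u)).
Proof. by rewrite mis' eqxx u1. Qed.

Lemma mid_u_a : a \notin mis psi' u.
Proof. by have [da _ _] := mid_neq; rewrite mid_u (negbTE au) orbF [a == d]eq_sym (negbTE da) andbF. Qed.

Lemma mid_b_d : d \in mis psi' b.
Proof. by have [_ dt _] := mid_neq; rewrite mis' eqxx orbT dt eqxx. Qed.

Lemma mid_b_a : (a \in mis psi' b) = (t \in mis psi b).
Proof.
have [da _ _] := mid_neq.
rewrite mis' eqxx orbT nat_ [a == d]eq_sym (negbTE da) /= mis1 same_refl andbT.
by case: ifP => [_|/negbFE ->]; rewrite ?tpermL.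
Qed.

Lemma mid_edge x y : psi x y != a -> psi x y != t ->
  ~~ ((x == u) && (y == b)) -> ~~ ((x == b) && (y == u)) -> psi' x y = psi x y.
Proof.
move=> na nt /negbTE e1 /negbTE e2; rewrite /mid /recol e1 e2 /=.
by case: ifP => // _; apply: kswap_edge.
Qed.

Lemma mid_edge_u y : y != b -> psi' u y = psi u y.
Proof.
have [_ _ nub] := mid_neq.
move=> /negbTE yb; rewrite /mid /recol yb (negbTE nub) andbF /=.
by case: ifP => // _; apply: kswap_edge_off.
Qed.
End Mid.
End Recolouring.

(** * Degrees, and the full vertices as leaves of the fan *)

Section Degrees.
Variables (T C : finType) (adj : rel T).
Hypothesis adjC : symmetric adj.
Hypothesis adjI : irreflexive adj.
Variable r : T.
Implicit Types (psi : T -> T -> C) (th : T -> C) (c : C) (s u v w x y z : T).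

Local Notation mis := (mis adj r).
Local Notation same := (same adj r).
Local Notation proper := (proper adj r).
Local Notation hadj := (hadj adj r).
Local Notation N := (nbr adj r).
Local Notation fr := (fr adj r).
Local Notation arrow := (arrow adj r).
Local Notation valid := (valid adj r).
Local Notation bad := (bad adj r).
Local Notation reach psi th := (connect (arrow psi th)).
Hypothesis unc : uncolorable C adj r.

Definition full v := #|C| <= #|nbr adj v|.

Lemma mis_card psi v : proper psi -> v != r ->
  #|mis psi v| + #|nbr adj v| = #|C| + (v \in N).
Proof.
move=> pr vr; pose H := [set y | hadj v y].
have -> : #|nbr adj v| = #|H| + (v \in N).
  have [vN|vN] := boolP (v \in N).
    rewrite (cardsD1 r); have -> : r \in nbr adj v by rewrite inE adjC; rewrite inE in vN.
    rewrite addnC; congr (_ + _); apply: eq_card => y.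
    by rewrite !inE /hadj vr andbC.
  rewrite addn0; apply: eq_card => y; rewrite !inE /hadj vr /=.
  have [->|_] := eqVneq y r; last by rewrite andbT.
  by rewrite andbF adjC; move: vN; rewrite inE => /negbTE.
rewrite addnA; congr (_ + _); rewrite -(cardsC (mis psi v)); congr (_ + _).
have -> : ~: mis psi v = [set psi v y | y in H].
  apply/setP=> c; rewrite in_setC; apply/misPn/imsetP => [[y vy <-]|[y]].
    by exists y; rewrite ?inE.
  by rewrite inE => vy ->; exists y.
by rewrite card_in_imset // => y z; rewrite !inE; apply: pr.2.
Qed.

Lemma full_mis psi v : proper psi -> v \in N -> full v = (#|mis psi v| <= 1).
Proof.
move=> pr vN; have := mis_card pr (nbr_neq adjI vN); rewrite vN /full.
by move=> H; apply/idP/idP; lia.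
Qed.

Lemma full_sink psi th s v : valid psi th s -> v \in N -> v != s ->
  full v = (fr psi th v == set0).
Proof.
case=> pr sN inj val vN vs; rewrite (full_mis pr vN) /fr vN.
rewrite (cardsD1 (th v)) val // -cards_eq0; lia.
Qed.

Lemma sink_arrow psi th s v w : valid psi th s -> v \in N -> v != s -> full v ->
  arrow psi th v w = false.
Proof.
by move=> V vN vs; rewrite (full_sink V vN vs) /arrow => /eqP->; rewrite in_set0 andbF.
Qed.

Lemma sink_reach psi th s v w : valid psi th s -> v \in N -> v != s -> full v ->
  reach psi th v w -> v = w.
Proof.
move=> V vN vs fv vw; apply/eqP; apply: contraT => nvw.
by have [x] := connect_first vw nvw; rewrite (sink_arrow _ V).
Qed.

(* A free colour of the fan that is no [th w] could be given to the root instead. *)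
Lemma fan_full psi th s z c : valid psi th s -> reach psi th s z -> c \in fr psi th z ->
  exists2 w, arrow psi th z w & th w = c.
Proof.
move=> V sz cz; have [/existsP[w /andP[wN /eqP wc]]|] := boolP [exists w, (w \in N) && (th w == c)].
  by exists w => //; rewrite /arrow wN wc.
rewrite negb_exists => /forallP nc; exfalso; have [pr sN inj val] := V.
have nc' w : w \in N -> th w != c by move=> wN; have := nc w; rewrite wN.
pose th' v := if v == s then c else th v.
have V' : valid psi th' s.
  split=> // [x y xN yN|u uN us]; last by rewrite /th' (negbTE us) val.
  rewrite /th'; case: eqP => [->|_]; case: eqP => [->|_] //.
  - by move=> E; have := nc' y yN; rewrite E eqxx.
  - by move=> E; have := nc' x xN; rewrite E eqxx.
  - exact: inj.
have th'o v : v != s -> th' v = th v by rewrite /th' => /negbTE->.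
have ncs : z != s.
  apply: contraTneq cz => ->; rewrite (fr_root unc V).
  by have := root_mis unc V'; rewrite /th' eqxx.
have [_ _ inj' _] := V'.
apply: (not_bad_root unc V'); exists z; last first.
  rewrite arrowE // ?(connect_nbr sN sz) // ncs /th' eqxx.
  exact: fr_mis cz.
move: z sz {cz ncs}; apply: connect_ind => [|y x sy IH yx]; first exact: connect0.
apply: (connect_trans IH); apply: connect1.
have [xs _] := fan_link adjC unc V sy yx.
have yN := connect_nbr sN sy; have xN := arrow_nbr yx.
by rewrite arrowE // th'o // (arrow_mis yx) (arrowI yN yx).
Qed.

(* Each child of the root starts its own branch of the fan, which ends in a full vertex. *)
Lemma fan_card psi th s : valid psi th s ->
  #|mis psi s| <= #|[set x | [&& reach psi th s x, x != s & full x]]|.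
Proof.
move=> V; have [pr sN inj val] := V.
pose X := [set x | reach psi th s x] :\ s; pose W := [set x | arrow psi th s x].
have aF x y : reach psi th s x -> arrow psi th x y -> reach psi th s y /\ y != s.
  move=> sx xy; split; first exact: connect_trans sx (connect1 xy).
  by have [] := fan_link adjC unc V sx xy.
have -> : mis psi s = [set th x | x in W].
  rewrite -(fr_root unc V); apply/setP=> c; apply/idP/imsetP => [cs|[x]].
    by have [w sw <-] := fan_full V (connect0 _ s) cs; exists w; rewrite ?inE.
  by rewrite inE => /andP[_ +] ->.
apply: leq_trans (leq_imset_card _ _) _.
apply: leq_trans (card_sources (e := arrow psi th) (X := X) (W := W) _ _ _) _.
- apply/subsetP=> x; rewrite !inE => sx.
  by have [-> ->] := aF _ _ (connect0 _ s) sx.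
- move=> x y; rewrite !inE => /andP[xs sx] xy; have [-> ->] := aF _ _ sx xy.
  rewrite /= andbT; apply: contra xs => sy; apply/eqP.
  exact: (fan_uniq adjC adjI unc V sx (connect0 _ s) xy sy).
- move=> x x' y; rewrite !inE => /andP[_ sx] /andP[_ sx'].
  exact: (fan_uniq adjC adjI unc V sx sx').
apply: subset_leq_card; apply/subsetP=> x; rewrite !inE => /andP[/andP[xs sx] nx].
rewrite xs sx (full_sink V (connect_nbr sN sx) xs) /=.
apply: contraR nx => /set0Pn[c cx].
by have [w xw _] := fan_full V sx cx; apply/existsP; exists w.
Qed.

(** The root may carry any colour, and [z] misses [th s]. The fan does not notice: none of its
    vertices misses [th s], and none points to [z], since then the root would be bad. *)
Lemma exchange psi th s z : valid psi th s -> z \in N -> arrow psi th z s ->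
  exists th', [/\ valid psi th' s, th' z = th s, th' s = th z,
    forall v, v != z -> v != s -> th' v = th v &
    reach psi th s =1 reach psi th' s].
Proof.
move=> V zN zs; have [pr sN inj val] := V; have nzs := arrowI zN zs.
pose th' v := th (tperm z s v).
have tpN v : (tperm z s v \in N) = (v \in N) by case: tpermP => // ->; rewrite ?sN ?zN.
have inj' : {in N &, injective th'}.
  by move=> x y xN yN /inj E; apply: (@perm_inj _ (tperm z s)); apply: E; rewrite tpN.
have th'o v : v != z -> v != s -> th' v = th v by move=> vz vs; rewrite /th' tpermD 1?eq_sym.
have th'z : th' z = th s by rewrite /th' tpermL.
have th's : th' s = th z by rewrite /th' tpermR.
have V' : valid psi th' s.
  split=> // u uN us; have [->|uz] := eqVneq u z; first by rewrite th'z (arrow_mis zs).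
  by rewrite th'o // val.
exists th'; split=> //; apply: connect_agree => v sv x.
have vN := connect_nbr sN sv.
have sm := good_mis unc V (not_bad_root unc V) sv.
have vs : arrow psi th v s = false by apply/negP=> /arrow_mis; rewrite (negbTE sm).
have vz : arrow psi th v z = false.
  apply/negP=> vz; apply: (not_bad_root unc V); exists z => //.
  exact: connect_trans sv (connect1 vz).
have zv : v != z.
  by apply/eqP=> vz'; apply: (not_bad_root unc V); exists z => //; rewrite -vz'.
have [xN|xN] := boolP (x \in N); last by rewrite /arrow (negbTE xN).
have [->|xz] := eqVneq x z; first by rewrite vz arrowE // zv th'z (negbTE sm).
have [->|xs] := eqVneq x s; last by rewrite !arrowE // th'o.
rewrite vs arrowE // th's; have := vz; rewrite arrowE // zv /= => ->.
by rewrite andbF.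
Qed.

Section Mid.
Variables (psi : T -> T -> C) (th : T -> C) (s u b w : T).
Hypothesis V : valid psi th s.
Hypotheses (ub : hadj u b) (ab : th s \in mis psi b) (uw : arrow psi th u w).
Hypotheses (ws : w != s) (nuw : u != w) (au : th s \notin mis psi u).
Hypotheses (suw : same psi (th s) (th w) u w) (bw : b != w).
Local Notation psi' := (mid adj r psi (th s) (th w) u b).

(** The chain of [u] ends in [u] and [w]. As [b] misses [th s], it would be a third end, or
    isolated. *)
Lemma mid_sep : ~~ same psi (th s) (th w) b u.
Proof.
have [pr sN inj val] := V; have wN := arrow_nbr uw.
apply/negP=> bu; have nub : u != b by apply: contraTneq ub => ->; rewrite hadjI.
have tu := arrow_mis uw.
have [sw|sw] := boolP (th s \in mis psi w).
  have := same_isolated sw (val _ wN ws).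
  by move=> /(_ u); rewrite sameC // suw => /(_ isT) E; move: nuw; rewrite E eqxx.
have kw : kend adj r psi (th s) (th w) w by rewrite /kend (negbTE sw) val.
have ku : kend adj r psi (th s) (th w) u by rewrite /kend (negbTE au) tu.
have [tb|tb] := boolP (th w \in mis psi b).
  by have E := same_isolated ab tb bu; rewrite E eqxx in nub.
have kb : kend adj r psi (th s) (th w) b by rewrite /kend ab (negbTE tb).
have E : w = b.
  apply: (ends3 adjC adjI pr ku kw kb suw _ nuw nub).
  by rewrite sameC.
by move: bw; rewrite E eqxx.
Qed.

Lemma mid_valid : valid psi' th s.
Proof.
have [pr sN inj val] := V; have wN := arrow_nbr uw; have tu := arrow_mis uw.
have sep := mid_sep.
split=> //; first exact: (mid_proper adjC adjI pr ub ab tu sep).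
move=> x xN xs; have [da dt nub] := mid_neq adjC adjI pr ub ab tu.
have nxs : th x != th s by rewrite (inj_in_eq inj).
have swb : ~~ same psi (th s) (th w) b w.
  by apply: contra sep => bw'; apply: same_trans bw' _; rewrite sameC.
have [E|xw] := eqVneq (th x) (th w).
  have -> : x = w by apply: inj.
  by rewrite mid_mis_off ?val // eq_sym.
have [E|xd] := eqVneq (th x) (psi u b); last by rewrite mid_mis ?val.
have xm := val _ xN xs; rewrite E in xm *.
rewrite mid_mis_d //; apply: contraTneq xm => ->; apply/misPn.
  by exists b.
by exists u; rewrite 1?hadjC // (pr.1 _ _ ub).
Qed.
End Mid.
End Degrees.

(** * Recolouring an edge [u b] inside a state *)

Section Toggle.
Variables (T C : finType) (adj : rel T).
Hypothesis adjC : symmetric adj.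
Hypothesis adjI : irreflexive adj.
Variable r : T.
Implicit Types (psi : T -> T -> C) (th : T -> C) (c : C) (s u v w x y z : T).

Local Notation mis := (mis adj r).
Local Notation same := (same adj r).
Local Notation kend := (kend adj r).
Local Notation proper := (proper adj r).
Local Notation hadj := (hadj adj r).
Local Notation N := (nbr adj r).
Local Notation fr := (fr adj r).
Local Notation arrow := (arrow adj r).
Local Notation valid := (valid adj r).
Local Notation bad := (bad adj r).
Local Notation reach psi th := (connect (arrow psi th)).
Local Notation full := (full C adj).
Hypothesis unc : uncolorable C adj r.
Hypothesis cardN : #|C| <= #|N|.

Lemma surj psi th s : valid psi th s -> forall c, exists2 w, w \in N & th w = c.
Proof.
case=> _ _ inj _ c.
have : [set th w | w in N] = setT.
  by apply/eqP; rewrite eqEcard subsetT cardsT (card_in_imset inj).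
by move/setP/(_ c); rewrite inE => /imsetP[w wN ->]; exists w.
Qed.

(** The interface of [mid]: away from [th s], [th w] and the old colour of [u b], the missing
    colours are unchanged everywhere; that old colour becomes free at both [u] and [b]. *)
Record mid_spec psi th s u b w psi' : Prop := MidSpec {
  ms_valid : valid psi' th s;
  ms_sep : ~~ same psi (th s) (th w) b u;
  ms_ds : psi u b != th s;
  ms_dw : psi u b != th w;
  ms_ub : u != b;
  ms_mis : forall x c, c != th s -> c != th w -> c != psi u b ->
    (c \in mis psi' x) = (c \in mis psi x);
  ms_d : forall x, x != u -> x != b -> (psi u b \in mis psi' x) = (psi u b \in mis psi x);
  ms_off : forall x c, x != u -> x != b -> ~~ same psi (th s) (th w) b x ->
    (c \in mis psi' x) = (c \in mis psi x);
  ms_off2 : forall x c, x != u -> x != b -> th s \notin mis psi x ->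
    th w \notin mis psi x -> (c \in mis psi' x) = (c \in mis psi x);
  ms_u : forall c, (c \in mis psi' u) = (c != th w) && ((c == psi u b) || (c \in mis psi u));
  ms_ua : th s \notin mis psi' u;
  ms_bd : psi u b \in mis psi' b;
  ms_ba : (th s \in mis psi' b) = (th w \in mis psi b);
  ms_edge : forall x y, psi x y != th s -> psi x y != th w ->
    ~~ ((x == u) && (y == b)) -> ~~ ((x == b) && (y == u)) -> psi' x y = psi x y;
  ms_edge_u : forall y, y != b -> psi' u y = psi u y }.

Lemma mid_spec_mid psi th s u b w : valid psi th s -> hadj u b -> th s \in mis psi b ->
  arrow psi th u w -> w != s -> u != w -> th s \notin mis psi u ->
  same psi (th s) (th w) u w -> b != w ->
  mid_spec psi th s u b w (mid adj r psi (th s) (th w) u b).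
Proof.
move=> V ub ab uw ws nuw au suw bw.
have sep := mid_sep adjC adjI V ub ab uw ws nuw au suw bw.
have tu := arrow_mis uw; have [pr _ _ _] := V.
have [da dt nub] := mid_neq adjC adjI pr ub ab tu.
split=> //.
- exact: mid_valid.
- exact: (mid_mis adjC adjI pr ub ab tu sep).
- exact: (mid_mis_d adjC adjI pr ub ab tu sep).
- exact: (mid_mis_off adjC adjI pr ub ab tu sep).
- exact: (mid_mis_off2 adjC adjI pr ub ab tu sep).
- exact: (mid_u adjC adjI pr ub ab tu sep).
- exact: (mid_u_a adjC adjI pr ub ab tu au sep).
- exact: (mid_b_d adjC adjI pr ub ab tu sep).
- exact: (mid_b_a adjC adjI pr ub ab tu au sep).
- exact: mid_edge.
- exact: (mid_edge_u adjC adjI pr ub ab tu sep).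
Qed.

(** A fan vertex missing [th w] lies on the chain of [w], which is that of [u], and this chain is
    disjoint from the chain of [b], the only one that is changed. *)
Lemma mid_fan psi th s u b w psi' x : valid psi th s -> th s \in mis psi b ->
  arrow psi th u w -> w != s -> same psi (th s) (th w) u w ->
  mid_spec psi th s u b w psi' -> reach psi th s x -> x != u -> mis psi' x = mis psi x.
Proof.
move=> V ab uw ws suw MS sx xu; apply/setP=> c; have [pr sN inj val] := V.
have ax := good_mis unc V (not_bad_root unc V) sx.
have xb : x != b by apply: contraNneq ax => ->.
have [tx|tx] := boolP (th w \in mis psi x); last exact: (ms_off2 MS).
apply: (ms_off MS) => //; apply: contra (ms_sep MS) => bx.
apply: same_trans bx _.
have wN := arrow_nbr uw.
have [->|xw] := eqVneq x w; first by rewrite sameC.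
have a : arrow psi th x w by rewrite arrowE // ?xw ?(connect_nbr sN sx).
have [_ l] := fan_link adjC unc V sx a.
by apply: same_trans l _; rewrite sameC.
Qed.

Section Root.
Variables (psi : T -> T -> C) (th : T -> C) (s b t : T).
Hypothesis V : valid psi th s.
Hypotheses (sb : hadj s b) (ab : th s \in mis psi b) (st : arrow psi th s t) (bt : b != t).
Local Notation psi' := (mid adj r psi (th s) (th t) s b).

Lemma root_mid : mid_spec psi th s s b t psi'.
Proof.
have [ts l] := fan_link adjC unc V (connect0 _ s) st.
by apply: mid_spec_mid => //; rewrite ?(root_mis unc V) // eq_sym.
Qed.

Lemma root_mid_mis x : reach psi th s x -> x != s -> mis psi' x = mis psi x.
Proof.
have [ts l] := fan_link adjC unc V (connect0 _ s) st.
exact: (mid_fan V ab st ts l root_mid).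
Qed.

Lemma root_mid_arrow y x : reach psi th s y -> y != s -> arrow psi' th y x = arrow psi th y x.
Proof. by move=> sy ys; rewrite /arrow /fr root_mid_mis. Qed.

Lemma root_mid_child x : arrow psi th s x -> x != t -> arrow psi' th s x.
Proof.
move=> sx xt; have [_ sN inj _] := V; have xN := arrow_nbr sx; have tN := arrow_nbr st.
rewrite arrowE // (arrowI sN sx) (ms_u root_mid) (inj_in_eq inj) // xt.
by rewrite (arrow_mis sx) orbT.
Qed.

Lemma root_mid_new w : w \in N -> th w = psi s b -> arrow psi' th s w.
Proof.
move=> wN wd; have [_ sN inj _] := V.
rewrite arrowE // wd (ms_u root_mid) (ms_dw root_mid) eqxx andbT.
by apply/eqP=> E; move: (ms_ds root_mid); rewrite -wd E eqxx.
Qed.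
End Root.

(* Choosing which child of the root is given up lets a prescribed vertex of the
   fan keep its predecessor. *)
Lemma branch psi th s b y1 : valid psi th s -> hadj s b -> th s \in mis psi b ->
  1 < #|mis psi s| -> reach psi th s y1 -> y1 != s ->
  exists t y, let psi' := mid adj r psi (th s) (th t) s b in
  [/\ arrow psi th s t, b != t, t != y1 & [/\ reach psi th s y, arrow psi th y y1,
    reach psi' th s y & arrow psi' th y y1]].
Proof.
move=> V sb ab m1 sy1 y1s; have [pr sN inj val] := V.
have y1s' : s != y1 by rewrite eq_sym.
have [y sy yy1] := connect_last sy1 y1s'.
have bt t : arrow psi th s t -> b != t.
  move=> st; have := good_mis unc V (not_bad_root unc V) (connect1 st).
  by apply: contraNneq => <-.
have ex x : exists2 t, arrow psi th s t & t != x.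
  have /subsetPn[c cs cx] : ~~ (mis psi s \subset [set th x]).
    by apply/negP=> /subset_leq_card; rewrite cards1 leqNgt m1.
  rewrite -(fr_root unc V) in cs.
  have [w sw wc] := fan_full adjC unc V (connect0 _ s) cs; exists w => //.
  by apply: contraNneq cx => <-; rewrite wc inE.
have [ys|ys] := eqVneq y s.
  rewrite ys in sy yy1; have [t st ty] := ex y1.
  exists t, s; split; rewrite ?bt //; split=> //.
  by apply: root_mid_child; rewrite ?bt // eq_sym.
have nsy : s != y by rewrite eq_sym.
have [t1 st1 t1y] := connect_first sy nsy; have [t st tt1] := ex t1.
have ty1 : t != y1.
  apply: contra_neq ys => E; rewrite -E in yy1.
  exact: (fan_uniq adjC adjI unc V sy (connect0 _ s) yy1 st).
exists t, y; split; rewrite ?bt //; split=> //; last by rewrite root_mid_arrow ?bt.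
apply: connect_trans (connect1 (root_mid_child V sb ab st (bt _ st) st1 _)) _.
  by rewrite eq_sym.
have st1' : reach psi th s t1 := connect1 st1.
suff H v : reach psi th t1 v -> v != s /\
  reach (mid adj r psi (th s) (th t) s b) th t1 v by have [] := H _ t1y.
move: v; apply: connect_ind => [|v x t1v [vs IH] vx].
  by have [] := fan_link adjC unc V (connect0 _ s) st1; split=> //; apply: connect0.
have sv : reach psi th s v := connect_trans st1' t1v.
have [xs _] := fan_link adjC unc V sv vx; split=> //.
by apply: connect_trans IH (connect1 _); rewrite root_mid_arrow ?bt.
Qed.

(** Rerooting permutes the colours carried by the fan: the fan vertices may change their colours,
    but the set of these colours stays. *)
Lemma reroot_mem psi th s u th' w w' : valid psi th s -> valid psi th' u ->
  (forall v, ~~ reach psi th s v -> th' v = th v) ->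
  w \in N -> w' \in N -> th' w' = th w -> reach psi th s w -> reach psi th s w'.
Proof.
move=> [_ _ inj _] V' off wN w'N E sw; apply: contraLR sw => sw'.
by suff <- : w' = w by []; apply: inj; rewrite // -off.
Qed.

Lemma fan_deficient psi th s u : valid psi th s -> reach psi th s u -> ~~ full u ->
  1 < #|mis psi u|.
Proof.
case=> pr sN _ _ su; rewrite (full_mis adjC adjI pr) ?ltnNge //.
exact: connect_nbr sN su.
Qed.

(* Otherwise recolouring the edge [u b] would give [w] a second predecessor. *)
Lemma toggle_outside psi th s u b w : valid psi th s -> th s \in mis psi b ->
  reach psi th s u -> ~~ full u -> hadj u b -> w \in N -> th w = psi u b ->
  ~~ reach psi th s w.
Proof.
move=> V ab su nfu ub wN wd; apply/negP=> sw.
have [th1 [V1 t1 off eqF]] := reroot adjC adjI unc V su.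
have [w1 w1N w1d] := surj V1 (psi u b).
have sw1 : reach psi th s w1 by apply: (reroot_mem V V1 off wN w1N _ sw); rewrite w1d.
rewrite eqF in sw1; rewrite -t1 in ab.
have [pr1 uN inj1 _] := V1.
have w1u : w1 != u.
  by apply: contraTneq ab => E; rewrite -E w1d (pr1.1 _ _ ub); apply/misPn; exists u; rewrite 1?hadjC.
have [t [y [ut bt tw [uy yw uy' yw']]]] :=
  branch V1 ub ab (fan_deficient V su nfu) sw1 w1u.
have MS := root_mid V1 ub ab ut bt.
have uw' := root_mid_new V1 ub ab ut bt w1N w1d.
have E := fan_uniq adjC adjI unc (ms_valid MS) uy' (connect0 _ u) yw' uw'.
move: (arrow_mis yw); rewrite E w1d; apply/negP/misPn; by exists b.
Qed.
Lemma two_preds psi th s y z w : valid psi th s -> w \in N -> w != s ->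
  y != z -> y != w -> z != w -> th s \notin mis psi y -> th s \notin mis psi z ->
  th w \in mis psi y -> th w \in mis psi z ->
  ~~ same psi (th s) (th w) y w \/ ~~ same psi (th s) (th w) z w.
Proof.
move=> [pr _ _ val] wN ws yz yw zw ay az ty tz.
have [swy|] := boolP (same psi (th s) (th w) y w); last by left.
right; apply/negP=> szw; have tw := val _ wN ws.
have [aw|aw] := boolP (th s \in mis psi w).
  by case/eqP: yw; apply/esym; apply: (same_isolated aw tw); rewrite sameC.
have kw : kend psi (th s) (th w) w by rewrite /kend (negbTE aw) tw.
have ky : kend psi (th s) (th w) y by rewrite /kend (negbTE ay) ty.
have kz : kend psi (th s) (th w) z by rewrite /kend (negbTE az) tz.
case/eqP: yz; apply: (ends3 adjC adjI pr kw ky kz); rewrite 1?sameC // 1?eq_sym //.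
Qed.

(** The chain of [x] is changed, if necessary, to make [x] miss [th s]; the fan is untouched. It
    serves to give [b] back the colour that a recolouring took from it. *)
Record restored psi th s w x psi' : Prop := Restored {
  rs_valid : valid psi' th s;
  rs_mis : forall z c, c != th s -> c != th w -> (c \in mis psi' z) = (c \in mis psi z);
  rs_edge : forall z z', psi z z' != th s -> psi z z' != th w -> psi' z z' = psi z z';
  rs_val : forall x y, psi' x y = psi x y \/ psi' x y = tperm (th s) (th w) (psi x y);
  rs_a : th s \in mis psi' x;
  rs_off : forall z, ~~ same psi (th s) (th w) x z -> mis psi' z = mis psi z;
  rs_edge_off : forall z, ~~ same psi (th s) (th w) x z -> psi' z =1 psi z;
  rs_on : forall z, z != x -> th w \in mis psi z -> same psi (th s) (th w) x z ->
    th s \in mis psi' z;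
  rs_on2 : forall z, z != x -> th s \in mis psi z -> same psi (th s) (th w) x z ->
    th w \in mis psi' z;
  rs_same : same psi' (th s) (th w) =2 same psi (th s) (th w);
  rs_fan : forall z, reach psi th s z -> mis psi' z = mis psi z;
  rs_reach : reach psi th s =1 reach psi' th s }.

Lemma restore psi th s w x : valid psi th s -> w \in N -> w != s ->
  th w \in mis psi x -> (th s \notin mis psi x -> ~~ same psi (th s) (th w) x w) ->
  exists psi', restored psi th s w x psi'.
Proof.
move=> V wN ws wx H; have [sx|sx] := boolP (th s \in mis psi x).
  by exists psi; split=> // [x' y|z zx _ xz|z zx _ xz]; [left | move: zx; rewrite (same_isolated sx wx xz) eqxx..].
have {H}xw := H sx; exists (sw adj r psi th s w x); split.
- exact: sw_valid.
- by move=> z c; apply: (mis_sw_other _ V).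
- by move=> z z'; apply: kswap_edge.
- by move=> z y; rewrite /sw /kswap; case: ifP; [right | left].
- by rewrite (mis_sw _ _ V) same_refl tpermL.
- by move=> z /negbTE xz; apply/setP=> c; rewrite (mis_sw _ _ V) xz.
- by move=> z xz z'; apply: kswap_edge_off.
- by move=> z _ wz xz; rewrite (mis_sw _ _ V) xz tpermL.
- by move=> z _ sz xz; rewrite (mis_sw _ _ V) xz tpermR.
- exact: same_kswap.
- by move=> z; apply: fan_mis_sw.
- exact: fan_sw.
Qed.

Lemma fan_restore psi th s y w x : valid psi th s -> reach psi th s y ->
  arrow psi th y w -> th w \in mis psi x -> x != y -> x != w ->
  exists psi', restored psi th s w x psi'.
Proof.
move=> V sy yw wx xy xw; have [ws _] := fan_link adjC unc V sy yw.
apply: (restore V (arrow_nbr yw) ws wx) => sx.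
have kx : kend psi (th s) (th w) x by rewrite /kend (negbTE sx) wx.
by have [] := fan_not_same adjC adjI unc V sy yw kx xy xw.
Qed.
End Toggle.

(** * Maximal fans *)

Section Maximal.
Variables (T C : finType) (adj : rel T).
Hypothesis adjC : symmetric adj.
Hypothesis adjI : irreflexive adj.
Variable r : T.
Implicit Types (psi : T -> T -> C) (th : T -> C) (c : C) (s u v w x y z b : T).

Local Notation mis := (mis adj r).
Local Notation same := (same adj r).
Local Notation kend := (kend adj r).
Local Notation proper := (proper adj r).
Local Notation hadj := (hadj adj r).
Local Notation N := (nbr adj r).
Local Notation fr := (fr adj r).
Local Notation arrow := (arrow adj r).
Local Notation valid := (valid adj r).
Local Notation bad := (bad adj r).
Local Notation sw := (sw adj r).
Local Notation reach psi th := (connect (arrow psi th)).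
Local Notation full := (full C adj).
Hypothesis unc : uncolorable C adj r.
Hypothesis cardN : #|C| <= #|N|.

Variables (q : T) (p M : nat).
Hypothesis nfq : ~~ full q.

Definition top psi th s : Prop :=
  [/\ valid psi th s, reach psi th s q & #|[set x | reach psi th s x]| = p].

Definition basin psi th b : {set T} := [set y in N | reach psi th y b].

Definition maxF : Prop := forall psi th s, valid psi th s -> reach psi th s q ->
  #|[set x | reach psi th s x]| <= p.

(** As [b] lies in its own basin, [M = 0] says that no neighbour of [r] points to the root of a
    maximal fan. *)
Definition maxB : Prop := forall psi th s b, top psi th s -> b \in N ->
  arrow psi th b s -> #|basin psi th b| <= M.

Hypotheses (HF : maxF) (HB : maxB).

(* Otherwise exchanging colours at the last vertex [z'] before [s] would put [z'] above
   the whole basin of [b]. *)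
Lemma grow psi th s b z : top psi th s -> b \in N -> th s \in mis psi b ->
  M <= #|basin psi th b| -> z \in N -> bad psi th s z -> reach psi th z b.
Proof.
move=> [V sq cF] bN ab MB zN [z' zz' z's]; have [pr sN inj val] := V.
apply: contraT => nzb; have z'N := connect_nbr zN zz'.
have nz'b : ~~ reach psi th z' b by apply: contra nzb; apply: connect_trans.
have bs : arrow psi th b s.
  rewrite arrowE // ab andbT; apply: contraTneq ab => ->; exact: root_mis V.
have nsb : ~~ reach psi th s b.
  by apply/negP=> sb; apply: (not_bad_root unc V); exists b.
have [th2 [V2 t2z t2s off eqF]] := exchange unc V z'N z's; have [_ _ inj2 _] := V2.
have top2 : top psi th2 s.
  by split=> //; rewrite -?eqF // -cF; apply: eq_card => x; rewrite !inE eqF.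
have z's2 : arrow psi th2 z' s by rewrite arrowE // t2s val ?andbT ?(arrowI z'N z's).
have bz' : arrow psi th2 b z'.
  by rewrite arrowE // t2z ab andbT; apply: contraNneq nz'b => ->.
have := HB top2 z'N z's2.
suff : #|z' |: basin psi th b| <= #|basin psi th2 z'|.
  have nz' : z' \notin basin psi th b by rewrite inE (negbTE nz'b) andbF.
  by rewrite cardsU1 nz' => l1 l2; move: (leq_trans l1 l2); rewrite ltnNge MB.
apply: subset_leq_card; apply/subsetP=> y; rewrite in_setU1 inE => /orP[/eqP->|/andP[yN yb]].
  by rewrite inE z'N connect0.
rewrite inE yN /=; apply: connect_trans (connect1 bz').
suff H v : reach psi th y v -> reach psi th v b -> reach psi th2 y v by apply: H.
move: v; apply: connect_ind => [|v x yv IH vx xb]; first by rewrite connect0.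
have vb := connect_trans (connect1 vx) xb.
apply: connect_trans (IH vb) (connect1 _).
have vN := connect_nbr yN yv; have xN := arrow_nbr vx.
rewrite arrowE // (arrowI vN vx) off ?(arrow_mis vx) //.
  by apply: contraNneq nz'b => <-.
by apply: contraNneq nsb => <-.
Qed.

(* The fan loses [v], and the edge [s u] frees a colour that brings in [w] in its place. *)
Lemma toggle_root psi th s v u w : top psi th s -> arrow psi th s v -> full v ->
  hadj s u -> th s \in mis psi u -> w \in N -> th w = psi s u ->
  let psi' := mid adj r psi (th s) (th v) s u in
  [/\ ~~ reach psi th s w, full w, u != v & top psi' th s].
Proof.
move=> [V sq cF] sv fv su au wN wd psi'; have [pr sN inj val] := V.
have qv : q != v by apply: contraNneq nfq => ->.
have uv : u != v.
  have := good_mis unc V (not_bad_root unc V) (connect1 sv).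
  by apply: contraNneq => <-.
have MS : mid_spec adj r psi th s s u v psi' := root_mid adjC adjI unc V su au sv uv.
have V' := ms_valid MS.
have vN := arrow_nbr sv; have [vs _] := fan_link adjC unc V (connect0 _ s) sv.
have sw' : arrow psi' th s w := root_mid_new adjC adjI unc V su au sv uv wN wd.
have keep y x : reach psi th s y -> arrow psi th y x -> x != v -> arrow psi' th y x.
  move=> sy yx xv; have [ys|ys] := eqVneq y s.
    by rewrite ys in yx *; apply: root_mid_child.
  by rewrite root_mid_arrow.
have sub x : reach psi th s x -> x != v -> reach psi' th s x.
  move: x; apply: connect_ind => [|y x sy IH yx xv]; first by rewrite connect0.
  apply: connect_trans (IH _) (connect1 (keep _ _ sy yx xv)).
  by apply: contraTneq yx => ->; rewrite (sink_arrow adjC adjI _ V).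
have pred x : reach psi th s x -> x != s -> x != v ->
    exists y, [/\ reach psi th s y, arrow psi th y x, reach psi' th s y & arrow psi' th y x].
  move=> sx xs xv; have xs' : s != x by rewrite eq_sym.
  have [y sy yx] := connect_last sx xs'; exists y; split=> //; last exact: keep.
  by apply: sub => //; apply: contraTneq yx => ->; rewrite (sink_arrow adjC adjI _ V).
have dns : th w \notin mis psi s by rewrite wd; apply/misPn; exists u.
have wv : w != v by apply: contraNneq dns => ->; apply: arrow_mis sv.
have [ws _] := fan_link adjC unc V' (connect0 _ s) sw'.
have nw : ~~ reach psi th s w.
  apply/negP=> sw; have [y [sy yw sy' yw']] := pred w sw ws wv.
  have E := fan_uniq adjC adjI unc V' sy' (connect0 _ s) yw' sw'.
  by move: dns; rewrite -E (arrow_mis yw).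
(* The fan keeps all its vertices but [v] and gains [w]. This already makes [p] vertices, so the
   maximality of [p] turns the inclusion into an equality. *)
have cF' : #|w |: ([set x | reach psi th s x] :\ v)| = p.
  have sv' : reach psi th s v := connect1 sv.
  by rewrite cardsU1 !inE (negbTE nw) andbF -cF [in RHS](cardsD1 v) inE sv'.
have eqF : [set x | reach psi' th s x] = w |: ([set x | reach psi th s x] :\ v).
  apply/esym/eqP; rewrite eqEcard cF' HF // ?sub // andbT; apply/subsetP=> x.
  rewrite !inE => /orP[/eqP->|/andP[xv sx]]; first exact: connect1.
  exact: sub.
have inF x : reach psi' th s x = (x == w) || reach psi th s x && (x != v).
  by move/setP/(_ x): eqF; rewrite !inE andbC.
split=> //; last by split=> //; rewrite ?eqF // inF sq qv orbT.
(* A free colour at [w] would lead to a vertex of the old fan, which would then have two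
   predecessors. *)
rewrite (full_sink adjC adjI V' wN ws); apply/eqP/setP=> c; rewrite inE; apply/negP=> cw.
have sw'' : reach psi' th s w := connect1 sw'.
have [x wx _] := fan_full adjC unc V' sw'' cw.
have [xs _] := fan_link adjC unc V' sw'' wx.
have := inF x; rewrite (connect_trans sw'' (connect1 wx)) => /esym/orP[/eqP xw|/andP[sx xv]].
  by move: wx; rewrite xw arrow_irr.
have [y [sy yx sy' yx']] := pred x sx xs xv.
have E := fan_uniq adjC adjI unc V' sw'' sy' wx yx'.
by move: nw; rewrite E sy.
Qed.
End Maximal.

(** * The neighbourhood of [r] outside a fixed maximal fan *)

Section Base.
Variables (T C : finType) (adj : rel T).
Hypothesis adjC : symmetric adj.
Hypothesis adjI : irreflexive adj.
Variable r : T.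
Implicit Types (psi : T -> T -> C) (th : T -> C) (c : C) (u w x y z : T).

Local Notation mis := (mis adj r).
Local Notation same := (same adj r).
Local Notation kend := (kend adj r).
Local Notation proper := (proper adj r).
Local Notation hadj := (hadj adj r).
Local Notation N := (nbr adj r).
Local Notation fr := (fr adj r).
Local Notation arrow := (arrow adj r).
Local Notation valid := (valid adj r).
Local Notation bad := (bad adj r).
Local Notation sw := (sw adj r).
Local Notation reach psi th := (connect (arrow psi th)).
Local Notation full := (full C adj).
Local Notation basin := (basin adj r).
Hypothesis unc : uncolorable C adj r.
Hypothesis cardN : #|C| <= #|N|.

Variables (q : T) (p M : nat).
Hypothesis nfq : ~~ full q.
Local Notation top := (top adj r q p).
Hypotheses (HF : maxF C adj r q p) (HB : maxB C adj r q p M).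

Variables (psi0 : T -> T -> C) (th0 : T -> C) (s v b : T).
Hypothesis T0 : top psi0 th0 s.
Hypothesis sv : arrow psi0 th0 s v.
Hypothesis fv : full v.
Hypothesis br : b != r.
Hypothesis ab0 : th0 s \in mis psi0 b.
Local Notation B0 := (basin psi0 th0 b).
Hypothesis HM : (b \in N /\ M <= #|B0|) \/ (b \notin N /\ M = 0).
Local Notation F0 := (reach psi0 th0 s).
Local Notation a := (th0 s).

Let V0 : valid psi0 th0 s. Proof. by case: T0. Qed.
Let pr0 : proper psi0. Proof. by case: V0. Qed.
Let sN : s \in N. Proof. by case: V0. Qed.
Let inj0 : {in N &, injective th0}. Proof. by case: V0. Qed.
Let F0N x : F0 x -> x \in N. Proof. exact: connect_nbr. Qed.

Lemma b_notin_F : ~~ F0 b.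
Proof. by apply/negP=> /(good_mis unc V0 (not_bad_root unc V0)); rewrite ab0. Qed.

Lemma basin_notin_F y : y \in B0 -> ~~ F0 y.
Proof.
rewrite inE => /andP[_ yb]; apply: contra b_notin_F => sy; exact: connect_trans sy yb.
Qed.

Lemma basin_neq_s y : y \in B0 -> y != s.
Proof. by move/basin_notin_F; apply: contraNneq => ->. Qed.

Lemma basin_not_full y : y \in B0 -> ~~ full y.
Proof.
move=> yB; have ys := basin_neq_s yB; move: yB; rewrite inE => /andP[yN yb].
apply/negP=> fy; have E := sink_reach adjC adjI V0 yN ys fy yb.
have : arrow psi0 th0 y s by rewrite arrowE // ys E ab0.
by rewrite (sink_arrow adjC adjI _ V0).
Qed.

Lemma basin_b : b \in N -> b \in B0.
Proof. by move=> bN; rewrite inE bN connect0. Qed.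

(* The states reached from [psi0], [th0] by changes that do not affect the fan. *)
Definition der psi th : Prop := [/\ valid psi th s,
  forall x, F0 x -> mis psi x = mis psi0 x &
  forall x, x \in N -> x != s -> F0 x || full x -> th x = th0 x].

Lemma der_arrow psi th x : der psi th -> F0 x -> arrow psi th x =1 arrow psi0 th0 x.
Proof.
move=> [V mE tE] sx; have [pr _ inj _] := V.
have frE : fr psi th x = fr psi0 th0 x.
  have [->|xs] := eqVneq x s; first by rewrite (fr_root unc V) (fr_root unc V0) mE.
  by rewrite /fr mE // tE ?sx // F0N.
have a0 w : arrow psi0 th0 x w -> th w = th0 w.
  move=> xw; have [ws _] := fan_link adjC unc V0 sx xw.
  by rewrite tE ?(arrow_nbr xw) // (connect_trans sx (connect1 xw)).
move=> w; apply/idP/idP=> [xw|xw].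
  have /andP[wN] := xw; rewrite frE => cw.
  have [w0 xw0 w0E] := fan_full adjC unc V0 sx cw.
  suff -> : w = w0 by [].
  by apply: inj; rewrite ?(arrow_nbr xw0) // (a0 _ xw0).
have /andP[wN cw] := xw.
by rewrite /arrow frE a0 ?wN.
Qed.

Lemma der_reach psi th : der psi th -> reach psi th s =1 F0.
Proof.
move=> D x; apply/esym; move: x; apply: connect_agree => x sx y.
by rewrite (der_arrow D).
Qed.

Lemma der_top psi th : der psi th -> top psi th s.
Proof.
move=> D; have [V _ _] := D; have [_ sq <-] := T0.
split=> //; first by rewrite der_reach.
by apply: eq_card => x; rewrite !inE der_reach.
Qed.

Lemma der_sw psi th w z : der psi th -> w \in N -> w != s ->
  ~~ same psi (th s) (th w) z w -> der (sw psi th s w z) th.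
Proof.
move=> D wN ws zw; have [V mE tE] := D; split=> //; first exact: sw_valid.
move=> x sx; rewrite (fan_mis_sw adjC unc V wN ws zw) ?mE //.
by rewrite der_reach.
Qed.

(* The colours that cannot be freed at s without enlarging the fan. *)
Definition Lam c := [exists l, [&& l \in N, ~~ F0 l, full l & th0 l == c]].

Lemma Lam_th w : w \in N -> Lam (th0 w) = ~~ F0 w && full w.
Proof.
move=> wN; apply/existsP/idP => [[l /and4P[lN lF fl /eqP E]]|/andP[wF fw]].
  by rewrite -(inj0 lN wN E) lF.
by exists w; rewrite wN wF fw eqxx.
Qed.

Lemma Lam_a : Lam a = false.
Proof. by rewrite Lam_th // connect0. Qed.

(* The condition is void when [M = 0], that is when no vertex outside of the fan is bad;
   in that case [b] is not a neighbour of [r]. *)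
Definition prot psi u : Prop := 0 < M -> adj s u && ~~ Lam (psi u s).

Lemma prot_sw psi th w z u : th s = a -> prot psi u ->
  (0 < M -> psi u s = a -> ~~ Lam (th w)) ->
  prot (sw psi th s w z) u.
Proof.
move=> tsE P H M0; have /andP[-> nl] := P M0; rewrite /sw /kswap /= tsE.
case: ifP => // _; case: tpermP => [E|_|//]; first exact: H.
by rewrite Lam_a.
Qed.

(* If u were bad, shifting colours along the path from u to s would free a colour
   missing at u, so that the edge su could be recoloured with the colour of v. The fan
   would then lose v and, being maximal, would gain a full vertex outside of it. *)
Lemma prot_not_bad psi th u : der psi th -> u \in N -> ~~ F0 u -> prot psi u ->
  ~ bad psi th s u.
Proof.
move=> D uN uF P [z uz zs]; have [V mE tE] := D; have [pr _ inj val] := V.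
have zN := connect_nbr uN uz.
have [M0|M0] := posnP M.
  have := HB (der_top D) zN zs.
  rewrite M0 leqn0 cards_eq0 => /eqP/setP/(_ z).
  by rewrite in_set0 in_set zN connect0.
have /andP[su nl] := P M0; have us := connect_trans uz (connect1 zs).
have [th' [Q [inj' mis' t's off QP]]] := shift_connect inj uN us.
have uns : u != s by apply: contraNneq uF => ->.
have V' : valid psi th' s.
  split=> // x xN xs; have [xQ|xQ] := boolP (x \in Q); first exact: mis'.
  by rewrite off ?val.
have D' : der psi th'.
  split=> // x xN xs Fx; rewrite -(tE _ xN xs Fx); apply: off; apply/negP=> /QP[ux xsr].
  case/orP: Fx => [sx|fx].
    have [x' xx' x's] := connect_last xsr xs.
    by apply: (not_bad_root unc V); exists x' => //; apply: connect_trans xx'; rewrite der_reach.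
  by have E := sink_reach adjC adjI V xN xs fx xsr; rewrite E eqxx in xs.
have sv' : arrow psi th' s v by rewrite (der_arrow D').
have hsu : hadj s u by rewrite /hadj su !(nbr_neq adjI).
have au : th' s \in mis psi u by rewrite t's val.
have [w wN wd] := surj cardN V' (psi s u).
have [wF fw _ _] := toggle_root adjC adjI unc nfq HF (der_top D') sv' fv hsu au wN wd.
have [_ _ tE'] := D'; rewrite (der_reach D') in wF.
move: nl; rewrite -(pr.1 _ _ hsu) -wd tE' ?fw ?orbT //; first by rewrite Lam_th // wF fw.
by apply: contraNneq wF => ->.
Qed.

(** If [y] outside the fan pointed to [w] in it, its chain would avoid [w], whose chain already has
    its two ends. Changing it would make [u] bad, and [u] would stay protected because the colour of
    a fan vertex is not in [Lam]. *)
Lemma prot_reach psi u z : der psi th0 -> u \in N -> ~~ F0 u -> prot psi u ->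
  reach psi th0 u z -> ~~ F0 z.
Proof.
move=> D uN uF P; have [V _ _] := D; have [pr _ _ val] := V.
have nb := prot_not_bad D uN uF P.
move: z; apply: connect_ind => // y w uy yF yw; apply/negP=> Fw.
have wN := F0N Fw; have ws : w != s.
  by apply/eqP=> E; apply: nb; exists y; rewrite -?E.
have rw : reach psi th0 s w by rewrite (der_reach D).
have sw' : s != w by rewrite eq_sym.
have [x sx xw] := connect_last rw sw'.
have yx : y != x by apply: contraNneq yF => ->; rewrite -(der_reach D).
have ky : kend psi a (th0 w) y.
  by rewrite /kend (negbTE (good_mis unc V nb uy)) (arrow_mis yw).
have [nyw _] := fan_not_same adjC adjI unc V sx xw ky yx (arrowI (connect_nbr uN uy) yw).
have D' := der_sw D wN ws nyw.
apply: (prot_not_bad D' uN uF _ (bad_sw adjC unc V wN nyw nb uy yw)).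
by apply: prot_sw => // _ _; rewrite Lam_th // Fw.
Qed.

(** Arrows out of [b] are exempt: recolouring an edge at [b] disturbs them, and a path to [b] can
    stop there. *)
Definition keep psi : Prop :=
  forall y w, y \in B0 -> w \in B0 -> y != b -> arrow psi0 th0 y w -> arrow psi th0 y w.

Definition semi psi : Prop := der psi th0 /\ keep psi.

(* In a good state the basin of [b] is still [B0], by maximality. *)
Definition good psi : Prop := semi psi /\ a \in mis psi b.

Lemma keep_mis psi psi' : keep psi -> (forall y w, y \in B0 -> w \in B0 -> y != b ->
  th0 w \in mis psi y -> th0 w \in mis psi' y) -> keep psi'.
Proof.
move=> K H y w yB wB yb yw.
have yN : y \in N by move: yB; rewrite in_set => /andP[].
have wN : w \in N by move: wB; rewrite in_set => /andP[].
by rewrite arrowE // H ?(arrow_mis (K _ _ yB wB yb yw)) ?(arrowI yN yw).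
Qed.

Lemma keep_reach psi y : keep psi -> y \in B0 -> reach psi th0 y b.
Proof.
move=> K; rewrite inE => /andP[yN /connectP[pp]].
elim: pp y yN => [|x pp IH] y yN /=; first by move=> _ ->; rewrite connect0.
case/andP=> yx xp bE; have xN := arrow_nbr yx.
have [->|yb] := eqVneq y b; first exact: connect0.
have xb : reach psi0 th0 x b by apply/connectP; exists pp.
apply: connect_trans (connect1 (K _ _ _ _ yb yx)) (IH x xN xp bE).
  by rewrite inE yN (connect_trans (connect1 yx)).
by rewrite inE xN.
Qed.

(** For [b] in [N] the basin has kept at least [M] vertices, so it cannot have grown, and bad
    vertices belong to it by [grow]. Otherwise [b] has no arrow into it and [M = 0] excludes bad
    vertices. *)
Lemma keep_basin psi z : top psi th0 s -> keep psi -> a \in mis psi b -> z \in N ->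
  reach psi th0 z b \/ bad psi th0 s z -> z \in B0.
Proof.
move=> TD K ab zN; have [V _ _] := TD.
case: HM => [[bN MB]|[bN M0]]; last first.
  case=> [zb|[z' zz' z's]].
    by have := connect_nbr zN zb; rewrite (negbTE bN).
  have z'N := connect_nbr zN zz'.
  have := HB TD z'N z's; rewrite M0 leqn0 cards_eq0 => /eqP/setP/(_ z').
  by rewrite in_set0 in_set z'N connect0.
have sub : B0 \subset basin psi th0 b.
  apply/subsetP=> y yB; rewrite in_set (keep_reach K) //.
  by move: yB; rewrite in_set => /andP[->].
have bs : arrow psi th0 b s.
  by rewrite arrowE // ab andbT; apply: contraNneq b_notin_F => ->.
have E : B0 = basin psi th0 b.
  by apply/eqP; rewrite eqEcard sub (leq_trans (HB TD bN bs) MB).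
move=> H; rewrite E in_set zN /=; case: H => // H.
apply: (grow unc HB TD) => //.
by apply: leq_trans MB _; apply: subset_leq_card.
Qed.

Lemma good_basin psi z : good psi -> z \in N -> reach psi th0 z b \/ bad psi th0 s z ->
  z \in B0.
Proof. by case=> [[D K] ab]; apply: keep_basin (der_top D) K ab. Qed.

(** The region K in which the counting takes place. In a good state its vertices are not bad, since
    bad vertices lie in the basin of [b]. *)
Definition inK x := [&& x \in N, ~~ F0 x & x \notin B0].

Lemma inK_nbr x : inK x -> x \in N. Proof. by case/and3P. Qed.
Lemma inK_notF x : inK x -> ~~ F0 x. Proof. by case/and3P. Qed.
Lemma inK_neq_s x : inK x -> x != s.
Proof. by move/inK_notF; apply: contraNneq => ->. Qed.

Lemma inK_neq_b x : inK x -> x != b.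
Proof.
case/and3P=> xN _ xB; apply/eqP=> E; case/negP: xB.
by rewrite E; apply: basin_b; rewrite -E.
Qed.

Lemma good_not_bad psi z : good psi -> inK z -> ~ bad psi th0 s z.
Proof. by move=> G /and3P[zN _ zB] zb; case/negP: zB; apply: good_basin G zN _; right. Qed.

Lemma good_K_mis psi z : good psi -> inK z -> a \notin mis psi z.
Proof.
move=> G zK; have [[[V _ _] _] _] := G.
exact: (good_mis unc V (good_not_bad G zK) (connect0 _ z)).
Qed.

Lemma good_K_reach psi z w : good psi -> inK z -> reach psi th0 z w -> w \in N /\ w \notin B0.
Proof.
move=> G zK zw; have [zN _ zB] := and3P zK; split; first exact: connect_nbr zN zw.
apply: contra zB => wB; apply: (good_basin G) => //; left.
exact: connect_trans zw (keep_reach G.1.2 wB).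
Qed.

Lemma good_K_arrow psi z w : good psi -> inK z -> arrow psi th0 z w ->
  [/\ w \in N, w \notin B0, w != s & b != w].
Proof.
move=> G zK zw; have [wN wB] := good_K_reach G zK (connect1 zw); split=> //.
  apply/eqP=> E; apply: (good_not_bad G zK); exists z; [exact: connect0 | by rewrite -E].
by apply/eqP=> E; case/negP: wB; rewrite -E; apply: basin_b; rewrite E.
Qed.

Lemma semi_sw psi w z : semi psi -> w \in N -> w != s -> w \notin B0 ->
  ~~ same psi a (th0 w) z w -> semi (sw psi th0 s w z).
Proof.
move=> [D K] wN ws wB zw; split; first exact: der_sw.
have [V _ _] := D => y x yB xB yb yx.
rewrite (arrow_sw_other adjC unc V wN zw) ?K // ?(basin_neq_s xB) //.
by apply: contraNneq wB => <-.
Qed.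

Lemma sw_b psi w z : semi psi -> w \in N -> ~~ same psi a (th0 w) z b ->
  a \in mis psi b -> a \in mis (sw psi th0 s w z) b.
Proof.
move=> [[V _ _] _] wN /negbTE zb ab.
by rewrite (mis_sw _ _ V) zb.
Qed.

(** A change on a chain that avoids both [w] and [b] would keep the state good and make [y] bad. *)
Lemma good_same psi y w : good psi -> inK y -> arrow psi th0 y w ->
  ~~ same psi a (th0 w) y w -> same psi a (th0 w) y b.
Proof.
move=> G yK yw nyw; apply: contraT => nyb; have [S ab] := G; have [[V _ _] _] := S.
have [wN wB ws bw] := good_K_arrow G yK yw.
have G' : good (sw psi th0 s w y).
  by split; [apply: semi_sw | apply: sw_b].
exfalso; apply: (good_not_bad G' yK); exists y; first exact: connect0.
exact: arrow_sw_end.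
Qed.
(* Otherwise, after exchanging colours on the chain of u and moving the fan from v to l,
   both u and b can be made to miss [a], so that u is in the basin of b. *)
Lemma full_target_same psi u l : 0 < M -> good psi -> inK u -> prot psi u -> psi u s = a ->
  arrow psi th0 u l -> ~~ F0 l -> full l -> same psi a (th0 l) u l.
Proof.
move=> M0 G uK P us ul lF fl; apply: contraT => nul.
have [[D K] ab] := G; have [V _ _] := D; have [_ _ _ val] := V.
have [lN lB ls bl] := good_K_arrow G uK ul; have uN := inK_nbr uK.
have uns := inK_neq_s uK; have nub := inK_neq_b uK.
have sub := good_same G uK ul nul.
have bs : b != s by apply: contraNneq b_notin_F => ->.
have al : a != th0 l by rewrite (inj_in_eq inj0) // eq_sym.
pose psi1 := sw psi th0 s l u.
have D1 : der psi1 th0 by apply: der_sw.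
have [V1 _ _] := D1; have [pr1 _ _ _] := V1.
have hsu : hadj s u by have /andP[su _] := P M0; rewrite /hadj su !(nbr_neq adjI).
have au1 : a \in mis psi1 u by apply: arrow_mis (arrow_sw_end adjC unc V lN nul ul).
have wd : th0 l = psi1 s u.
  by rewrite (pr1.1 _ _ hsu) /psi1 /sw /kswap same_refl us tpermL.
have sv1 : arrow psi1 th0 s v by rewrite (der_arrow D1).
have [_ _ uv T2] := toggle_root adjC adjI unc nfq HF (der_top D1) sv1 fv hsu au1 lN wd.
have MS := root_mid adjC adjI unc V1 hsu au1 sv1 uv.
have sl2 := root_mid_new adjC adjI unc V1 hsu au1 sv1 uv lN wd.
set psi2 := mid _ _ _ _ _ _ _ in T2 MS sl2; have V2 := ms_valid MS.
have lu2 : th0 l \in mis psi2 u by rewrite wd (ms_bd MS).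
have lb2 : th0 l \in mis psi2 b.
  have bu : b != u by rewrite eq_sym.
  by rewrite wd (ms_d MS bs bu) -wd (mis_sw _ _ V) sub tpermR.
have r0 := connect0 (arrow psi2 th0) s.
have [psi3 R3] := fan_restore adjC adjI unc V2 r0 sl2 lb2 bs bl.
have [psi4 [T4 K4 ab4 au4]] : exists psi4,
    [/\ top psi4 th0 s, keep psi4, a \in mis psi4 b & a \in mis psi4 u].
  have T3 : top psi3 th0 s.
    have [_ q2 c2] := T2; split; [exact: rs_valid R3 | by rewrite -(rs_reach R3) |].
    by rewrite -c2; apply: eq_card => x; rewrite !inE (rs_reach R3).
  have K3 : keep psi3.
    apply: (keep_mis K) => y w yB wB yb wy.
    have wN : w \in N by move: wB; rewrite in_set => /andP[].
    have w1 : th0 w != a by rewrite (inj_in_eq inj0) ?basin_neq_s.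
    have w2 : th0 w != th0 l by rewrite (inj_in_eq inj0) //; apply: contraNneq lB => <-.
    have w3 : th0 w != th0 v.
      rewrite (inj_in_eq inj0) ?(arrow_nbr sv) //.
      by apply: contraTneq (basin_notin_F wB) => ->; rewrite negbK connect1.
    rewrite (rs_mis R3) // (ms_mis MS) -?wd // (mis_sw_other _ V) //.
  (* The change that frees [a] at [b] also frees it at [u] if both are on one chain. Otherwise [u]
     gets a change of its own, which leaves [b] alone. *)
  have [bu|nbu] := boolP (same psi2 a (th0 l) b u).
    by exists psi3; split; [| | exact: rs_a R3 | exact: (rs_on R3)].
  have sl3 : arrow psi3 th0 s l.
    by rewrite /arrow /fr (rs_fan R3 r0).
  have lu3 : th0 l \in mis psi3 u by rewrite (rs_off R3).
  have ul' : u != l := arrowI uN ul.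
  have r3 := connect0 (arrow psi3 th0) s.
  have [psi4 R4] := fan_restore adjC adjI unc (rs_valid R3) r3 sl3 lu3 uns ul'.
  exists psi4; split; last exact: rs_a R4.
  - have [_ q2 c2] := T3; split; [exact: rs_valid R4 | by rewrite -(rs_reach R4) |].
    by rewrite -c2; apply: eq_card => x; rewrite !inE (rs_reach R4).
  - apply: (keep_mis K3) => y w yB wB yb wy.
    have wN : w \in N by move: wB; rewrite in_set => /andP[].
    have w1 : th0 w != a by rewrite (inj_in_eq inj0) ?basin_neq_s.
    have w2 : th0 w != th0 l by rewrite (inj_in_eq inj0) //; apply: contraNneq lB => <-.
    by rewrite (rs_mis R4).
  - rewrite (rs_off R4) ?(rs_a R3) // (rs_same R3) sameC //.
    by have [] := V2.
have [_ _ uB] := and3P uK; case/negP: uB.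
apply: (keep_basin T4 K4 ab4 uN); right; exists u; first exact: connect0.
by rewrite arrowE // uns.
Qed.
(* Recolouring the edge [u b] with [th0 w] makes [u] point to [w2]. *)
Lemma toggle psi u w w2 : good psi -> inK u -> hadj u b -> prot psi u ->
  arrow psi th0 u w -> w2 \in N -> th0 w2 = psi u b ->
  (0 < M -> psi u s = a -> ~~ Lam (th0 w2)) ->
  [/\ inK w2, forall z, inK z -> ~~ arrow psi th0 z w2 &
    exists psi', [/\ good psi', arrow psi' th0 u w2, prot psi' u &
      forall z c, c != a -> c != th0 w -> c != th0 w2 ->
        (c \in mis psi' z) = (c \in mis psi z)]].
Proof.
move=> G uK ub P uw w2N w2d HL.
have [[D K] ab] := G; have [V _ _] := D; have [pr _ _ val] := V.
have [wN wB ws bw] := good_K_arrow G uK uw; have [uN uF uB] := and3P uK.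
have au := good_K_mis G uK; have nuw := arrowI uN uw.
have bs : b != s by apply: contraNneq b_notin_F => ->.
(* Otherwise a change on the chain of [u] would make [u] bad. It could destroy the protection only
   if [u s] has colour [a] and [w] is full outside the fan, the case settled by
   [full_target_same]. *)
have suw : same psi a (th0 w) u w.
  apply: contraT => nsuw; have D' := der_sw D wN ws nsuw.
  have P' : prot (sw psi th0 s w u) u.
    apply: prot_sw => // M0 us; rewrite Lam_th //; apply: contra nsuw => /andP[wF fw].
    exact: full_target_same.
  exfalso; apply: (prot_not_bad D' uN uF P').
  by exists u; [exact: connect0 | exact: arrow_sw_end].
have MS := mid_spec_mid adjC adjI V ub ab uw ws nuw au suw bw.
set psi1 := mid _ _ _ _ _ _ _ in MS.
have V1 := ms_valid MS; have [pr1 _ _ val1] := V1.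
have nub := ms_ub MS; have d_a := ms_ds MS; have d_w := ms_dw MS.
rewrite -w2d in d_a d_w.
have D1 : der psi1 th0.
  split=> // x sx; have [_ mE _] := D.
  have xu : x != u by apply: contraNneq uF => <-.
  have rx : reach psi th0 s x by rewrite (der_reach D).
  by rewrite (mid_fan adjC unc V ab uw ws suw MS rx xu) mE.
have BN y : y \in B0 -> y \in N by rewrite in_set => /andP[].
have K1 : keep psi1.
  apply: (keep_mis K) => y x yB xB yb xy.
  have [E|nE] := eqVneq (th0 x) (psi u b).
    by rewrite E (ms_d MS) -?E //; apply: contraNneq uB => <-.
  have xN := BN _ xB; have xa : th0 x != a by rewrite (inj_in_eq inj0) ?basin_neq_s.
  have xw : th0 x != th0 w.
    by rewrite (inj_in_eq inj0) //; apply: contraNneq wB => <-.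
  by rewrite (ms_mis MS).
have P1 : prot psi1 u by rewrite /prot (ms_edge_u MS) // eq_sym.
have dnu : th0 w2 \notin mis psi u by rewrite w2d; apply/misPn; exists b.
have dnb : th0 w2 \notin mis psi b.
  by rewrite w2d; apply/misPn; exists u; rewrite 1?hadjC // (pr.1 _ _ ub).
have w2s : w2 != s by apply: contraNneq d_a => ->.
have uw2 : u != w2 by apply: contraNneq dnu => <-; apply: val; rewrite ?inK_neq_s.
have a1 : arrow psi1 th0 u w2 by rewrite arrowE // uw2 (ms_u MS) d_w w2d eqxx.
have au1 := ms_ua MS.
have db1 : th0 w2 \in mis psi1 b by rewrite w2d (ms_bd MS).
have suw2 : same psi1 a (th0 w2) u w2.
  apply: contraT => nsuw; have D' := der_sw D1 w2N w2s nsuw.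
  have P' : prot (sw psi1 th0 s w2 u) u.
    by apply: prot_sw => // M0; rewrite (ms_edge_u MS) 1?eq_sym //; apply: HL.
  exfalso; apply: (prot_not_bad D' uN uF P').
  by exists u; [exact: connect0 | exact: arrow_sw_end].
have ku : kend psi1 a (th0 w2) u by rewrite /kend (negbTE au1) (arrow_mis a1).
have kw2 : kend psi1 a (th0 w2) w2.
  rewrite /kend val1 //; apply/eqP=> aw2; case/eqP: uw2; apply/esym.
  by apply: (same_isolated aw2 (val1 _ w2N w2s)); rewrite sameC.
have others x : x != u -> x != w2 -> kend psi1 a (th0 w2) x -> ~~ same psi1 a (th0 w2) x w2.
  move=> xu xw2 kx; apply/negP=> sx; case/eqP: xu; apply/esym.
  apply: (ends3 adjC adjI pr1 kw2 ku kx); rewrite 1?sameC // eq_sym //.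
have nbu1 : ~~ same psi1 a (th0 w2) b u.
  apply/negP=> sbu; have [ab1|ab1] := boolP (a \in mis psi1 b).
    by move: nub; rewrite (same_isolated ab1 db1 sbu) eqxx.
  have bw2 : b != w2.
    apply: contraNneq ab1 => E; rewrite E in dnb *.
    by rewrite val in dnb.
  have kb : kend psi1 a (th0 w2) b by rewrite /kend (negbTE ab1) db1.
  have bu : b != u by rewrite eq_sym.
  by case/negP: (others _ bu bw2 kb); apply: same_trans sbu suw2.
have w2F : ~~ F0 w2.
  apply/negP=> Fw2; have rw : reach psi1 th0 s w2 by rewrite (der_reach D1).
  have sw2 : s != w2 by rewrite eq_sym.
  have [x sx xw] := connect_last rw sw2.
  have ux : u != x by apply: contraNneq uF => ->; rewrite -(der_reach D1).
  by have [/negP[]] := fan_not_same adjC adjI unc V1 sx xw ku ux uw2.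
(* Otherwise a shift along the path from [w2] to [b] gives [b] the colour [th0 w2]. Then [u] points
   to [b], and a change on its chain, which avoids [b], makes [u] bad. *)
have w2B : w2 \notin B0.
  apply/negP=> w2B; have w2b := keep_reach K1 w2B; have bN := connect_nbr w2N w2b.
  have [th1 [Q [inj1 mis1 t1b off QP]]] := shift_connect inj0 w2N w2b.
  have bF : ~~ full b by apply: basin_not_full; apply: basin_b.
  have V1' : valid psi1 th1 s.
    split=> // x xN xs; have [xQ|xQ] := boolP (x \in Q); last by rewrite off ?val1.
    by have [->|xb] := eqVneq x b; [rewrite t1b | apply: mis1].
  have D1' : der psi1 th1.
    have [_ mE _] := D1; split=> // x xN xs Fx; apply: off; apply/negP=> /QP[_ xb].
    case/orP: Fx => [sx|fx].
      by case/negP: b_notin_F; rewrite -(der_reach D1); apply: connect_trans xb; rewrite der_reach.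
    by move: bF; rewrite -(sink_reach adjC adjI V1 xN xs fx xb) fx.
  have t1s : th1 s = a.
    apply: off; apply/negP=> /QP[_ sb].
    by case/negP: b_notin_F; rewrite -(der_reach D1).
  have nub1 : ~~ same psi1 (th1 s) (th1 b) u b by rewrite t1s t1b sameC.
  have a1' : arrow psi1 th1 u b by rewrite arrowE // nub t1b (arrow_mis a1).
  have D2 := der_sw D1' bN bs nub1.
  have P2 : prot (sw psi1 th1 s b u) u.
    apply: prot_sw => // _ _.
    by rewrite t1b Lam_th // (negbTE (basin_not_full w2B)) andbF.
  apply: (prot_not_bad D2 uN uF P2).
  by exists u; [exact: connect0 | exact: arrow_sw_end].
have w2K : inK w2 by rewrite /inK w2N w2F.
have bw2 : b != w2 by rewrite eq_sym inK_neq_b.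
have [psi2 R] : exists psi2, restored adj r psi1 th0 s w2 b psi2.
  apply: restore => // ab1; apply: others; rewrite // 1?eq_sym //.
  by rewrite /kend (negbTE ab1) db1.
have D2 : der psi2 th0.
  have [_ mE _] := D1; split=> [|x sx|//]; first exact: rs_valid R.
  by rewrite (rs_fan R) ?mE ?(der_reach D1).
have G2 : good psi2.
  split; last exact: rs_a R.
  split=> //; apply: (keep_mis K1) => y x yB xB yb xy.
  have xN := BN _ xB; have xa : th0 x != a by rewrite (inj_in_eq inj0) ?basin_neq_s.
  have xw : th0 x != th0 w2.
    by rewrite (inj_in_eq inj0) //; apply: contraNneq w2B => <-.
  by rewrite (rs_mis R).
split=> //; last first.
  exists psi2; split=> //.
  - by rewrite /arrow /fr (rs_off R).
  - by rewrite /prot (rs_edge_off R).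
  - by move=> z c ca cw cw2; rewrite (rs_mis R) // (ms_mis MS) -?w2d.
(* The chain of [w2] ends in [u] and [w2], so it does not contain [z]. By [good_same], [z] would be
   on the chain of [b], and freeing [a] at [b] would free it at [z], which no vertex of K allows. *)
move=> z zK; apply/negP=> zw2; have dz := arrow_mis zw2; have zN := inK_nbr zK.
have zu : z != u by apply: contraNneq dnu => <-.
have zb := inK_neq_b zK; have nzw2 := arrowI zN zw2.
have dz1 : th0 w2 \in mis psi1 z by rewrite w2d (ms_d MS) // -w2d.
have az2 := good_K_mis G2 zK.
have [bz|nbz] := boolP (same psi1 a (th0 w2) b z).
  by case/negP: az2; apply: (rs_on R).
have az1 : a \notin mis psi1 z by rewrite -(rs_off R).
have kz : kend psi1 a (th0 w2) z by rewrite /kend (negbTE az1) dz1.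
have zw2' : arrow psi2 th0 z w2 by rewrite arrowE // nzw2 (rs_off R).
have nzw := others _ zu nzw2 kz; rewrite -(rs_same R) in nzw.
have := good_same G2 zK zw2' nzw; rewrite (rs_same R) sameC //.
by apply/negP.
Qed.
Lemma deficient_arrow psi th u : valid psi th s -> u \in N -> u != s -> ~~ full u ->
  exists w, arrow psi th u w.
Proof.
move=> V uN us; rewrite (full_sink adjC adjI V uN us) => /set0Pn[c cu].
by have [w wN wc] := surj cardN V c; exists w; rewrite /arrow wN wc.
Qed.

Lemma hadj_K u : inK u -> adj b u -> hadj u b.
Proof. by move=> uK bu; rewrite /hadj adjC bu br (nbr_neq adjI (inK_nbr uK)). Qed.

(** Apart from [a], only [th0 w] and [th0 w2] can change between the two states of [toggle]. So
    whatever [w2] reaches is reached by [u] in one of them, and a protected vertex of K reaches only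
    K. *)
Lemma toggle_reach psi u w2 z : good psi -> inK u -> ~~ full u -> hadj u b ->
  prot psi u -> w2 \in N -> th0 w2 = psi u b -> reach psi th0 w2 z -> z != w2 -> inK z.
Proof.
move=> G uK nfu ub P w2N w2d w2z zw2.
have [[D K] ab] := G; have [V _ _] := D; have [pr _ _ val] := V.
have w2s : w2 != s.
  apply: contraTneq ab => E; rewrite -E w2d (pr.1 _ _ ub).
  by apply/misPn; exists u; rewrite 1?hadjC.
have nf : ~~ full w2.
  apply: contra zw2 => f2; apply/eqP/esym.
  exact: (sink_reach adjC adjI V w2N w2s f2 w2z).
have [w uw] := deficient_arrow V (inK_nbr uK) (inK_neq_s uK) nfu.
have HL : 0 < M -> psi u s = a -> ~~ Lam (th0 w2).
  by move=> _ _; rewrite Lam_th // (negbTE nf) andbF.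
have [w2K src [psi' [G' uw2 P' mE]]] := toggle G uK ub P uw w2N w2d HL.
have [D' _] := G'.1; have [uN uF uB] := and3P uK.
have wa : th0 w != a by rewrite (inj_in_eq inj0) ?(arrow_nbr uw) //; case: (good_K_arrow G uK uw).
have H1 x : reach psi th0 u x -> inK x.
  move=> ux; have [xN xB] := good_K_reach G uK ux.
  by rewrite /inK xN xB (prot_reach D uN uF P ux).
have H2 x : reach psi' th0 u x -> inK x.
  move=> ux; have [xN xB] := good_K_reach G' uK ux.
  by rewrite /inK xN xB (prot_reach D' uN uF P' ux).
suff H x : reach psi th0 w2 x -> reach psi th0 u x || reach psi' th0 u x.
  by have /orP[/H1|/H2] := H _ w2z.
move: x; apply: connect_ind => [|y x w2y + yx]; first by rewrite (connect1 uw2) orbT.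
case/orP=> uy; first by rewrite (connect_trans uy (connect1 yx)).
have yK := H2 _ uy; have [xN xB xs _] := good_K_arrow G yK yx.
have xw2 : x != w2 by apply/eqP=> E; case/negP: (src _ yK); rewrite -E.
have [->|xw] := eqVneq x w; first by rewrite (connect1 uw).
apply/orP; right; apply: connect_trans uy (connect1 _).
have yN := inK_nbr yK; have wN := arrow_nbr uw.
by rewrite arrowE // (arrowI yN yx) mE ?(arrow_mis yx) // (inj_in_eq inj0).
Qed.

(** Stronger than [prot], so that it survives as [prot] after the changes of [converge]: these could
    turn colour [a] on [u s] into a colour of [Lam]. *)
Definition sprot psi u : Prop :=
  0 < M -> [&& adj s u, ~~ Lam (psi u s) & psi u s != a].

Lemma sprot_prot psi u : sprot psi u -> prot psi u.
Proof. by move=> P M0; have /and3P[-> ->] := P M0. Qed.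

Record converged psi w z psi' : Prop := Converged {
  cv_good : good psi';
  cv_z : th0 v \in mis psi' z;
  cv_w : forall x, inK x -> x != z -> th0 w \in mis psi x -> th0 w \in mis psi' x;
  cv_mis : forall x c, c != a -> c != th0 v -> c != th0 w ->
    (c \in mis psi' x) = (c \in mis psi x);
  cv_edge : forall x y, psi x y != a -> psi x y != th0 v -> psi x y != th0 w ->
    psi' x y = psi x y;
  cv_prot : forall u, inK u -> sprot psi u -> prot psi' u }.

Let vN : v \in N. Proof. exact: arrow_nbr sv. Qed.
Let vs : v != s. Proof. by case: (fan_link adjC unc V0 (connect0 _ s) sv). Qed.
Let Fv : F0 v. Proof. exact: connect1. Qed.
Let va : th0 v != a. Proof. by rewrite (inj_in_eq inj0). Qed.

Lemma restore_good psi : semi psi -> th0 v \in mis psi b ->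
  exists2 psi', restored adj r psi th0 s v b psi' & good psi'.
Proof.
move=> [D K] vb; have [V mE tE] := D.
have sv' : arrow psi th0 s v by rewrite (der_arrow D).
have bs : b != s by apply: contraNneq b_notin_F => ->.
have bv : b != v by apply: contraNneq b_notin_F => ->.
have [psi' R] := fan_restore adjC adjI unc V (connect0 _ s) sv' vb bs bv.
exists psi' => //; split; last exact: rs_a R.
split.
  split=> [|x sx|//]; first exact: rs_valid R.
  have rx : reach psi th0 s x by rewrite (der_reach D).
  by rewrite (rs_fan R rx) mE.
apply: (keep_mis K) => y x yB xB yb xy.
have xN : x \in N by move: xB; rewrite in_set => /andP[].
rewrite (rs_mis R) // (inj_in_eq inj0) ?basin_neq_s //.
by apply: contraNneq (basin_notin_F xB) => ->.
Qed.

Lemma v_edge psi u : der psi th0 -> hadj s u -> psi u s != th0 v.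
Proof.
move=> D su; have [[pr _ _ _] _ _] := D; rewrite -(pr.1 _ _ su).
have sv' : arrow psi th0 s v by rewrite (der_arrow D).
by move/misP: (arrow_mis sv'); apply.
Qed.

Lemma prot_restored psi psi' z u : prot psi u -> restored adj r psi th0 s v z psi' ->
  prot psi' u.
Proof.
move=> P R M0; have /andP[-> nl] := P M0.
case: (rs_val R u s) => -> //=; case: tpermP => [_|_|//]; last by rewrite Lam_a.
by rewrite Lam_th // Fv.
Qed.

(* When two vertices of K miss the same colour [th0 w], one of them is freed from it
   and made to miss the colour of v instead. *)
Lemma converge psi y z w : good psi -> inK y -> inK z -> y != z -> inK w ->
  arrow psi th0 y w -> arrow psi th0 z w ->
  exists psi' x, (x = y \/ x = z) /\ converged psi w x psi'.
Proof.
move=> G yK zK yz wK yw zw.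
have [S ab] := G; have [D K] := S; have [V _ _] := D; have [pr inj _ val] := V.
have yN := inK_nbr yK; have zN := inK_nbr zK; have wN := inK_nbr wK.
have wB : w \notin B0 by case/and3P: wK.
have ws := inK_neq_s wK.
have vB : v \notin B0 by apply: contraL Fv; apply: basin_notin_F.
have vw : v != w by apply: contraTneq Fv => ->; exact: inK_notF wK.
have wa : th0 w != a by rewrite (inj_in_eq inj0).
have wv : th0 w != th0 v by rewrite (inj_in_eq inj0) // eq_sym.
have triv x : x = y \/ x = z -> th0 v \in mis psi x -> exists psi' x',
    (x' = y \/ x' = z) /\ converged psi w x' psi'.
  move=> xyz vx; exists psi, x; split=> //; split=> // u uK P; exact: sprot_prot.
have [vy|vy] := boolP (th0 v \in mis psi y); first by apply: (triv y) => //; left.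
have [vz|vz] := boolP (th0 v \in mis psi z); first by apply: (triv z) => //; right.
have yz_K x : x = y \/ x = z -> inK x by case=> ->.
have xw_ x : x = y \/ x = z -> x != w.
  by case=> ->; [apply: arrowI yN yw | apply: arrowI zN zw].
have choose psi1 : semi psi1 ->
    (forall x, x = y \/ x = z -> (a \notin mis psi1 x) && (th0 w \in mis psi1 x)) ->
    exists x, (x = y \/ x = z) /\ ~~ same psi1 a (th0 w) x w.
  move=> [[V1 _ _] _] H1.
  have /andP[ay ty] := H1 _ (or_introl erefl); have /andP[az tz] := H1 _ (or_intror erefl).
  have [nyw|nzw] := two_preds adjC adjI V1 wN ws yz (arrowI yN yw) (arrowI zN zw) ay az ty tz.
    by exists y; split=> //; left.
  by exists z; split=> //; right.
have aw x : x = y \/ x = z -> (a \notin mis psi x) && (th0 w \in mis psi x).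
  by case=> ->; rewrite ?(good_K_mis G yK) ?(good_K_mis G zK) ?(arrow_mis yw) ?(arrow_mis zw).
have nv x : x = y \/ x = z -> th0 v \notin mis psi x by case=> ->.
have us_v u : inK u -> 0 < M -> sprot psi u -> psi u s != th0 v.
  move=> uK M0 P; have /and3P[su _ _] := P M0; apply: v_edge => //.
  by rewrite /hadj su !(nbr_neq adjI) // inK_nbr.
have [vb|vb] := boolP (th0 v \in mis psi b).
  (* The change on the chain of [x] takes [a] away from [b] and frees it at [x]. Regaining [a] at
     [b] through [th0 v] must take [a] away from [x] again, hence leaves [x] missing [th0 v]. *)
  have [x [xyz nxw]] := choose _ S aw; have xK := yz_K _ xyz.
  have /andP[ax tx] := aw _ xyz; have xw : arrow psi th0 x w by case: xyz => ->.
  have sxb := good_same G xK xw nxw.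
  have nxb := inK_neq_b xK.
  pose psi1 := sw psi th0 s w x.
  have S1 : semi psi1 by apply: semi_sw.
  have tb : th0 w \notin mis psi b.
    apply/negP=> tb; case/eqP: nxb; apply/esym; apply: (same_isolated ab tb).
    by rewrite sameC.
  have vb1 : th0 v \in mis psi1 b by rewrite (mis_sw_other _ V) // eq_sym.
  have [psi2 R G2] := restore_good S1 vb1.
  have ax1 : a \in mis psi1 x by rewrite (mis_sw _ _ V) same_refl tpermL.
  exists psi2, x; split=> //; split=> //.
  - apply: (rs_on2 R) => //; apply: contraT => nbx.
    by have := good_K_mis G2 xK; rewrite (rs_off R nbx) ax1.
  - move=> x' x'K xx' tx'; rewrite (rs_mis R) // (mis_sw _ _ V).
    have -> // : same psi a (th0 w) x x' = false.
    apply/negP=> sxx'; have ax' := good_K_mis G x'K.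
    have kx : kend psi a (th0 w) x by rewrite /kend (negbTE ax) tx.
    have kx' : kend psi a (th0 w) x' by rewrite /kend (negbTE ax') tx'.
    have kb : kend psi a (th0 w) b by rewrite /kend ab (negbTE tb).
    have x'x : x != x' by rewrite eq_sym.
    have E := ends3 adjC adjI pr kx kb kx' sxb sxx' nxb x'x.
    by have := inK_neq_b x'K; rewrite E eqxx.
  - by move=> x' c ca cv cw; rewrite (rs_mis R) // (mis_sw_other _ V).
  - move=> x' x'' ca cv cw; have E : psi1 x' x'' = psi x' x'' by apply: kswap_edge.
    by rewrite (rs_edge R) E.
  - move=> u uK P; apply: (prot_restored _ R) => M0; apply: prot_sw => //.
      exact: sprot_prot.
    by move=> _ us; have /and3P[_ _ /negP[]] := P M0; rewrite us.
have bs : b != s by apply: contraNneq b_notin_F => ->.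
have bv : b != v by apply: contraNneq b_notin_F => ->.
have kb : kend psi a (th0 v) b by rewrite /kend ab (negbTE vb).
have sv' : arrow psi th0 s v by rewrite (der_arrow D).
have [nbv _] := fan_not_same adjC adjI unc V (connect0 _ s) sv' kb bs bv.
(* First [b] gives up [a] for [th0 v]. After the change at [x] it regains [a], and [x] is carried
   along as in the previous case. *)
pose psi1 := sw psi th0 s v b.
have S1 : semi psi1 by apply: semi_sw.
have [[V1 _ _] _] := S1; have [pr1 _ _ _] := V1.
have vb1 : th0 v \in mis psi1 b by rewrite (mis_sw _ _ V) same_refl tpermR.
have av1 x : x = y \/ x = z -> (a \notin mis psi1 x) && (th0 v \notin mis psi1 x).
  move=> xyz; have /andP[ax _] := aw _ xyz; have vx := nv _ xyz.
  by rewrite !(mis_sw _ _ V); case: ifP; rewrite ?tpermL ?tpermR ax vx.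
have [x [xyz nxw]] : exists x, (x = y \/ x = z) /\ ~~ same psi1 a (th0 w) x w.
  apply: choose => // x xyz; have /andP[-> _] := av1 _ xyz; have /andP[_ tx] := aw _ xyz.
  by rewrite (mis_sw_other _ V) // eq_sym.
have xK := yz_K _ xyz; have nxb := inK_neq_b xK; have /andP[ax1 vx1] := av1 _ xyz.
have /andP[_ tx] := aw _ xyz.
have tx1 : th0 w \in mis psi1 x by rewrite (mis_sw_other _ V).
pose psi2 := sw psi1 th0 s w x.
have S2 : semi psi2 by apply: semi_sw.
have [[V2 _ _] _] := S2; have [pr2 _ _ _] := V2.
have ax2 : a \in mis psi2 x by rewrite (mis_sw _ _ V1) same_refl tpermL.
have vx2 : th0 v \notin mis psi2 x by rewrite (mis_sw_other _ V1) // eq_sym.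
have vb2 : th0 v \in mis psi2 b by rewrite (mis_sw_other _ V1) // eq_sym.
have ab2 : a \notin mis psi2 b.
  by apply/negP=> ab2; have := good_K_mis (conj S2 ab2) xK; rewrite ax2.
have [psi3 R G3] := restore_good S2 vb2.
have to_b x' : inK x' -> a \in mis psi2 x' -> same psi2 a (th0 v) b x'.
  move=> x'K ax'; apply: contraT => nbx'.
  by have := good_K_mis G3 x'K; rewrite (rs_off R nbx') ax'.
exists psi3, x; split=> //; split=> //.
- by apply: (rs_on2 R) => //; apply: to_b.
- move=> x' x'K xx' tx'; rewrite (rs_mis R) //.
  have tx1' : th0 w \in mis psi1 x' by rewrite (mis_sw_other _ V).
  rewrite (mis_sw _ _ V1); have -> // : same psi1 a (th0 w) x x' = false.
  apply/negP=> sxx'.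
  have ax2' : a \in mis psi2 x' by rewrite (mis_sw _ _ V1) sxx' tpermL.
  have nx'b := inK_neq_b x'K.
  have kb2 : kend psi2 a (th0 v) b by rewrite /kend (negbTE ab2) vb2.
  have kx2 : kend psi2 a (th0 v) x by rewrite /kend ax2 (negbTE vx2).
  have bx' : b != x' by rewrite eq_sym.
  have bx : b != x by rewrite eq_sym.
  have vx2' : th0 v \notin mis psi2 x'.
    apply/negP=> vx'; case/eqP: nx'b; apply: (same_isolated ax2' vx').
    by rewrite sameC // to_b.
  have kx2' : kend psi2 a (th0 v) x' by rewrite /kend ax2' (negbTE vx2').
  have E := ends3 adjC adjI pr2 kb2 kx2 kx2' (to_b _ xK ax2) (to_b _ x'K ax2') bx bx'.
  by move: xx'; rewrite E eqxx.
- by move=> x' c ca cv cw; rewrite (rs_mis R) // (mis_sw_other _ V1) // (mis_sw_other _ V).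
- move=> x' x'' ca cv cw; have E : psi1 x' x'' = psi x' x'' by apply: kswap_edge.
  have E2 : psi2 x' x'' = psi x' x'' by rewrite -E; apply: kswap_edge; rewrite E.
  by rewrite (rs_edge R) E2.
- move=> u uK P; apply: (prot_restored _ R) => M0; apply: prot_sw => //.
    apply: prot_sw => //; first exact: sprot_prot.
    by move=> _ _; rewrite Lam_th // Fv.
  move=> _; rewrite /psi1 /sw /kswap; have /and3P[_ _ na] := P M0; have nv' := us_v u uK M0 P.
  case: ifP => _; last by move=> E; move: na; rewrite E eqxx.
  case: tpermP => [E|E|_ _] E'; move: na nv'; rewrite ?E ?E' ?eqxx //.
Qed.
Lemma good0 : good psi0.
Proof. by do 2!split=> //; split. Qed.

(** A path to [z] keeps its arrows up to its first visit to [z], and [z] now points to [v]. This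
    links [d] to the fan, which the callers refute. *)
Lemma converged_reach psi w z psi' d : good psi -> inK w -> converged psi w z psi' ->
  (forall x, reach psi th0 d x -> inK x) -> reach psi th0 d z -> reach psi' th0 d v.
Proof.
move=> G wK CV dK dz; have wN := inK_nbr wK.
have zK := dK _ dz; have zN := inK_nbr zK.
have zv : arrow psi' th0 z v.
  rewrite arrowE // (cv_z CV) andbT; apply: contraTneq Fv => <-; exact: inK_notF.
apply: connect_trans (connect1 zv).
suff H x : reach psi th0 d x -> reach psi' th0 d x || reach psi' th0 d z.
  by have /orP[] := H _ dz.
move: x; apply: connect_ind => [|y x dy + yx]; first by rewrite connect0.
case/orP=> dy'; last by rewrite dy' orbT.
have [yz|yz] := eqVneq y z; first by rewrite -yz dy' orbT.
have yK := dK _ dy; have yN := inK_nbr yK.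
have xK : inK x by apply: dK; apply: connect_trans dy (connect1 yx).
have xN := inK_nbr xK; apply/orP; left; apply: connect_trans dy' (connect1 _).
rewrite arrowE // (arrowI yN yx) /=; have tx := arrow_mis yx.
have [E|xw] := eqVneq x w; first by rewrite E (cv_w CV) // -E.
have xv : x != v by apply: contraTneq Fv => <-; exact: inK_notF.
by rewrite (cv_mis CV) // (inj_in_eq inj0) // inK_neq_s.
Qed.

(** The sinks of [X] are full, because a deficient vertex has a free colour and every colour is
    carried by some neighbour of [r]. *)
Lemma K_count (X W : {set T}) : W \subset X -> (forall x, x \in X -> inK x) ->
  (forall x y, x \in X -> arrow psi0 th0 x y -> y \in X :\: W) ->
  (forall x x' y, x \in X -> x' \in X -> arrow psi0 th0 x y -> arrow psi0 th0 x' y -> x = x') ->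
  #|W| <= #|[set l in N | ~~ F0 l && full l]|.
Proof.
move=> WX XK out uniq; apply: leq_trans (card_sources WX out uniq) _.
apply: subset_leq_card; apply/subsetP=> x; rewrite in_set => /andP[/XK xK nx].
rewrite in_set (inK_nbr xK) (inK_notF xK) /=; apply: contraR nx => nf.
have [w xw] := deficient_arrow V0 (inK_nbr xK) (inK_neq_s xK) nf.
by apply/existsP; exists w.
Qed.

Definition targets (U : {set T}) : {set T} :=
  [set w in N | [exists u in U, th0 w == psi0 u b]].

Lemma targetsP (U : {set T}) w :
  reflect (exists u, [/\ u \in U, w \in N & th0 w = psi0 u b]) (w \in targets U).
Proof.
rewrite /targets in_set; apply: (iffP andP); last first.
  by case=> u [uU wN E]; split=> //; apply/existsP; exists u; rewrite uU E eqxx.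
by case=> wN /existsP[u /andP[uU /eqP E]]; exists u.
Qed.

Lemma targets_card (U : {set T}) : (forall u, u \in U -> hadj u b) -> #|U| <= #|targets U|.
Proof.
move=> Ub; have inj : {in U &, injective (fun u => psi0 u b)}.
  move=> u u' /Ub ub /Ub u'b; rewrite (pr0.1 _ _ ub) (pr0.1 _ _ u'b).
  by apply: pr0.2; rewrite hadjC.
rewrite -(card_in_imset inj).
apply: leq_trans (leq_imset_card th0 (mem (targets U))).
apply: subset_leq_card; apply/subsetP=> c /imsetP[u uU ->].
have [w wN E] := surj cardN V0 (psi0 u b).
by rewrite -E; apply: imset_f; apply/targetsP; exists u.
Qed.

(** [K_count] is applied to all that [D] and its targets reach. If some vertex had two predecessors
    there, [converge] would make a member of [D] or a target reach [v], against [prot_reach] or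
    [toggle_reach]. *)
Lemma outer_count (D : {set T}) :
  (forall u, u \in D -> [/\ inK u, ~~ full u, adj b u & sprot psi0 u]) ->
  #|D| <= #|[set l in N | ~~ F0 l && full l]|.
Proof.
move=> HD; pose W := targets D.
have Db u : u \in D -> hadj u b by move=> /HD[uK _ bu _]; apply: hadj_K.
apply: leq_trans (targets_card Db) _.
have W_ok w : w \in W -> inK w /\ (forall z, inK z -> ~~ arrow psi0 th0 z w).
  case/targetsP=> u [uD wN wd]; have [uK nfu bu P] := HD _ uD.
  have [w' uw'] := deficient_arrow V0 (inK_nbr uK) (inK_neq_s uK) nfu.
  have [|wK src _] := toggle good0 uK (Db _ uD) (sprot_prot P) uw' wN wd; last by [].
  by move=> M0 us; have /and3P[_ _ /eqP[]] := P M0.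
pose X := [set x | [exists d in D :|: W, reach psi0 th0 d x]].
have XP x : reflect (exists2 d, d \in D :|: W & reach psi0 th0 d x) (x \in X).
  rewrite in_set; apply: (iffP existsP) => [[d /andP[]]|[d dW dx]]; first by exists d.
  by exists d; rewrite dW.
have dK d x : d \in D :|: W -> reach psi0 th0 d x -> inK x.
  rewrite in_setU => /orP[dD|dW] dx.
    have [uK _ _ P] := HD _ dD; have [xN xB] := good_K_reach good0 uK dx.
    by rewrite /inK xN xB (prot_reach good0.1.1 (inK_nbr uK) (inK_notF uK) (sprot_prot P) dx).
  have [->|xd] := eqVneq x d; first by have [] := W_ok _ dW.
  have /targetsP[u [uD wN wd]] := dW; have [uK nfu bu P] := HD _ uD.
  exact: (toggle_reach good0 uK nfu (Db _ uD) (sprot_prot P) wN wd dx).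
have XK x : x \in X -> inK x by case/XP=> d dW /dK; apply.
have outX x y : x \in X -> arrow psi0 th0 x y -> y \in X.
  by case/XP=> d dW dx xy; apply/XP; exists d => //; apply: connect_trans dx (connect1 xy).
have outW x y : x \in X -> arrow psi0 th0 x y -> y \notin W.
  by move=> /XK xK xy; apply/negP=> /W_ok[_ /(_ x xK)]; rewrite xy.
apply: (K_count _ XK) => [|x y xX xy|x x' y xX x'X xy x'y].
- by apply/subsetP=> w wW; apply/XP; exists w; rewrite ?in_setU ?wW ?orbT ?connect0.
- by rewrite in_setD (outX _ _ xX xy) (outW _ _ xX xy).
apply/eqP; apply: contraT => nxx'.
have yK := XK _ (outX _ _ xX xy).
have [psi' [z [xz CV]]] := converge good0 (XK _ xX) (XK _ x'X) nxx' yK xy x'y.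
have zX : z \in X by case: xz => ->.
have [d dDW dz] := XP _ zX.
have dv := converged_reach good0 yK CV (fun x => dK d x dDW) dz.
have G' := cv_good CV; have [[D' _] _] := G'.
move: dDW; rewrite in_setU => /orP[dD|dW].
  have [uK _ _ P] := HD _ dD.
  have := prot_reach D' (inK_nbr uK) (inK_notF uK) (cv_prot CV uK P) dv.
  by rewrite Fv.
have /targetsP[u [uD dN dd]] := dW; have [uK nfu bu P] := HD _ uD.
have ub := Db _ uD; have dKK := (W_ok _ dW).1.
have dv' : v != d by apply: contraTneq Fv => ->; exact: inK_notF.
have dd' : th0 d = psi' u b.
  rewrite (cv_edge CV) // -dd (inj_in_eq inj0) ?(inK_nbr yK) ?inK_neq_s // 1?eq_sym //.
  by apply: contraTneq dW => E; rewrite -E; apply: outW xX xy.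
have := toggle_reach G' uK nfu ub (cv_prot CV uK P) dN dd' dv dv'.
by move/inK_notF; rewrite Fv.
Qed.
(* The fan of [psi] with its root moved to [u]. *)
Record rooted psi u th : Prop := Rooted {
  rt_valid : valid psi th u;
  rt_u : th u = a;
  rt_off : forall x, ~~ F0 x -> th x = th0 x;
  rt_F : F0 =1 reach psi th u }.

Lemma rootedP psi u : der psi th0 -> F0 u -> exists th, rooted psi u th.
Proof.
move=> D Fu; have [V _ _] := D; have ru : reach psi th0 s u by rewrite (der_reach D).
have [th1 [V1 t1 off eqF]] := reroot adjC adjI unc V ru.
exists th1; split=> //; first by move=> x Fx; rewrite off // (der_reach D).
by move=> x; rewrite -eqF (der_reach D).
Qed.

(* [psi'] recolours the edge [u b] and keeps a predecessor of [y1] in the fan of [u]. *)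
Record inner psi u th y1 psi' : Prop := Inner {
  in_t : exists t, [/\ F0 t, t != y1 & mid_spec adj r psi th u u b t psi'];
  in_y : exists y, [/\ F0 y, reach psi' th u y & arrow psi' th y y1] }.

(** * Recolouring [u b] for a vertex [u] of the fan *)

Section Inner.
Variables (psi : T -> T -> C) (u w : T).
Hypothesis G : good psi.
Hypotheses (Fu : F0 u) (nfu : ~~ full u) (ub : hadj u b).
Hypotheses (wN : w \in N) (wd : th0 w = psi u b).

Let D : der psi th0. Proof. by case: G => [[]]. Qed.
Let uN : u \in N. Proof. exact: F0N. Qed.

Lemma innerP th y1 : rooted psi u th -> F0 y1 -> y1 != u -> exists psi', inner psi u th y1 psi'.
Proof.
move=> R Fy y1u; have V1 := rt_valid R.
have ab : th u \in mis psi b by rewrite (rt_u R) G.2.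
have ry : reach psi th u y1 by rewrite -(rt_F R).
have [t [y [ut bt ty [uy yy uy' yy']]]] :=
  branch adjC adjI unc V1 ub ab (fan_deficient adjC adjI V1 (connect0 _ u) nfu) ry y1u.
exists (mid adj r psi (th u) (th t) u b); split.
  by exists t; split=> //; [rewrite (rt_F R) connect1 | apply: root_mid].
by exists y; split=> //; rewrite (rt_F R).
Qed.

Lemma inner_valid th y1 psi' : inner psi u th y1 psi' -> valid psi' th u.
Proof. by case=> [[t [_ _ MS]] _]; apply: ms_valid MS. Qed.

Let wF : ~~ F0 w.
Proof.
have [V _ _] := D; rewrite -(der_reach D).
apply: (toggle_outside adjC adjI unc cardN V G.2 _ nfu ub wN wd).
by rewrite (der_reach D).
Qed.

Lemma inner_new th y1 psi' : rooted psi u th -> inner psi u th y1 psi' -> arrow psi' th u w.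
Proof.
move=> R I; have [_ _ inj _] := inner_valid I; case: I => [[t [Ft _ MS]] _].
have d := rt_off R wF; rewrite wd in d.
rewrite arrowE // (ms_u MS) d (ms_dw MS) eqxx andbT.
by apply: contraNneq wF => <-.
Qed.

(** The two colours of the Kempe change are carried by [u] and [t], both in the fan, so they differ
    from that of [y]; the third affected colour, the old one of [u b], is lost at no vertex outside
    the fan. *)
Lemma inner_mis th y1 psi' x y : rooted psi u th -> inner psi u th y1 psi' ->
  ~~ F0 x -> y \in N -> ~~ F0 y -> th0 y \in mis psi x -> th y \in mis psi' x.
Proof.
move=> R I Fx yN Fy yx; have [_ _ inj _] := inner_valid I.
case: I => [[t [Ft _ MS]] _].
have ty := rt_off R Fy.
have xu : x != u by apply: contraNneq Fx => ->.
have [E|nE] := eqVneq (th y) (psi u b).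
  rewrite E; have [->|xb] := eqVneq x b; first exact: (ms_bd MS).
  by rewrite (ms_d MS) // -E ty.
have yu : th y != th u by rewrite (inj_in_eq inj) //; apply: contraNneq Fy => ->.
have yt : th y != th t by rewrite (inj_in_eq inj) ?(F0N Ft) //; apply: contraNneq Fy => ->.
by rewrite (ms_mis MS) // ty.
Qed.

Lemma inner_arrow th y1 psi' x y : rooted psi u th -> inner psi u th y1 psi' ->
  x \in N -> ~~ F0 x -> ~~ F0 y -> arrow psi th0 x y -> arrow psi' th x y.
Proof.
move=> R I xN Fx Fy xy; have yN := arrow_nbr xy; have [_ _ inj _] := inner_valid I.
by rewrite arrowE // (arrowI xN xy) (inner_mis R I) // (arrow_mis xy).
Qed.

(* If [w] were in the basin of [b], then after recolouring [u b] the vertex [b] would be in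
   the fan of [u] and would be a second predecessor of [w]. *)
Lemma inner_target : inK w.
Proof.
rewrite /inK wN wF; apply/negP=> wB; have wb := keep_reach G.1.2 wB.
have bN := connect_nbr wN wb; have [V _ _] := D; have [pr _ _ val] := V.
have [th R] := rootedP D Fu.
have [y1 Fy1 y1u] : exists2 y1, F0 y1 & y1 != u.
  have [us|us] := eqVneq u s; last by exists s; [exact: connect0 | rewrite eq_sym].
  by exists v; rewrite // us.
have [psi' I] := innerP R Fy1 y1u; have V' := inner_valid I.
have uw := inner_new R I.
have wb' : reach psi' th w b.
  suff H x : reach psi th0 w x -> reach psi th0 x b -> reach psi' th w x by apply: H.
  have bF z : reach psi th0 z b -> ~~ F0 z.
    move=> zb; apply: contra b_notin_F => Fz; rewrite -(der_reach D).
    by apply: connect_trans zb; rewrite (der_reach D).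
  move: x; apply: connect_ind => [|y x wy IH yx xb]; first by rewrite connect0.
  have yb := connect_trans (connect1 yx) xb; have yN := connect_nbr wN wy.
  by apply: connect_trans (IH yb) (connect1 _); apply: (inner_arrow R I); rewrite ?bF.
have bs : b != s by apply: contraNneq b_notin_F => ->.
have bw : b != w.
  have dnb : th0 w \notin mis psi b.
    by rewrite wd (pr.1 _ _ ub); apply/misPn; exists u; rewrite 1?hadjC.
  by apply: contraNneq dnb => <-; apply: val.
have [t [_ _ MS]] := in_t I; have [_ _ inj _] := V'.
have bw' : arrow psi' th b w by rewrite arrowE // bw (rt_off R wF) wd (ms_bd MS).
have := fan_uniq adjC adjI unc V' (connect_trans (connect1 uw) wb') (connect0 _ u) bw' uw.
by move=> E; have := ms_ub MS; rewrite E eqxx.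
Qed.

(** After the recolouring [w] hangs from [u], so all that it reaches joins the fan of [u]. An arrow
    from there into the old fan would give some vertex a second predecessor. *)
Lemma inner_reach z : reach psi th0 w z -> inK z /\ forall th y1 psi',
  rooted psi u th -> inner psi u th y1 psi' -> reach psi' th u z.
Proof.
move: z; apply: connect_ind => [|z x wz [zK IH] zx].
  split; first exact: inner_target.
  by move=> th y1 psi' R I; apply: connect1; apply: inner_new R I.
have [xN xB xs _] := good_K_arrow G zK zx; have zN := inK_nbr zK; have zF := inK_notF zK.
have xF : ~~ F0 x.
  apply/negP=> Fx; have [th R] := rootedP D Fu; have V1 := rt_valid R.
  have [V _ _] := D; have [pr _ _ _] := V.
  (* Rerooting at [u] may move the colour of [x] to another vertex [y1], still in the fan. The
     recolouring is chosen to keep the old predecessor of [y1]. *)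
  have [y1 y1N y1x] := surj cardN V1 (th0 x).
  have Fy1 : F0 y1.
    rewrite -(der_reach D); apply: (reroot_mem V V1 _ xN y1N y1x).
      by move=> x'; rewrite (der_reach D); apply: (rt_off R).
    by rewrite (der_reach D).
  have y1u : y1 != u.
    apply: contra_neq xs => E; apply: inj0 => //.
    by rewrite -y1x E (rt_u R).
  have [psi' I] := innerP R Fy1 y1u; have V' := inner_valid I.
  have [_ _ inj _] := V'.
  have [t [Ft ty MS]] := in_t I; have [y [Fy uy yy]] := in_y I.
  have zy : arrow psi' th z y1.
    rewrite arrowE // (ms_mis MS) ?y1x ?(arrow_mis zx) ?andbT.
    - by apply: contraNneq zF => ->.
    - by rewrite (rt_u R) (inj_in_eq inj0).
    - by rewrite -y1x (inj_in_eq inj) 1?eq_sym // (F0N Ft).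
    - by rewrite -wd (inj_in_eq inj0) //; apply: contraNneq wF => <-.
  have E := fan_uniq adjC adjI unc V' (IH _ _ _ R I) uy zy yy.
  by move: zF; rewrite E Fy.
split; first by rewrite /inK xN xF xB.
by move=> th y1 psi' R I; apply: connect_trans (IH _ _ _ R I) (connect1 (inner_arrow R I zN zF xF zx)).
Qed.

Lemma inner_source z : reach psi th0 w z -> ~~ arrow psi th0 z w.
Proof.
move=> wz; apply/negP=> zw; have [zK rz] := inner_reach wz.
have [th R] := rootedP D Fu.
have [y1 Fy1 y1u] : exists2 y1, F0 y1 & y1 != u.
  have [us|us] := eqVneq u s; last by exists s; [exact: connect0 | rewrite eq_sym].
  by exists v; rewrite // us.
have [psi' I] := innerP R Fy1 y1u; have V' := inner_valid I.
have zw' := inner_arrow R I (inK_nbr zK) (inK_notF zK) wF zw.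
have E := fan_uniq adjC adjI unc V' (rz _ _ _ R I) (connect0 _ u) zw' (inner_new R I).
by have := inK_notF zK; rewrite E Fu.
Qed.

(** Otherwise [w'] joins the fan of [u] once [u b] is recoloured. Restoring the root colour at [b]
    keeps this fan, and [u'] is a deficient vertex of it whose edge to [b] still has the colour of
    [w'], against [toggle_outside]. *)
Lemma inner_disjoint u' w' z : F0 u' -> ~~ full u' -> hadj u' b -> u' != u ->
  w' \in N -> th0 w' = psi u' b -> ~~ F0 w' -> reach psi th0 w z -> ~~ arrow psi th0 z w'.
Proof.
move=> Fu' nfu' ub' uu' w'N w'd w'F wz; apply/negP=> zw'.
have [zK rz] := inner_reach wz; have [th R] := rootedP D Fu.
have [V _ _] := D; have [pr _ _ _] := V.
have [psi' I] := innerP R Fu' uu'; have V' := inner_valid I.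
have uw := inner_new R I; have [_ _ inj _] := V'.
have zw := inner_arrow R I (inK_nbr zK) (inK_notF zK) w'F zw'.
have uw' := connect_trans (rz _ _ _ R I) (connect1 zw).
have [y [_ uy yu']] := in_y I; have uu'' := connect_trans uy (connect1 yu').
have [t [Ft _ MS]] := in_t I.
have dw : th w = psi u b by rewrite (rt_off R).
have wb : th w \in mis psi' b by rewrite dw (ms_bd MS).
have bw : b != w by rewrite eq_sym (inK_neq_b inner_target).
have bu : b != u by rewrite eq_sym (ms_ub MS).
have [psi2 R2] := fan_restore adjC adjI unc V' (connect0 _ u) uw wb bu bw.
have nd : psi u b != psi u' b.
  rewrite (pr.1 _ _ ub) (pr.1 _ _ ub'); apply: contra_neq uu' => E; apply/esym.
  by apply: (pr.2 b) E; rewrite hadjC.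
have e1 : psi u' b != th u.
  by rewrite (rt_u R) -w'd (inj_in_eq inj0) //; apply: contraNneq w'F => ->.
have e2 : psi u' b != th t.
  rewrite -w'd -(rt_off R w'F) (inj_in_eq inj) ?(F0N Ft) //.
  by apply: contraNneq w'F => ->.
have ub'' : u' != b by apply: contraTneq ub' => ->; rewrite hadjI.
have E : psi' u' b = psi u' b.
  by apply: (ms_edge MS) => //; rewrite (negbTE uu', negbTE ub'').
have E2 : psi2 u' b = psi' u' b by apply: (rs_edge R2); rewrite E // dw eq_sym.
have : ~~ reach psi2 th u w'.
  apply: (toggle_outside adjC adjI unc cardN (rs_valid R2) (rs_a R2) _ nfu' ub' w'N).
    by rewrite -(rs_reach R2).
  by rewrite E2 E (rt_off R).
by rewrite -(rs_reach R2) uw'.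
Qed.
End Inner.

(** As in [outer_count], with the targets alone as starting points, since the vertices of [U] lie in
    the fan and not in K. *)
Lemma inner_count (U : {set T}) : (forall u, u \in U -> [/\ F0 u, ~~ full u & adj b u]) ->
  #|U| <= #|[set l in N | ~~ F0 l && full l]|.
Proof.
move=> HU; pose W := targets U.
have Ub u : u \in U -> hadj u b.
  by move=> /HU[/F0N uN _ bu]; rewrite /hadj adjC bu br (nbr_neq adjI uN).
apply: leq_trans (targets_card Ub) _.
pose X := [set x | [exists w in W, reach psi0 th0 w x]].
have XP x : reflect (exists2 w, w \in W & reach psi0 th0 w x) (x \in X).
  rewrite in_set; apply: (iffP existsP) => [[d /andP[]]|[d dW dx]]; first by exists d.
  by exists d; rewrite dW.
have WK w x : w \in W -> reach psi0 th0 w x -> inK x.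
  case/targetsP=> u [uU wN wd] wx; have [Fu nfu _] := HU _ uU.
  by have [] := inner_reach good0 Fu nfu (Ub _ uU) wN wd wx.
have XK x : x \in X -> inK x by case/XP=> w /WK; apply.
have outX x y : x \in X -> arrow psi0 th0 x y -> y \in X.
  by case/XP=> d dW dx xy; apply/XP; exists d => //; apply: connect_trans dx (connect1 xy).
have outW x y : x \in X -> arrow psi0 th0 x y -> y \notin W.
  case/XP=> w /targetsP[u [uU wN wd]] wx xy; apply/negP=> yW.
  have /targetsP[u' [u'U yN yd]] := yW; have [Fu nfu _] := HU _ uU.
  have [Fu' nfu' _] := HU _ u'U; have yF := inK_notF (WK _ _ yW (connect0 _ y)).
  have [E|uu'] := eqVneq u' u.
    have yw : y = w by apply: inj0; rewrite // wd yd E.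
    have := inner_source good0 Fu nfu (Ub _ uU) wN wd wx.
    by rewrite -yw xy.
  have := inner_disjoint good0 Fu nfu (Ub _ uU) wN wd Fu' nfu' (Ub _ u'U) uu' yN yd yF wx.
  by rewrite xy.
apply: (K_count _ XK) => [|x y xX xy|x x' y xX x'X xy x'y].
- by apply/subsetP=> w wW; apply/XP; exists w.
- by rewrite in_setD (outX _ _ xX xy) (outW _ _ xX xy).
apply/eqP; apply: contraT => nxx'.
have yK := XK _ (outX _ _ xX xy).
have [psi' [z [xz CV]]] := converge good0 (XK _ xX) (XK _ x'X) nxx' yK xy x'y.
have zX : z \in X by case: xz => ->.
have [d dW dz] := XP _ zX.
have dv := converged_reach good0 yK CV (fun x => WK d x dW) dz.
have G' := cv_good CV.
have /targetsP[u [uU dN dd]] := dW; have [Fu nfu _] := HU _ uU.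
have dK := WK _ _ dW (connect0 _ d).
have dd' : th0 d = psi' u b.
  rewrite (cv_edge CV) // -dd (inj_in_eq inj0) ?(inK_nbr yK) ?inK_neq_s // 1?eq_sym //.
    by apply: contraTneq Fv => ->; exact: inK_notF.
  by apply: contraTneq dW => E; rewrite -E; apply: outW xX xy.
have [vK _] := inner_reach G' Fu nfu (Ub _ uU) dN dd' dv.
by have := inK_notF vK; rewrite Fv.
Qed.
Lemma common_count : b \in N ->
  #|[set u in N | [&& ~~ full u, adj b u & adj s u]]| <=
  3 * #|[set l in N | ~~ F0 l && full l]| + 1.
Proof.
move=> bN; set g := #|[set l in N | ~~ F0 l && full l]|; pose X := [set u in N | [&& ~~ full u, adj b u & adj s u]]; rewrite -/X.
(* [X1] lies in the fan, [X2] holds the vertices whose edge to [s] has a dangerous colour, [X3] the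
   rest of K. The extra 1 in the bound comes from the colour [a] in [X2]. *)
pose X1 := [set u | [&& F0 u, ~~ full u & adj b u]].
pose X2 := [set u | hadj s u && (Lam (psi0 u s) || (psi0 u s == a))].
pose X3 := [set u | [&& inK u, ~~ full u, adj b u &
  [&& adj s u, ~~ Lam (psi0 u s) & psi0 u s != a]]].
have c1 : #|X1| <= g.
  by apply: inner_count => u; rewrite in_set => /and3P.
have c3 : #|X3| <= g.
  by apply: outer_count => u; rewrite in_set => /and4P[uK nfu bu P]; split=> // _.
have c2 : #|X2| <= g + 1.
  have inj : {in X2 &, injective (psi0 s)}.
    by move=> u u'; rewrite !in_set => /andP[su _] /andP[su' _]; apply: pr0.2.
  rewrite -(card_in_imset inj) addn1.
  apply: (@leq_trans #|a |: [set th0 l | l in [set l in N | ~~ F0 l && full l]]|).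
    apply: subset_leq_card; apply/subsetP=> c /imsetP[u]; rewrite in_set => /andP[su H] ->.
    rewrite in_setU1 (pr0.1 _ _ su); case/orP: H => [/existsP[l]|->//].
    case/and4P=> lN lF lf /eqP<-; apply/orP; right; apply: imset_f.
    by rewrite in_set lN lF.
  by rewrite cardsU1 -add1n leq_add ?leq_b1 ?leq_imset_card.
apply: (@leq_trans (#|X1| + #|X2| + #|X3|)).
  have sub : X \subset X1 :|: X2 :|: X3.
    apply/subsetP=> u; rewrite [u \in X]in_set => /andP[uN /and3P[nfu bu su]].
    have hsu : hadj s u by rewrite /hadj su !(nbr_neq adjI).
    rewrite !in_setU !in_set hsu nfu bu su /=.
    have [//|uF] := boolP (F0 u); rewrite /=.
    have [//|uL] := boolP (Lam (psi0 u s)); rewrite /=.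
    have [//|ua] := eqVneq (psi0 u s) a; rewrite /= andbT /inK uN uF /=.
    (* Basin vertices need no set of their own: they are bad, hence not protected. *)
    apply/negP=> uB; have P : prot psi0 u by move=> _; rewrite su.
    apply: (prot_not_bad good0.1.1 uN uF P); exists b.
      by move: uB; rewrite in_set => /andP[].
    by rewrite arrowE // ab0 andbT; apply: contraNneq b_notin_F => ->.
  apply: leq_trans (subset_leq_card sub) _.
  by apply: leq_trans (leq_card_setU _ _) _; rewrite leq_add2r leq_card_setU.
apply: leq_trans (leq_add (leq_add c1 c2) c3) _.
by move: g {c1 c2 c3}; clear; lia.
Qed.

(** Here [M = 0], so protection is automatic, and the basin is empty because no arrow enters [b]. *)
Lemma miss_count : b \notin N ->
  #|[set u in N | ~~ full u && adj b u]| <= 2 * #|[set l in N | ~~ F0 l && full l]|.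
Proof.
move=> bN; set g := #|[set l in N | ~~ F0 l && full l]|; pose X := [set u in N | ~~ full u && adj b u]; rewrite -/X.
have M0 : M = 0 by case: HM => [[]|[]//]; rewrite (negbTE bN).
pose X1 := [set u | [&& F0 u, ~~ full u & adj b u]].
pose X3 := [set u | [&& inK u, ~~ full u & adj b u]].
have c1 : #|X1| <= g.
  by apply: inner_count => u; rewrite in_set => /and3P.
have c3 : #|X3| <= g.
  by apply: outer_count => u; rewrite in_set => /and3P[uK nfu bu]; split=> //; rewrite /sprot M0.
rewrite mulSn mul1n; apply: leq_trans (leq_add c1 c3).
have sub : X \subset X1 :|: X3.
  apply/subsetP=> u; rewrite [u \in X]in_set => /and3P[uN nfu bu].
  rewrite in_setU !in_set nfu bu !andbT /inK uN /=; case: (F0 u) => //=.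
  rewrite in_set uN /=; apply/negP=> ub; have := connect_nbr uN ub.
  by rewrite (negbTE bN).
by apply: leq_trans (subset_leq_card sub) _; apply: leq_card_setU.
Qed.
End Base.

Lemma ex_max (P : nat -> Prop) B : (exists k, P k) -> (forall k, P k -> k <= B) ->
  exists2 k, P k & forall l, P l -> l <= k.
Proof.
elim: B => [|B IH] [k Pk] H; first by exists k => // l /H; rewrite leqn0 => /eqP->.
have [PB|nPB] := classic (P B.+1); first by exists B.+1.
apply: IH; first by exists k.
by move=> l Pl; have := H _ Pl; rewrite leq_eqVlt => /orP[/eqP E|//]; case: nPB; rewrite -E.
Qed.

Lemma card_setI_ge (T : finType) (A B V : {set T}) : A \subset V -> B \subset V ->
  #|A| + #|B| <= #|V| + #|A :&: B|.
Proof.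
move=> AV BV; rewrite -cardsUI leq_add2r; apply: subset_leq_card.
by rewrite subUset AV.
Qed.

Lemma involution_even (T : finType) (D : {set T}) (f : T -> T) :
  (forall x, x \in D -> [/\ f x \in D, f (f x) = x & f x != x]) -> ~~ odd #|D|.
Proof.
elim: {D}_.+1 {-2}D (ltnSn #|D|) => // k IH D Dk H.
have [->|/set0Pn[x xD]] := eqVneq D set0; first by rewrite cards0.
have [fD ff fx] := H x xD.
have fD' : f x \in D :\ x by rewrite in_setD1 fx.
rewrite (cardsD1 x) xD (cardsD1 (f x) (D :\ x)) fD' !add1n /= negbK.
apply: IH; first by move: Dk; rewrite (cardsD1 x) xD (cardsD1 (f x) (D :\ x)) fD'; lia.
move=> y; rewrite !in_setD1 => /and3P[yfx yx yD]; have [fyD ffy fy] := H y yD.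
rewrite fyD fy ffy !andbT; split=> //; apply/andP; split.
  by apply: contra_neq yx => E; rewrite -ffy E ff.
by apply: contra_neq yfx => E; rewrite -ffy E.
Qed.

(** * Counting *)

Section Final.
Variables (T C : finType) (adj : rel T) (V : {set T}).
Hypothesis adjC : symmetric adj.
Hypothesis adjI : irreflexive adj.
Hypothesis adjV : forall x y, adj x y -> x \in V.
Implicit Types (psi : T -> T -> C) (th : T -> C) (c : C) (s u v w x y z b : T).
Local Notation full := (full C adj).
Local Notation n := #|V|.
Local Notation D := #|C|.
Local Notation dg v := #|nbr adj v|.

Hypothesis dgD : forall v, dg v <= D.
Hypothesis unc : forall x, uncolorable C adj x.
Hypothesis crit : forall x y, adj x y ->
  exists (psi : T -> T -> C) th, valid adj x psi th y.
Hypothesis noniso : forall x, x \in V -> exists y, adj x y.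

Lemma nbr_sub v : nbr adj v \subset V.
Proof. by apply/subsetP=> x; rewrite in_set adjC => /adjV. Qed.

(* Vizing's adjacency lemma. *)
Lemma full_nbrs x y : adj x y -> D < dg x + #|[set z in nbr adj y | full z]|.
Proof.
move=> xy; have yx : adj y x by rewrite adjC.
have [psi [th Vd]] := crit yx; have [pr xN _ _] := Vd.
have := mis_card adjC pr (nbr_neq adjI xN); rewrite xN addn1 => <-.
rewrite addnC leq_add2l; apply: leq_trans (fan_card adjC adjI (@unc y) Vd) _.
apply: subset_leq_card; apply/subsetP=> z; rewrite !in_set => /and3P[xz _ ->].
by have := connect_nbr xN xz; rewrite in_set => ->.
Qed.

Variable r : T.
Hypothesis cardN : D <= dg r.
Local Notation N := (nbr adj r).
Local Notation m := #|[set x in N | full x]|.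
Variable k : nat.
Hypothesis k2 : 2 <= k.
Hypothesis mk : m <= k.
Hypothesis nD : 4 * n + 9 * k <= 6 * D.

Local Notation mis := (mis adj r).
Local Notation same := (same adj r).
Local Notation proper := (proper adj r).
Local Notation hadj := (hadj adj r).
Local Notation arrow := (arrow adj r).
Local Notation valid := (valid adj r).
Local Notation basin := (basin adj r).
Local Notation reach psi th := (connect (arrow psi th)).

Lemma cardN_eq : #|N| = D.
Proof. by apply/eqP; rewrite eqn_leq cardN dgD. Qed.

Lemma card_nonfull : #|[set x in N | ~~ full x]| + m = D.
Proof.
rewrite -cardN_eq addnC -(cardsID [set x | full x] N); congr (_ + _).
  by apply: eq_card => x; rewrite !in_set andbC.
by apply: eq_card => x; rewrite !in_set andbC.
Qed.

(** By [full_nbrs], a neighbour of [x] has more than [D - dg x] full neighbours; together with the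
    [D - m] deficient neighbours of [r] they fit into [V]. *)
Lemma degree_lower x : x \in V -> 2 * D < dg x + n + m.
Proof.
move=> xV; have [y xy] := noniso xV; have := full_nbrs xy.
have : #|[set z in nbr adj y | full z]| + #|[set x in N | ~~ full x]| <= n.
  rewrite -cardsUI (_ : _ :&: _ = set0) ?cards0 ?addn0.
    apply: subset_leq_card; apply/subsetP=> z; rewrite in_setU !in_set.
    by case/orP=> /andP[]; rewrite adjC => /adjV.
  by apply/setP=> z; rewrite in_setI !in_set; case: (full z); rewrite !andbF.
have := card_nonfull.
by clear; lia.
Qed.
Section Top.
Variables (q : T) (p : nat).
Hypotheses (qN : q \in N) (nfq : ~~ full q).
Hypothesis qmin : forall x, x \in N -> dg q <= dg x.
Local Notation top := (top adj r q p).

(** With the root moved to [q], which misses [D + 1 - dg q] colours, [fan_card] finds that many full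
    vertices in the same fan. *)
Lemma top_full psi th s : top psi th s ->
  D < dg q + #|[set l in N | reach psi th s l && full l]|.
Proof.
move=> [Vd sq _]; have [th' [Vd' _ _ eqF]] := reroot adjC adjI (@unc r) Vd sq.
have [pr _ _ _] := Vd'.
have := mis_card adjC pr (nbr_neq adjI qN); rewrite qN addn1 => <-.
rewrite addnC leq_add2l; apply: leq_trans (fan_card adjC adjI (@unc r) Vd') _.
apply: subset_leq_card; apply/subsetP=> z; rewrite !in_set => /and3P[qz _ ->].
by have := connect_nbr qN qz; rewrite eqF qz in_set => ->.
Qed.

Lemma top_split psi th s : #|[set l in N | reach psi th s l && full l]| +
  #|[set l in N | ~~ reach psi th s l && full l]| = m.
Proof.
rewrite -[RHS](cardsID [set l | reach psi th s l]); congr (_ + _).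
  by apply: eq_card => x; rewrite in_setI !in_set andbAC andbA.
by apply: eq_card => x; rewrite in_setD !in_set andbCA.
Qed.

(** The root is moved to a full vertex [v] of the fan and then to a child [t] of [v], from which [v]
    now hangs. *)
Lemma leaf psi th s : top psi th s -> exists th' s' v,
  [/\ top psi th' s', arrow psi th' s' v /\ full v, th' s' = th s,
      reach psi th s =1 reach psi th' s' &
      forall x, ~~ reach psi th s x -> th' x = th x].
Proof.
move=> Tp; have [Vd sq cF] := Tp.
have : 0 < #|[set l in N | reach psi th s l && full l]|.
  by have := top_full Tp; have := dgD q; clear; lia.
case/card_gt0P=> v; rewrite in_set => /and3P[vN sv fv].
have [th1 [V1 t1 off1 eq1]] := reroot adjC adjI (@unc r) Vd sv.
have [pr _ _ _] := Vd.
have : 0 < #|mis psi v|.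
  have := mis_card adjC pr (nbr_neq adjI vN); rewrite vN.
  by have := dgD v; clear; lia.
case/card_gt0P=> c; rewrite -(fr_root (@unc r) V1) => cv.
have [t vt _] := fan_full adjC (@unc r) V1 (connect0 _ v) cv.
have [th2 [V2 t2 v2 off2 eq2]] := reroot1 V1 vt.
have tN := arrow_nbr vt; have [_ _ inj2 _] := V2; have nvt := arrowI vN vt.
have [_ _ _ val1] := V1.
exists th2, t, v; split.
- split=> //; first by rewrite -eq2 -eq1.
  by rewrite -cF; apply: eq_card => x; rewrite !in_set -eq2 -eq1.
- by rewrite arrowE // eq_sym nvt v2 val1 // eq_sym.
- by rewrite t2.
- by move=> x; rewrite eq1 eq2.
- move=> x nx; rewrite off2 ?off1 //; apply: contraNneq nx => ->.
    by rewrite eq1.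
  by rewrite eq1 connect1.
Qed.

Variable M : nat.
Hypotheses (HF : maxF C adj r q p) (HB : maxB C adj r q p M).


(* The vertices r, b and the root have many deficient common neighbours, which
   contradicts [common_count]. *)
Lemma no_bad psi th s b : top psi th s -> b \in N -> arrow psi th b s ->
  M <= #|basin psi th b| -> False.
Proof.
move=> Tp bN bs Mb; have [th1 [s1 [v [T1 [sv fv] t1 eqF off]]]] := leaf Tp.
have [Vd sq _] := Tp; have [V1 _ _] := T1; have [_ _ inj1 _] := V1.
have ab : th1 s1 \in mis psi b by rewrite t1 (arrow_mis bs).
have nsb : ~~ reach psi th s b.
  by apply/negP=> sb; apply: (not_bad_root (@unc r) Vd); exists b.
have basin_sub : basin psi th b \subset basin psi th1 b.
  apply/subsetP=> y; rewrite !in_set => /andP[yN yb]; rewrite yN /=.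
  have yN' : y \in N by rewrite in_set.
  suff H x : reach psi th y x -> reach psi th x b -> reach psi th1 y x by apply: H.
  move: x; apply: connect_ind => [|z x yz IH zx xb]; first by rewrite connect0.
  have zb := connect_trans (connect1 zx) xb.
  apply: connect_trans (IH zb) (connect1 _).
  have zN := connect_nbr yN' yz; have xN := arrow_nbr zx.
  have xF : ~~ reach psi th s x by apply: contra nsb => sx; apply: connect_trans sx xb.
  by rewrite arrowE // (arrowI zN zx) off ?(arrow_mis zx).
have Mb1 := leq_trans Mb (subset_leq_card basin_sub).
have := common_count adjC adjI (@unc r) cardN nfq HF HB T1 sv fv (nbr_neq adjI bN) ab
  (or_introl (conj bN Mb1)) bN.
have s1N : s1 \in N by case: V1.
have := top_full T1; have := top_split psi th1 s1; have := card_nonfull.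
have := qmin bN; have := qmin s1N; have := dgD q.
set g := #|[set l in N | ~~ _ && _]|; set f := #|[set l in N | _ && _]|.
set S := [set x in N | ~~ full x].
have SV : S \subset V.
  by apply/subsetP=> x; rewrite in_set => /andP[xN _]; apply: (subsetP (nbr_sub r)).
have SbV : S :&: nbr adj b \subset V by apply: subset_trans SV; apply: subsetIl.
have c1 := card_setI_ge SV (nbr_sub b).
have c2 := card_setI_ge SbV (nbr_sub s1).
have -> : [set u in N | [&& ~~ full u, adj b u & adj s1 u]] = S :&: nbr adj b :&: nbr adj s1.
  apply/setP=> x; rewrite !in_setI !in_set.
  by case: (adj r x); case: (full x); case: (adj b x); case: (adj s1 x).
(* With e the degree of [q]: there are at least D - m + 2e - 2n common neighbours and at most 3g +
   1, where g <= m - D + e - 1. Since e <= D and m <= k, this gives 3D + 2 <= 2n + 4k. *)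
move: c1 c2 mk nD k2; move: (S :&: nbr adj b) => S1.
move: #|S1 :&: _| #|S1| #|S| g f #|nbr adj q| #|nbr adj b| #|nbr adj s1| n D k m.
by clear; lia.
Qed.
Hypothesis M0 : M = 0.

Lemma no_missing psi th s x : top psi th s -> x \in V -> x != r -> th s \notin mis psi x.
Proof.
move=> Tp xV xr; apply/negP=> ax; have [Vd _ _] := Tp; have [_ sN inj _] := Vd.
have [xN|xN] := boolP (x \in N).
  apply: (no_bad Tp xN); last by rewrite M0.
  rewrite arrowE // ax andbT; apply: contraTneq ax => ->.
  exact: (root_mis (@unc r) Vd).
have [th1 [s1 [v [T1 [sv fv] t1 eqF off]]]] := leaf Tp.
have ax1 : th1 s1 \in mis psi x by rewrite t1.
have := miss_count adjC adjI (@unc r) cardN nfq HF HB T1 sv fv xr ax1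
  (or_intror (conj xN M0)) xN.
have := top_full T1; have := top_split psi th1 s1; have := card_nonfull.
have := dgD q; have := degree_lower xV.
set g := #|[set l in N | ~~ _ && _]|; set f := #|[set l in N | _ && _]|.
set S := [set x in N | ~~ full x].
have SV : S \subset V.
  by apply/subsetP=> y; rewrite in_set => /andP[yN _]; apply: (subsetP (nbr_sub r)).
have c1 := card_setI_ge SV (nbr_sub x).
have -> : [set u in N | ~~ full u && adj x u] = S :&: nbr adj x.
  by apply/setP=> y; rewrite !in_setI !in_set -andbA.
(* By [degree_lower] there are more than 3D - 2m - 2n common neighbours, and at most 2(m - D + e -
   1), with e the degree of [q]. Hence 3D + 3 <= 2n + 4k. *)
move: c1 mk nD k2; move: #|S :&: _| #|S| g f #|nbr adj q| #|nbr adj x| n D k m.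
by clear; lia.
Qed.

Lemma odd_order psi th s : top psi th s -> odd n.
Proof.
move=> Tp; have [Vd _ _] := Tp; have [pr _ _ _] := Vd.
have rV : r \in V by move: qN; rewrite in_set => /adjV.
rewrite (cardsD1 r) rV /=.
pose f x := if [pick y | hadj x y && (psi x y == th s)] is Some y then y else x.
apply: (@involution_even _ _ f) => x; rewrite in_setD1 => /andP[xr xV].
have := no_missing Tp xV xr; move/misPn=> [y xy c].
have fE x' y' : hadj x' y' -> psi x' y' = th s -> f x' = y'.
  move=> xy' c'; rewrite /f; case: pickP => [z /andP[xz /eqP cz]|/(_ y')].
    by apply: (pr.2 x') => //; rewrite cz.
  by rewrite xy' c' eqxx.
have yx : hadj y x by rewrite hadjC.
have cy : psi y x = th s by rewrite -(pr.1 _ _ xy).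
rewrite (fE _ _ xy c) (fE _ _ yx cy); split=> //.
  have /and3P[axy _ yr] := xy; rewrite in_setD1 yr; apply: (@adjV y x).
  by rewrite adjC.
by apply: contraTneq xy => ->; rewrite hadjI.
Qed.

(** One such vertex is the [w] carrying [c]. Of two others, one is off the chain of [w]; a change
    there keeps the fan and makes that vertex miss [th s]. *)
Lemma few_missing psi th s c : top psi th s -> c != th s ->
  #|[set x in V :\ r | c \in mis psi x]| <= 2.
Proof.
move=> Tp cs; have [Vd sq cF] := Tp; have [pr sN inj _] := Vd.
have [w wN wc] := surj cardN Vd c; rewrite -wc in cs *.
have ws : w != s by apply: contraNneq cs => ->.
rewrite (cardsD1 w) -[2]/(1 + 1); apply: leq_add; first exact: leq_b1.
rewrite leqNgt; apply/negP=> /card_gt1P[y [z [+ + yz]]].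
rewrite !in_setD1 in_set in_setD1 => /and3P[yw /andP[yr yV] ty].
rewrite in_set in_setD1 => /and3P[zw /andP[zr zV] tz].
have absurd x : x \in V -> x != r -> th w \in mis psi x ->
    ~~ same psi (th s) (th w) x w -> False.
  move=> xV xr tx nxw.
  have T' : top (sw adj r psi th s w x) th s.
    have eqF := fan_sw adjC (@unc r) Vd wN ws nxw.
    split; [exact: sw_valid | by rewrite -eqF |].
    by rewrite -cF; apply: eq_card => x'; rewrite !in_set eqF.
  by have := no_missing T' xV xr; rewrite (mis_sw _ _ Vd) same_refl tpermL tx.
have [] := two_preds adjC adjI Vd wN ws yz yw zw (no_missing Tp yV yr)
  (no_missing Tp zV zr) ty tz; exact: absurd.
Qed.

(** Each of the [D - 1] colours other than [th s] is missed at most twice in H, so the degrees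
    outside [r] sum to at least D(n - 1) + D - 2(D - 1); [r] itself adds D. *)
Lemma degree_sum psi th s : top psi th s -> D * n.-1 + 2 <= \sum_(x in V) dg x.
Proof.
move=> Tp; have [Vd sq _] := Tp; have [pr sN _ _] := Vd.
have rV : r \in V by move: qN; rewrite in_set => /adjV.
have nE : n = #|V :\ r|.+1 by rewrite (cardsD1 r) rV.
have le : \sum_(x in V :\ r) #|mis psi x| <= 2 * D.-1.
  have -> : \sum_(x in V :\ r) #|mis psi x| =
      \sum_(c : C) #|[set x in V :\ r | c \in mis psi x]|.
    under eq_bigr do rewrite -sum1_card big_mkcond.
    rewrite exchange_big; apply: eq_bigr => c _.
    rewrite -sum1_card [in RHS](eq_bigl (fun x => (x \in V :\ r) && (c \in mis psi x))).
      by rewrite big_mkcondr.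
    by move=> x; rewrite in_set.
  rewrite (bigD1 (th s)) //= (_ : #|_| = 0) ?add0n; last first.
    apply/eqP; rewrite cards_eq0; apply/eqP/setP=> x; rewrite in_set0 in_set in_setD1.
    by apply/negP=> /andP[/andP[xr xV]]; apply/negP; apply: no_missing.
  apply: (@leq_trans (\sum_(c | c != th s) 2)).
    by apply: leq_sum => c; apply: few_missing.
  rewrite sum_nat_const mulnC leq_mul2l /= -(cardC1 (th s)).
  by apply: subset_leq_card; apply/subsetP=> c.
have eq : \sum_(x in V :\ r) #|mis psi x| + \sum_(x in V :\ r) dg x = D * #|V :\ r| + D.
  rewrite -big_split /= mulnC -sum_nat_const -{2}cardN_eq.
  have -> : #|N| = \sum_(x in V :\ r) (x \in N).
    rewrite -sum1_card big_mkcond [RHS]big_mkcond; apply: eq_bigr => x _.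
    rewrite in_setD1; case: (boolP (x \in N)) => xN; last by case: ifP.
    by rewrite (nbr_neq adjI xN) (subsetP (nbr_sub r) _ xN).
  rewrite -big_split /=; apply: eq_bigr => x; rewrite in_setD1 => /andP[xr _].
  exact: mis_card.
rewrite (bigD1 r) //= (eq_bigl (fun x => x \in V :\ r)); last first.
  by move=> x; rewrite in_setD1 andbC.
have D2 : 0 < D by have := nD; have := k2; clear; lia.
have rD := cardN_eq; rewrite nE /=; move: eq le rD D2.
set A := \sum_(x in V :\ r) #|mis psi x|; set B := \sum_(x in V :\ r) dg x.
by move: A B #|N| D #|V :\ r|; clear; nia.
Qed.
End Top.

Lemma overfull_core : odd n /\ D * n.-1 + 2 <= \sum_(x in V) dg x.
Proof.
have [q0 q0N nf0] : exists2 q, q \in N & ~~ full q.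
  have : 0 < #|[set x in N | ~~ full x]|.
    have := card_nonfull; move: mk nD k2; move: #|_| m n D k; clear; lia.
  by case/card_gt0P=> q; rewrite in_set => /andP[]; exists q.
case: (@arg_minnP _ q0 (fun x => x \in N) (fun x => dg x) q0N) => q /= qN qmin.
have nfq : ~~ full q by move: nf0; rewrite -!ltnNge; apply: leq_ltn_trans; apply: qmin.
pose isF p := exists psi th s, [/\ valid psi th s, reach psi th s q &
  #|[set x | reach psi th s x]| = p].
have [p [psi [th [s Tp]]] HF] : exists2 p, isF p & forall l, isF l -> l <= p.
  apply: (ex_max (B := #|T|)).
    have rq : adj r q by move: qN; rewrite /= in_set.
    have [psi [th Vd]] := crit rq.
    by exists #|[set x | reach psi th q x]|, psi, th, q; split=> //; apply: connect0.
  by move=> l [psi [th [s [_ _ <-]]]]; apply: max_card.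
have {}HF : maxF C adj r q p by move=> psi' th' s' V' q'; apply: HF; exists psi', th', s'.
pose isB l := l = 0 \/ exists psi th s b, [/\ top adj r q p psi th s, b \in N,
  arrow psi th b s & l = #|basin psi th b|].
have [M PM HB] : exists2 M, isB M & forall l, isB l -> l <= M.
  apply: (ex_max (B := #|T|)); first by exists 0; left.
  by move=> l [->//|[psi' [th' [s' [b [_ _ _ ->]]]]]]; apply: max_card.
have {}HB : maxB C adj r q p M.
  by move=> psi' th' s' b T' bN bs; apply: HB; right; exists psi', th', s', b.
case: PM => [M0|[psi' [th' [s' [b [T' bN bs ME]]]]]]; last first.
  exfalso; apply: (no_bad qN nfq qmin HF HB T' bN bs).
  by rewrite ME.
by split; [apply: (odd_order qN nfq qmin HF HB M0 Tp) | apply: (degree_sum qN nfq qmin HF HB M0 Tp)].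
Qed.
End Final.

(** * Graphs *)

Section Graph.
Variable T : finType.
Implicit Types (G H : sgraph T) (A B : {set T}) (x y z : T).

Definition adjacent G : rel T := fun x y => [set x; y] \in edges G.

Lemma adjacentC G : symmetric (adjacent G).
Proof. by move=> x y; rewrite /adjacent setUC. Qed.

Lemma edge_sub G A : A \in edges G -> A \subset vertices G /\ #|A| = 2.
Proof. by move=> AG; have /andP[sA /eqP cA] := forall_inP (edgesP G) A AG. Qed.

Lemma adjacentI G : irreflexive (adjacent G).
Proof.
move=> x; apply/negP=> /edge_sub[_]; by rewrite setUid cards1.
Qed.

Lemma adjacentV G x y : adjacent G x y -> x \in vertices G.
Proof. by case/edge_sub=> /subsetP + _; apply; rewrite set21. Qed.

Lemma edge_adjacent G A x : A \in edges G -> x \in A ->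
  exists2 y, A = [set x; y] & adjacent G x y.
Proof.
move=> AG xA; have [_ cA] := edge_sub AG.
have /cards2P[y [z [yz AE]]] : #|A| == 2 by rewrite cA.
move: xA; rewrite AE !inE => /orP[] /eqP->; [exists z | exists y] => //.
  by rewrite /adjacent -AE.
all: by rewrite ?/adjacent setUC -?AE.
Qed.

Lemma set2_inj x y z : [set x; y] = [set x; z] -> y = z.
Proof.
move=> E; have := set22 x y; rewrite E !inE => /orP[]/eqP yE //.
by have := set22 x z; rewrite -E yE !inE orbb => /eqP.
Qed.

Lemma degreeE G v : degree G v = #|nbr (adjacent G) v|.
Proof.
rewrite -(card_imset (nbr (adjacent G) v) (@set2_inj v)); apply: eq_card => A.
rewrite inE; apply/andP/imsetP => [[AG vA]|[y]].
  by have [y AE vy] := edge_adjacent AG vA; exists y; rewrite ?inE.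
by rewrite inE => vy ->; rewrite set21.
Qed.

Lemma degree_sum_edges G : \sum_(v in vertices G) degree G v = 2 * #|edges G|.
Proof.
transitivity (\sum_(A in edges G) #|A|); last first.
  rewrite (eq_bigr (fun=> 2)) ?sum_nat_const ?[2 * _]mulnC //.
  by move=> A /edge_sub[].
have dE v : degree G v = \sum_(A in edges G) (v \in A).
  rewrite /degree -sum1_card big_mkcond [RHS]big_mkcond; apply: eq_bigr => A _.
  by rewrite inE; case: (A \in edges G).
under eq_bigr do rewrite dE.
rewrite exchange_big; apply: eq_bigr => A /edge_sub[/subsetP sA _].
rewrite -sum1_card big_mkcond [RHS]big_mkcond; apply: eq_bigr => v _.
by case: (boolP (v \in A)) => [/sA ->|_] //; case: ifP.
Qed.

Definition good_coloring G (C : finType) (f : T -> T -> C) : Prop :=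
  (forall x y, adjacent G x y -> f x y = f y x) /\
  (forall x y z, adjacent G x y -> adjacent G x z -> f x y = f x z -> y = z).

Lemma coloring_edge_colorable G d (f : T -> T -> 'I_d.+1) :
  good_coloring G f -> edge_colorable G d.+1.
Proof.
move=> [fC fI].
pose c : {ffun edge G -> 'I_d.+1} := [ffun A =>
  if [pick p : T * T | val A == [set p.1; p.2]] is Some p then f p.1 p.2 else ord0].
have cE (A : edge G) x y : val A = [set x; y] -> c A = f x y.
  move=> AE; rewrite ffunE; case: pickP => [[x' y'] /= /eqP E|/(_ (x, y))]; last first.
    by rewrite AE eqxx.
  have AG : adjacent G x y by rewrite /adjacent -AE (valP A).
  have AG' : adjacent G x' y' by rewrite /adjacent -E (valP A).
  rewrite AE in E; have := set21 x' y'; rewrite -E !inE => /orP[]/eqP xE.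
    by rewrite xE in E *; rewrite (set2_inj E).
  rewrite xE in E *; rewrite setUC in E.
  by rewrite -(set2_inj E) fC // adjacentC.
apply/existsP; exists c; apply/forallP=> A; apply/forallP=> B; apply/implyP=> /andP[AB].
case/set0Pn=> z; rewrite inE => /andP[zA zB].
have [a AE za] := edge_adjacent (valP A) zA; have [b BE zb] := edge_adjacent (valP B) zB.
rewrite (cE _ _ _ AE) (cE _ _ _ BE); apply: contra_neq AB => E.
by apply: val_inj; rewrite /= AE BE (fI _ _ _ za zb E).
Qed.

Lemma edge_colorable_coloring G j d : j <= d.+1 -> edge_colorable G j ->
  exists f : T -> T -> 'I_d.+1, good_coloring G f.
Proof.
move=> jd /existsP[c /forallP cP].
pose f x y : 'I_d.+1 := if insub [set x; y] is Some e then inord (c e) else ord0.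
have fE x y (xy : adjacent G x y) : f x y = inord (c (Sub [set x; y] xy)).
  by rewrite /f insubT.
have ci (A B : edge G) : inord (c A) = inord (c B) :> 'I_d.+1 -> c A = c B.
  move/(congr1 val); rewrite /= !inordK ?(leq_trans (ltn_ord _)) //.
  exact: val_inj.
exists f; split=> [x y xy|x y z xy xz].
  by rewrite /f setUC.
rewrite !fE => /ci E; have /forallP/(_ (Sub [set x; z] xz))/implyP H := cP (Sub [set x; y] xy).
apply/eqP; apply: contraT => yz; have := H _; rewrite E eqxx; apply.
apply/andP; split; first by apply: contra_neq yz => /(congr1 val) /=; apply: set2_inj.
by apply/set0Pn; exists x; rewrite inE /= !set21.
Qed.

Lemma chromatic_index_le G j : edge_colorable G j -> chromatic_index G <= j.
Proof. by rewrite /chromatic_index; case: ex_minnP => i _ H /H. Qed.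

Lemma chromatic_index_colorable G : edge_colorable G (chromatic_index G).
Proof. by rewrite /chromatic_index; case: ex_minnP. Qed.

(** * The states supplied by criticality *)

Section Critical.
Variables (G : sgraph T) (d : nat).
Hypothesis crG : critical G.
Hypothesis c2 : class2 G.
Hypothesis mdG : max_degree G = d.+1.
Local Notation adj := (adjacent G).

Lemma no_coloring (f : T -> T -> 'I_d.+1) : ~ good_coloring G f.
Proof. by move/coloring_edge_colorable/chromatic_index_le; rewrite c2 mdG ltnn. Qed.

Lemma degree_le v : degree G v <= d.+1.
Proof.
have [vV|vV] := boolP (v \in vertices G).
  by rewrite -mdG /max_degree; apply: leq_bigmax_cond.
rewrite (_ : degree G v = 0) // degreeE; apply/eqP; rewrite cards_eq0.
by apply/eqP/setP=> y; rewrite !inE; apply: contraNF vV; apply: adjacentV.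
Qed.

Lemma critical_uncolorable x : uncolorable 'I_d.+1 adj x.
Proof.
move=> psi th pr inj; apply: NNPP => H.
have mth u : u \in nbr adj x -> th u \in mis adj x psi u.
  by move=> uN; apply: contraT => nu; case: H; exists u.
pose f y z := if y == x then th z else if z == x then th y else psi y z.
apply: (no_coloring (f := f)); split=> [y z yz|y z z' yz yz'].
  rewrite /f; case: eqP => [yx|/eqP yx]; case: eqP => [zx|/eqP zx] //.
    by move: yz; rewrite yx zx adjacentI.
  by apply: pr.1; rewrite /hadj yz yx zx.
rewrite /f; case: (eqVneq y x) => [yx|yx].
  by apply: inj; rewrite inE -yx.
have notin w : adj y w -> w != x -> adj y x -> psi y w != th y.
  move=> yw wx yx'; have yN : y \in nbr adj x by rewrite inE adjacentC.
  by move/misP: (mth y yN); apply; rewrite /hadj yw yx wx.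
case: (eqVneq z x) => [zx|zx]; case: (eqVneq z' x) => [zx'|zx'] //.
- by move=> _; rewrite zx zx'.
- by move=> E; rewrite zx in yz; move: (notin z' yz' zx' yz); rewrite E eqxx.
- by move=> E; rewrite zx' in yz'; move: (notin z yz zx yz'); rewrite E eqxx.
- by apply: pr.2; rewrite /hadj ?yz ?yz' yx ?zx ?zx'.
Qed.

Lemma delete_edgeP (A0 : {set T}) :
  [forall A in edges G :\ A0, (A \subset vertices G) && (#|A| == 2)].
Proof.
apply/forall_inP=> A; rewrite in_setD1 => /andP[_].
exact: (forall_inP (edgesP G)).
Qed.

(** Without the edge [x y] the graph has a colouring with [d.+1] colours. At most [d] of them occur
    at [x], and a free one becomes the colour that the root [y] carries. *)
Lemma critical_valid x y : adj x y ->
  exists (psi : T -> T -> 'I_d.+1) th, valid adj x psi th y.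
Proof.
move=> xy; pose H := SGraph (delete_edgeP [set x; y]).
have /crG : proper_subgraph H G.
  rewrite /proper_subgraph /subgraph /= subxx subD1set eqxx /=.
  by apply/eqP=> /setP/(_ [set x; y]); rewrite in_setD1 eqxx (_ : _ \in _ = true).
rewrite c2 mdG ltnS => le.
have [f [fC fI]] := edge_colorable_coloring le (chromatic_index_colorable H).
have Hadj u v : adjacent H u v = ([set u; v] != [set x; y]) && adj u v.
  by rewrite /adjacent in_setD1.
have Hx u v : u != x -> v != x -> adjacent H u v = adj u v.
  move=> ux vx; rewrite Hadj andb_idl // => _; apply: contra_neq ux => E.
  by have := set21 x y; rewrite -E !inE [x == v]eq_sym (negbTE vx) orbF => /eqP.
have Hxu u : adj x u -> u != y -> adjacent H x u.
  by move=> xu uy; rewrite Hadj xu andbT; apply: contra_neq uy => /set2_inj.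
have [c cN] : exists c, c \notin [set f x u | u in nbr adj x :\ y].
  apply/existsP; rewrite -negb_forall; apply/negP=> /forallP all_c.
  have : #|[set f x u | u in nbr adj x :\ y]| < #|'I_d.+1|.
    apply: leq_ltn_trans (leq_imset_card _ _) _.
    by have := degree_le x; rewrite degreeE (cardsD1 y) inE xy add1n card_ord.
  by rewrite (eq_card (B := predT)) ?ltnn // => c; rewrite all_c.
exists f, (fun u => if u == y then c else f x u); split.
- split=> [u v|u v w] /and3P[uv ux vx]; first by apply: fC; rewrite Hx.
  by move=> /and3P[uw _ wx]; apply: fI; rewrite Hx.
- by rewrite inE.
- move=> u v; rewrite !inE => xu xv; case: (eqVneq u y) => [->|uy]; case: (eqVneq v y) => [->|vy] //.
  + by move=> E; case/imsetP: cN; exists v; rewrite // !inE vy.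
  + by move=> E; case/imsetP: cN; exists u; rewrite // !inE uy.
  + by apply: fI; apply: Hxu.
- move=> u; rewrite inE => xu uy; rewrite (negbTE uy).
  have ux : adjacent H u x by rewrite adjacentC Hxu.
  apply/misP=> v /and3P[uv ux' vx]; apply: (contra_neq _ (vx)) => E.
  apply: (fI u v x _ ux); first by rewrite Hx.
  by rewrite E fC // adjacentC.
Qed.

Lemma critical_not_isolated x : x \in vertices G -> exists y, adj x y.
Proof.
move=> xV; apply: NNPP => iso.
have eP : [forall A in edges G, (A \subset vertices G :\ x) && (#|A| == 2)].
  apply/forall_inP=> A AG; have [sA ->] := edge_sub AG; rewrite andbT subsetD1 sA /=.
  by apply/negP=> xA; have [y _ xy] := edge_adjacent AG xA; case: iso; exists y.
pose H := SGraph eP.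
have /crG : proper_subgraph H G.
  rewrite /proper_subgraph /subgraph /= subD1set subxx /=; apply/orP; left.
  by apply/eqP=> /setP/(_ x); rewrite in_setD1 eqxx xV.
rewrite ltnNge => /negP; apply; apply: chromatic_index_le.
(* Deleting an isolated vertex leaves the edge set, and with it the colourings, literally
   unchanged. *)
exact: (chromatic_index_colorable H).
Qed.
End Critical.

Lemma core_adjacent G x y : adjacent (core G) x y =
  [&& adjacent G x y, degree G x == max_degree G & degree G y == max_degree G].
Proof.
rewrite /adjacent inE subUset !sub1set !inE.
case xy: (_ \in edges G) => //=.
by rewrite (adjacentV xy) (adjacentV (x := y) (y := x)) // adjacentC.
Qed.

Lemma min_degree_core G k : 0 < max_degree G -> min_degree (core G) <= k ->
  exists2 r, degree G r = max_degree G &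
    #|[set x in nbr (adjacent G) r | degree G x == max_degree G]| <= k.
Proof.
move=> md0 le.
have V0 : 0 < #|vertices G|.
  rewrite lt0n; apply: contraTneq md0 => /card0_eq V0.
  by rewrite /max_degree big_pred0.
have [r0 r0V r0E] := eq_bigmax_cond (degree G) V0.
have coreE r : degree G r = max_degree G -> degree (core G) r =
    #|[set x in nbr (adjacent G) r | degree G x == max_degree G]|.
  move=> rE; rewrite degreeE; apply: eq_card => x.
  by rewrite !inE core_adjacent rE eqxx.
apply: NNPP => H.
have big r : degree G r = max_degree G -> k < degree (core G) r.
  by move=> rE; rewrite coreE // ltnNge; apply/negP=> rk; apply: H; exists r.
move: le; rewrite leqNgt => /negP; apply; rewrite /min_degree.
elim/big_ind: _ => [|x y kx ky|r].
(* The initial value of the minimum is the order of the core, which is at least the core degree of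
   [r0] and so exceeds [k]. *)
- apply: leq_trans (big r0 (esym r0E)) _; rewrite degreeE; apply: subset_leq_card.
  by apply/subsetP=> x; rewrite [x \in nbr _ _]inE adjacentC; apply: adjacentV.
- by rewrite leq_min kx.
- by rewrite !inE => /andP[_ /andP[_ /eqP /big]].
Qed.
End Graph.

Theorem theorem1p1 (T : finType) (G : sgraph T) (k n Delta : nat)
  (hk : 2 <= k)
  (hG : Delta_critical Delta G)
  (hn : #|vertices G| = n)
  (hDelta : (2%:R / 3%:R * n%:R + 3%:R * k%:R / 2%:R <= Delta%:R :> rat)%R)
  (hcore : min_degree (core G) <= k) :
  overfull G.
Proof.
have {hDelta}hD : 4 * n + 9 * k <= 6 * Delta.
  rewrite -(Num.Theory.ler_nat rat) GRing.natrD !GRing.natrM; lra.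
case: hG => crG c2 mdG.
have [d dE] : exists d, Delta = d.+1 by exists Delta.-1; lia.
rewrite {}dE in mdG hD.
have md0 : 0 < max_degree G by rewrite mdG.
have [r rE rk] := min_degree_core md0 hcore.
have fullE v : full 'I_d.+1 (adjacent G) v = (degree G v == max_degree G).
  by rewrite /full card_ord -degreeE mdG eqn_leq (degree_le mdG).
have dgD v : #|nbr (adjacent G) v| <= #|'I_d.+1| by rewrite card_ord -degreeE (degree_le mdG).
have cardN : #|'I_d.+1| <= #|nbr (adjacent G) r| by rewrite card_ord -degreeE rE mdG.
have mk : #|[set x in nbr (adjacent G) r | full 'I_d.+1 (adjacent G) x]| <= k.
  by apply: leq_trans rk; apply: subset_leq_card; apply/subsetP=> x; rewrite !inE fullE.
have nD : 4 * #|vertices G| + 9 * k <= 6 * #|'I_d.+1| by rewrite card_ord hn.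
have [] := overfull_core (@adjacentC _ G) (@adjacentI _ G) (@adjacentV _ G) dgD
  (critical_uncolorable c2 mdG) (critical_valid crG c2 mdG)
  (critical_not_isolated crG) cardN hk mk nD.
rewrite card_ord (eq_bigr (degree G)); last by move=> v _; rewrite degreeE.
rewrite degree_sum_edges hn => on le.
(* With [n] odd this makes [n./2] positive, so that the quotient in [overfull] is a true one. *)
have dn : d.+1 < n.
  have rV : r \in vertices G.
    have : 0 < #|nbr (adjacent G) r| by apply: leq_trans cardN; rewrite card_ord.
    by case/card_gt0P=> y; rewrite inE; apply: adjacentV.
  rewrite -hn (cardsD1 r) rV add1n ltnS -[d.+1]card_ord; apply: leq_trans cardN _.
  apply: subset_leq_card; apply/subsetP=> y; rewrite in_setD1 inE => ry.
  rewrite (adjacentV (y := r)) 1?adjacentC // andbT.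
  by apply: contraTneq ry => ->; rewrite adjacentI.
have nE := odd_double_half n; rewrite on in nE.
have h0 : 0 < n./2 by lia.
rewrite /overfull hn mdG Num.Theory.ltr_pdivlMr ?Num.Theory.ltr0n //.
rewrite -GRing.natrM Num.Theory.ltr_nat.
(* With n = 2h + 1, the degree sum gives 2|E| >= 2h(d + 1) + 2, hence |E| > (d + 1)h. *)
by nia.
Qed.
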